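(* Let $0<\alpha,\beta<1$ and $n\in\mathbb{N}$. Define linear maps $\Gamma_0,\Gamma_1:\mathcal{D}_{\max}^{n}\to\mathbb{C}^{2n}$ by $$\Gamma_0 f:=\big(-f^{[n]}(-1),\dots,-f^{[2n-1]}(-1),\,f^{[n]}(1),\dots,f^{[2n-1]}(1)\big)^{T},$$ $$\Gamma_1 f:=\big(f^{\{n-1\}}(-1),\dots,f^{\{0\}}(-1),\,f^{\{n-1\}}(1),\dots,f^{\{0\}}(1)\big)^{T}.$$ Then $\{\mathbb{C}^{2n},\Gamma_0,\Gamma_1\}$ is a boundary triple for $\mathcal{D}_{\max}^{n}$; that is, the map $f\mapsto(\Gamma_0f,\Gamma_1f)$ from $\mathcal{D}_{\max}^{n}$ to $\mathbb{C}^{2n}\times\mathbb{C}^{2n}$ is surjective and, for all $f,g\in\mathcal{D}_{\max}^{n}$, $$\langle \ell^n[f],g\rangle_{L^2_{\alpha,\beta}}-\langle f,\ell^n[g]\rangle_{L^2_{\alpha,\beta}}=[f,g]_n(1)-[f,g]_n(-1)=\langle\Gamma_1f,\Gamma_0g\rangle_{\mathbb{C}^{2n}}-\langle\Gamma_0f,\Gamma_1g\rangle_{\mathbb{C}^{2n}}.$$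
   Context: Fix $0<\alpha,\beta<1$ and $n\in\mathbb{N}$. Let $L^2_{\alpha,\beta}:=L^2\big((-1,1),(1-x)^\alpha(1+x)^\beta dx\big)$. The Jacobi expression is $\ell[f](x)=-\frac{1}{(1-x)^{\alpha}(1+x)^{\beta}}\big[(1-x)^{\alpha+1}(1+x)^{\beta+1}f'(x)\big]'$, and $\ell^n$ is its $n$-fold composition. It can be written as $\ell^n[f]=\frac{1}{(1-x)^{\alpha}(1+x)^{\beta}}\sum_{k=1}^n(-1)^k\big[a_kf^{(k)}\big]^{(k)}$ with $a_k(x)=C(n,k,\alpha,\beta)(1-x)^{\alpha+k}(1+x)^{\beta+k}$, where the real constants $C(n,k,\alpha,\beta)$ are determined by this identity. Maximal domain: $\mathcal{D}_{\max}^{n}=\{f\in L^2_{\alpha,\beta}: f,f',\dots,f^{(2n-1)}\in AC_{\rm loc}(-1,1),\ \ell^n[f]\in L^2_{\alpha,\beta}\}$. Sesquilinear form: for $f,g\in\mathcal{D}^n_{\max}$ and $x\in(-1,1)$, $$[f,g]_n(x)=\sum_{k=1}^n\sum_{j=1}^k(-1)^{k+j}\Big\{\big[a_k\overline{g}^{(k)}\big]^{(k-j)}(x)f^{(j-1)}(x)-\big[a_kf^{(k)}\big]^{(k-j)}(x)\overline{g}^{(j-1)}(x)\Big\},$$ and $[f,g]_n(\pm1):=\lim_{x\to\pm1^{\mp}}[f,g]_n(x)$; these limits exist and are finite. Quasi-derivatives: $f^{[0]}=f$, $f^{[k]}=f^{(k)}$ for $1\le k\le n-1$, $f^{[n]}=a_nf^{(n)}$,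 $f^{[n+k]}=a_{n-k}f^{(n-k)}-\big[f^{[n+k-1]}\big]'$ for $1\le k\le n-1$. For $n\le m\le 2n-1$, $f^{[m]}(\pm1)$ denotes the limit as $x\to\pm1^{\mp}$. For $1\le j\le n$ fix $C^\infty(-1,1)$ functions $\varphi_j^{\pm}$ and $v_j^\pm$ with: $\varphi_j^+(x)=(1-x)^{j-1}$ and $v_j^+(x)=(1-x)^{-\alpha+n-j}$ for $x$ near $1$, both $0$ for $x$ near $-1$; $\varphi_j^-(x)=(1+x)^{j-1}$ and $v_j^-(x)=(1+x)^{-\beta+n-j}$ for $x$ near $-1$, both $0$ for $x$ near $1$. All of these belong to $\mathcal{D}_{\max}^n$. Define recursively, for $k=1,\dots,n$, $$u_k^{\pm}:=\Big\{v_k^{\pm}-\sum_{j=1}^{k-1}\frac{[\varphi_j^{\pm},v_k^{\pm}]_n(\pm1)}{[\varphi_j^{\pm},u_j^{\pm}]_n(\pm1)}u_j^{\pm}\Big\}\Big/[\varphi_k^{\pm},v_k^{\pm}]_n(\pm1)$$ (the denominators are nonzero). For $f\in\mathcal{D}^n_{\max}$ and $1\le j\le n$ put $f^{\{j-1\}}(1):=(-1)^{j-1}(j-1)!\,[f,u_j^+]_n(1)$ and $f^{\{j-1\}}(-1):=(j-1)!\,[f,u_j^-]_n(-1)$. *)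

(* Defs.v *)
(* Conventions.  A function (-1,1) -> C is represented by a total function
   R -> R[i], whose values outside (-1,1) are never used.  Derivatives, limits
   and integrals of such functions are taken on real and imaginary parts. *)
From HB Require Import structures.
From mathcomp Require Import all_boot all_order all_algebra.
From mathcomp Require Import complex.
From mathcomp Require Import all_classical all_reals all_analysis.

Set Implicit Arguments.
Unset Strict Implicit.
Unset Printing Implicit Defensive.

Import Order.TTheory GRing.Theory Num.Theory.
Import numFieldNormedType.Exports.

Local Open Scope classical_set_scope.
Local Open Scope ring_scope.
Local Open Scope complex_scope.

Definition cmod (R : realType) (z : R[i]) : R := ComplexField.Normc.normc z.

Definition cderivable (R : realType) (f : R -> R[i]) (x : R) : Prop :=
  derivable (fun y : R => complex.Re (f y) : R) x 1 /\
  derivable (fun y : R => complex.Im (f y) : R) x 1.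

Definition cderive (R : realType) (f : R -> R[i]) (x : R) : R[i] :=
  derive1 (fun y : R => complex.Re (f y) : R) x +i*
  derive1 (fun y : R => complex.Im (f y) : R) x.

Definition cderiven (R : realType) (k : nat) (f : R -> R[i]) : R -> R[i] :=
  iter k (@cderive R) f.

Definition ccvg (R : realType) (F : set_system R) (f : R -> R[i]) : Prop :=
  cvg ((fun y : R => complex.Re (f y) : R) @ F) /\
  cvg ((fun y : R => complex.Im (f y) : R) @ F).

Definition clim (R : realType) (F : set_system R) (f : R -> R[i]) : R[i] :=
  lim ((fun y : R => complex.Re (f y) : R) @ F) +i*
  lim ((fun y : R => complex.Im (f y) : R) @ F).

Definition cintegral (R : realType) (D : set R) (f : R -> R[i]) : R[i] :=
  Rintegral lebesgue_measure D (fun y => complex.Re (f y)) +i*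
  Rintegral lebesgue_measure D (fun y => complex.Im (f y)).

(* The list s enumerates non-overlapping subintervals [p.1, p.2] of [a, b]
   from left to right. *)
Definition abs_cont_on (R : realType) (a b : R) (f : R -> R[i]) : Prop :=
  forall e : R, 0 < e -> exists2 d : R, 0 < d &
    forall s : seq (R * R),
      all (fun p => [&& a <= p.1, p.1 <= p.2 & p.2 <= b]) s ->
      pairwise (fun p q => p.2 <= q.1) s ->
      \sum_(p <- s) (p.2 - p.1) < d ->
      \sum_(p <- s) cmod (f p.2 - f p.1) < e.

Definition AC_loc (R : realType) (f : R -> R[i]) : Prop :=
  forall a b : R, -1 < a -> a <= b -> b < 1 -> abs_cont_on a b f.

Definition csmooth (R : realType) (f : R -> R[i]) : Prop :=
  forall (k : nat) (x : R), -1 < x < 1 -> cderivable (cderiven k f) x.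

Definition jweight (R : realType) (al be : R) (x : R) : R :=
  (1 - x) `^ al * (1 + x) `^ be.

Definition jint (R : realType) : set R := `]-1, 1[%classic.

Definition L2ab (R : realType) (al be : R) (f : R -> R[i]) : Prop :=
  [/\ measurable_fun (@jint R) (fun x => complex.Re (f x)),
      measurable_fun (@jint R) (fun x => complex.Im (f x)) &
      lebesgue_measure.-integrable (@jint R)
        (fun x => (cmod (f x) ^+ 2 * jweight al be x)%:E)].

Definition inner_ab (R : realType) (al be : R) (f g : R -> R[i]) : R[i] :=
  cintegral (@jint R)
    (fun x => f x * (g x)^*%C * (jweight al be x)%:C).

Definition jacobi_expr (R : realType) (al be : R) (f : R -> R[i]) : R -> R[i] :=
  fun x => - ((jweight al be x)^-1)%:C *
    cderive (fun y => (jweight (al + 1) (be + 1) y)%:C * cderive f y) x.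

Definition jacobi_pow (R : realType) (al be : R) (n : nat) (f : R -> R[i]) :
    R -> R[i] :=
  iter n (jacobi_expr al be) f.

Definition acoef (R : realType) (al be : R) (C : nat -> R) (k : nat) (x : R) :
    R[i] :=
  (C k * jweight (al + k%:R) (be + k%:R) x)%:C.

(* C k stands for C(n, k, al, be); the identity for smooth f determines the
   values C 1, ..., C n, the other values of C are irrelevant. *)
Definition jacobi_constants (R : realType) (al be : R) (n : nat)
    (C : nat -> R) : Prop :=
  forall f : R -> R[i], csmooth f -> forall x : R, -1 < x < 1 ->
    jacobi_pow al be n f x =
    ((jweight al be x)^-1)%:C *
      \sum_(1 <= k < n.+1) (-1) ^+ k *
        cderiven k (fun y => acoef al be C k y * cderiven k f y) x.

(* cderive has a default value where the derivative does not exist, hence the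
   explicit differentiability requirement.  The highest derivative, of order
   2n, exists almost everywhere only, so that jacobi_pow al be n f is
   meaningful almost everywhere on (-1,1). *)
Definition Dmax (R : realType) (al be : R) (n : nat) (f : R -> R[i]) : Prop :=
  [/\ L2ab al be f,
      forall (k : nat) (x : R), (k < (2 * n).-1)%N -> -1 < x < 1 ->
        cderivable (cderiven k f) x,
      forall k : nat, (k <= (2 * n).-1)%N -> AC_loc (cderiven k f) &
      L2ab al be (jacobi_pow al be n f)].

Definition bracket (R : realType) (al be : R) (C : nat -> R) (n : nat)
    (f g : R -> R[i]) (x : R) : R[i] :=
  \sum_(1 <= k < n.+1) \sum_(1 <= j < k.+1) (-1) ^+ (k + j) *
    (cderiven (k - j)
       (fun y => acoef al be C k y * cderiven k (fun z => (g z)^*%C) y) x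
       * cderiven j.-1 f x
     - cderiven (k - j) (fun y => acoef al be C k y * cderiven k f y) x
       * cderiven j.-1 (fun z => (g z)^*%C) x).

(* The endpoints 1 and -1 are represented by the filters 1^'- and (-1)^'+. *)
Definition bracket_at (R : realType) (al be : R) (C : nat -> R) (n : nat)
    (F : set_system R) (f g : R -> R[i]) : R[i] :=
  clim F (bracket al be C n f g).

(* quasi_up k is the quasi-derivative of order n + k. *)
Fixpoint quasi_up (R : realType) (al be : R) (C : nat -> R) (n : nat)
    (k : nat) (f : R -> R[i]) : R -> R[i] :=
  match k with
  | 0%N => fun x => acoef al be C n x * cderiven n f x
  | k'.+1 => fun x => acoef al be C (n - k) x * cderiven (n - k) f x
                      - cderive (quasi_up al be C n k' f) x
  end.

Definition quasi (R : realType) (al be : R) (C : nat -> R) (n : nat)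
    (m : nat) (f : R -> R[i]) : R -> R[i] :=
  if (m < n)%N then cderiven m f else quasi_up al be C n (m - n) f.

Definition quasi_at (R : realType) (al be : R) (C : nat -> R) (n : nat)
    (F : set_system R) (m : nat) (f : R -> R[i]) : R[i] :=
  clim F (quasi al be C n m f).

(* useq br phi v k is the list [:: u_1; ...; u_k]; the families phi, v and u
   are indexed from 1, and br is the bracket at the endpoint considered. *)
Fixpoint useq (R : realType) (br : (R -> R[i]) -> (R -> R[i]) -> R[i])
    (phi v : nat -> R -> R[i]) (k : nat) : seq (R -> R[i]) :=
  match k with
  | 0%N => [::]
  | k'.+1 =>
    let us := useq br phi v k' in
    let u j := nth (fun=> 0) us j.-1 in
    rcons us (fun x =>
      (v k x - \sum_(1 <= j < k) br (phi j) (v k) / br (phi j) (u j) * u j x)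
      / br (phi k) (v k))
  end.

Definition ufun (R : realType) (br : (R -> R[i]) -> (R -> R[i]) -> R[i])
    (phi v : nat -> R -> R[i]) (k : nat) : R -> R[i] :=
  nth (fun=> 0) (useq br phi v k) k.-1.

Lemma size_useq (R : realType) (br : (R -> R[i]) -> (R -> R[i]) -> R[i])
    (phi v : nat -> R -> R[i]) (k : nat) : size (useq br phi v k) = k.
Proof. by elim: k => //= k IH; rewrite size_rcons IH. Qed.

Lemma nth_useq (R : realType) (br : (R -> R[i]) -> (R -> R[i]) -> R[i])
    (phi v : nat -> R -> R[i]) (k j : nat) : (0 < j <= k)%N ->
  nth (fun=> 0) (useq br phi v k) j.-1 = ufun br phi v j.
Proof.
elim: k => [|k IH] /andP[j0 jk]; first by move: j0; rewrite ltnNge jk.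
move: (jk); rewrite leq_eqVlt => /orP[/eqP -> //|]; rewrite ltnS => jk'.
by rewrite /= nth_rcons size_useq prednK // jk' IH // j0.
Qed.

Lemma ufunE (R : realType) (br : (R -> R[i]) -> (R -> R[i]) -> R[i])
    (phi v : nat -> R -> R[i]) (k : nat) : (0 < k)%N ->
  let u := ufun br phi v in
  u k = fun x =>
    (v k x - \sum_(1 <= j < k) br (phi j) (v k) / br (phi j) (u j) * u j x)
    / br (phi k) (v k).
Proof.
case: k => // k _ /=; rewrite /ufun [useq _ _ _ k.+1]/= nth_rcons size_useq /=.
rewrite ltnn eqxx; apply/funext => x; congr (( _ - _) / _).
rewrite big_nat [RHS]big_nat; apply: eq_bigr => j /andP[j0 jk].
by rewrite nth_useq // j0.
Qed.

(* curly_p j and curly_m j are f^{{j}}(1) and f^{{j}}(-1), for 0 <= j < n, in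
   terms of the families u^+ and u^-. *)
Definition curly_p (R : realType) (al be : R) (C : nat -> R) (n : nat)
    (up : nat -> R -> R[i]) (j : nat) (f : R -> R[i]) : R[i] :=
  (-1) ^+ j * (j`!)%:R * bracket_at al be C n (1 : R)^'- f (up j.+1).

Definition curly_m (R : realType) (al be : R) (C : nat -> R) (n : nat)
    (um : nat -> R -> R[i]) (j : nat) (f : R -> R[i]) : R[i] :=
  (j`!)%:R * bracket_at al be C n (-1 : R)^'+ f (um j.+1).

Definition Gamma0 (R : realType) (al be : R) (C : nat -> R) (n : nat)
    (f : R -> R[i]) : 'cV[R[i]]_(n + n) :=
  col_mx (\col_(i < n) - quasi_at al be C n (-1 : R)^'+ (n + i) f)
         (\col_(i < n) quasi_at al be C n (1 : R)^'- (n + i) f).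

Definition Gamma1 (R : realType) (al be : R) (C : nat -> R) (n : nat)
    (up um : nat -> R -> R[i]) (f : R -> R[i]) : 'cV[R[i]]_(n + n) :=
  col_mx (\col_(i < n) curly_m al be C n um (n - i.+1) f)
         (\col_(i < n) curly_p al be C n up (n - i.+1) f).

Definition cdot (R : realType) (m : nat) (z w : 'cV[R[i]]_m) : R[i] :=
  \sum_(i < m) z i 0 * (w i 0)^*%C.

Definition endpoint_family_p (R : realType) (al : R) (n : nat)
    (phi v : nat -> R -> R[i]) : Prop :=
  forall j : nat, (1 <= j <= n)%N ->
  [/\ csmooth (phi j) /\ csmooth (v j),
      \forall x \near (1 : R)^'-, phi j x = ((1 - x) ^+ j.-1)%:C,
      \forall x \near (1 : R)^'-,
        v j x = ((1 - x) `^ (- al + n%:R - j%:R))%:C,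
      \forall x \near (-1 : R)^'+, phi j x = 0 &
      \forall x \near (-1 : R)^'+, v j x = 0].

Definition endpoint_family_m (R : realType) (be : R) (n : nat)
    (phi v : nat -> R -> R[i]) : Prop :=
  forall j : nat, (1 <= j <= n)%N ->
  [/\ csmooth (phi j) /\ csmooth (v j),
      \forall x \near (-1 : R)^'+, phi j x = ((1 + x) ^+ j.-1)%:C,
      \forall x \near (-1 : R)^'+,
        v j x = ((1 + x) `^ (- be + n%:R - j%:R))%:C,
      \forall x \near (1 : R)^'-, phi j x = 0 &
      \forall x \near (1 : R)^'-, v j x = 0].

(* Main.v *)
Require Import Defs.
From HB Require Import structures.
From mathcomp Require Import all_boot all_order all_algebra.
From mathcomp Require Import complex.
From mathcomp Require Import all_classical all_reals all_analysis.
From mathcomp Require Import measurable_realfun lra ring zify.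

Set Implicit Arguments.
Unset Strict Implicit.
Unset Printing Implicit Defensive.

Import Order.TTheory GRing.Theory Num.Theory.
Import numFieldNormedType.Exports.

Local Open Scope classical_set_scope.
Local Open Scope ring_scope.
Local Open Scope complex_scope.

(* All definitions commute with real and imaginary parts, so the analysis is done
   for real f.  Let t be the distance to an endpoint and a the exponent of the
   weight there.  The functions t^i and q_i = t^(i - a) span a space which ell
   maps to itself, and solving ell f = g by two integrations improves an
   expansion by one order.  Starting from ell^n f in L^2 (Cauchy-Schwarz gives
   the Hoelder estimate of order (1 + a) / 2 for the flux of ell^(n - 1) f), every
   f in the maximal domain equals
     sum_(i < n) c_i t^i + sum_(i < n) d_i q_i + O(t^(n - (1 + a) / 2)),
   the remainder being differentiable 2n - 1 times.  The bracket with t^(k - 1)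
   tends to a multiple of the limit of the quasi-derivative of order 2n - k, to
   which the q_i contribute through a triangular matrix; its diagonal does not
   vanish because a is not an integer and C n <> 0.  The bracket of q_i and q_l
   tends to 0: it has a limit, and it is t^(1 - n - a) times a function smooth up
   to the endpoint.  Hence u_1, ..., u_n is the basis of the span of the q_i dual
   to the quasi-derivatives, [f, u_k] = c_(k - 1), and the bracket of f and g is
   the symplectic form in these coordinates.  The identity defining the C(n, k)
   is available for smooth functions only; subtracting Taylor polynomials
   transfers it to the flux, which gives Green's formula. *)

(** * Absolutely continuous functions *)

(** The derivative of order 2n exists almost everywhere only, so Green's formula rests on the
    fundamental theorem of calculus for absolutely continuous functions, obtained from Radon-Nikodym
    applied to the two monotone parts of a Jordan decomposition. The constants C(n, k) are never
    computed: they enter through their identity on smooth functions and through C n <> 0. The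
    remainder exponent n - (1 + a) / 2 is just good enough. Paired with a function of order -a the
    remainder contributes O(t^((1 - a) / 2)) to the bracket, and it contributes O(t^((1 + a) / 2))
    to the quasi-derivative of order 2n - 1, both tending to 0 because 0 < a < 1. Counting orders
    does not suffice for two singular functions q_i and q_l, whose bracket is a sum of terms of
    possibly negative order. The exponents that occur there are k + 1 - n - a, none of which is 0;
    an expansion without constant term that has a finite limit has limit 0. In the recursion for u_k
    all the denominators [phi_j, u_j] turn out to be 1, because the u_j already constructed are dual
    to the scaled quasi-derivatives. *)

Lemma near_derive1 (R : realType) (f g : R -> R) (x : R) :
  (\forall y \near x, f y = g y) -> derive1 f x = derive1 g x.
Proof. by move=> h; rewrite !derive1E; exact: near_eq_derive. Qed.

Lemma near_derivable (R : realType) (f g : R -> R) (x : R) :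
  (\forall y \near x, f y = g y) -> derivable f x 1 -> derivable g x 1.
Proof. by move=> h; apply: near_eq_derivable. Qed.

Lemma derive1D (R : realType) (f g : R -> R) (x : R) :
  derivable f x 1 -> derivable g x 1 ->
  derive1 (fun y => f y + g y) x = derive1 f x + derive1 g x.
Proof. by move=> df dg; rewrite !derive1E (deriveD df dg). Qed.

Lemma derive1_const (R : realType) (c : R) : derive1 (fun=> c : R) = fun=> 0.
Proof. by apply/funext => x; exact: derive1_cst. Qed.

Lemma near_derive1_shift (R : realType) (f g : R -> R) (c x : R) :
  (\forall y \near x, f y = g y + c) -> derivable g x 1 ->
  derivable f x 1 /\ derive1 f x = derive1 g x.
Proof.
move=> fg dg; have dc : derivable (fun=> c : R) x 1 by exact: derivable_cst.
split.
  apply: (near_derivable (f := fun y => g y + c)); last exact: derivableD.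
  by apply: filterS fg => y ->.
by rewrite (near_derive1 fg) derive1D // derive1_const addr0.
Qed.

Section AbsolutelyContinuous.
Variable R : realType.
Implicit Types (a b c d : R) (F G : R -> R) (s : seq (R * R)).
Local Notation TV := total_variation.
Local Notation BV := bounded_variation.

(** * Absolute continuity and total variation *)

Definition subitvs a b s :=
  all (fun p : R * R => [&& a <= p.1, p.1 <= p.2 & p.2 <= b]) s &&
  pairwise (fun p q : R * R => p.2 <= q.1) s.

Definition ac a b F := forall e : R, 0 < e -> exists2 d : R, 0 < d &
  forall s, subitvs a b s ->
    \sum_(p <- s) (p.2 - p.1) < d -> \sum_(p <- s) `|F p.2 - F p.1| < e.

(** Partitions come as increasing lists of points; read as lists of consecutive intervals they can
    be fed to the definition of [ac]. *)
Lemma variation_zip a b F (l : seq R) :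
  variation a b F l = \sum_(p <- zip (a :: l) l) `|F p.2 - F p.1|.
Proof.
elim: l a => [|x l IH] a; first by rewrite /variation /= !big_nil.
by rewrite big_cons -IH /variation big_nat_recl.
Qed.

Lemma sum_steps c d (l : seq R) : itv_partition c d l ->
  \sum_(p <- zip (c :: l) l) (p.2 - p.1) = d - c.
Proof.
elim: l c => [|x l IH] c [/= pl /eqP ld]; first by rewrite big_nil -ld subrr.
rewrite big_cons /= IH; last by split; [case/andP: pl|apply/eqP].
by rewrite addrC addrA subrK.
Qed.

Lemma subitvs_steps c d (l : seq R) : itv_partition c d l ->
  subitvs c d (zip (c :: l) l).
Proof.
elim: l c => [|x l IH] c pl //.
have xd := itv_partition_cons pl.
have cx : c < x by case: pl => /= /andP[].
have xled : x <= d := itv_partition_le xd.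
have /andP[al pws] := IH _ xd.
rewrite /subitvs /= !lexx (ltW cx) xled /=; apply/andP; split; last first.
  apply/andP; split => //; apply/allP => p pz; move/allP : al => /(_ p pz).
  by case/and3P.
apply/allP => p pz; move/allP : al => /(_ p pz) /and3P[xp -> ->].
by rewrite (le_trans (ltW cx) xp).
Qed.

(** Lets one interval of a family be replaced by a partition of it, so that suprema over partitions
    can be taken one interval at a time. *)
Lemma subitvs_refine a b s0 (p : R * R) s1 s2 :
  subitvs a b (s0 ++ p :: s2) -> subitvs p.1 p.2 s1 ->
  subitvs a b (s0 ++ s1 ++ s2).
Proof.
move=> /andP[]; rewrite all_cat /= => /and3P[a0 /and3P[ap pp pb] a2].
rewrite pairwise_cat /= allrel_consr => /and3P[/andP[r0p r02] p0 /andP[rp2 p2]].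
move=> /andP[al pws]; apply/andP; split.
  rewrite !all_cat a0 a2 andbT /=; apply/allP => q qs.
  have /and3P[? ? ?] := allP al q qs.
  by rewrite (le_trans ap) //= (le_trans _ pb) // andbT.
rewrite !pairwise_cat p0 pws p2 /= !andbT allrel_catr r02 andbT.
apply/andP; split.
  apply/allrelP => x y xs ys; have /and3P[? ? ?] := allP al y ys.
  by rewrite (le_trans (allP r0p x xs)).
apply/allrelP => x y xs ys; have /and3P[? ? ?] := allP al x xs.
by rewrite (le_trans _ (allP rp2 y ys)).
Qed.

Lemma ac_dist a b F : ac a b F -> forall e, 0 < e -> exists2 d, 0 < d &
  forall x y, a <= x <= b -> a <= y <= b -> `|x - y| < d -> `|F x - F y| < e.
Proof.
move=> acF e e0; have [d d0 H] := acF e e0; exists d => //.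
have W x y : a <= x <= b -> a <= y <= b -> `|x - y| < d -> x <= y ->
    `|F x - F y| < e.
  move=> /andP[ax xb] /andP[ay yb] xyd xy.
  have := H [:: (x, y)]; rewrite !big_seq1 /= distrC; apply.
    by rewrite /subitvs /= ax xy yb.
  by rewrite -(ger0_norm (_ : 0 <= y - x)) ?subr_ge0 // distrC.
move=> x y xab yab xyd; have [xy|/ltW yx] := leP x y; first exact: W.
by rewrite distrC; apply: W => //; rewrite distrC.
Qed.

(** Refining the intervals does not change their total length, so the bound on increments survives
    the supremum over the partitions of every interval. *)
Lemma ac_TV_le a b F (e d : R) :
  (forall s, subitvs a b s -> \sum_(p <- s) (p.2 - p.1) < d ->
     \sum_(p <- s) `|F p.2 - F p.1| <= e) ->
  forall s, subitvs a b s -> \sum_(p <- s) (p.2 - p.1) < d ->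
  (\sum_(p <- s) TV p.1 p.2 F <= e%:E)%E.
Proof.
move=> H s.
(* The intervals of [s0] are measured by increments, those of [s] by variation. The induction cuts
   the first interval of [s] by an arbitrary partition and moves the pieces into [s0]. *)
suff: forall s0, subitvs a b (s0 ++ s) ->
    \sum_(p <- s0 ++ s) (p.2 - p.1) < d ->
    ((\sum_(p <- s0) `|F p.2 - F p.1|)%:E + \sum_(p <- s) TV p.1 p.2 F
       <= e%:E)%E.
  by move=> /(_ [::]); rewrite !big_nil /= add0e.
elim: s => [|p s IH] s0 ok len.
  by rewrite big_nil adde0 lee_fin; rewrite cats0 in ok len; apply: H.
have pp : p.1 <= p.2.
  by move/andP : ok => [+ _]; rewrite all_cat /= => /and3P[_ /and3P[]].
rewrite big_cons.
have step l : itv_partition p.1 p.2 l ->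
  ((\sum_(p <- s0) `|F p.2 - F p.1|)%:E + ((variation p.1 p.2 F l)%:E + 
   \sum_(p <- s) TV p.1 p.2 F) <= e%:E)%E.
  move=> pl; have h1 : subitvs a b ((s0 ++ zip (p.1 :: l) l) ++ s).
    by rewrite -catA; apply: subitvs_refine ok _; exact: subitvs_steps.
  have h2 : \sum_(p <- (s0 ++ zip (p.1 :: l) l) ++ s) (p.2 - p.1) < d.
    by move: len; rewrite !big_cat /= big_cons (sum_steps pl) addrA.
  have := IH _ h1 h2.
  by rewrite big_cat -(variation_zip p.1 p.2) EFinD -addeA.
have S0 : (0 <= \sum_(p <- s) TV p.1 p.2 F)%E.
  rewrite big_seq; apply: sume_ge0 => q qs; apply: total_variation_ge0.
  move/andP : ok => [+ _]; rewrite all_cat /= => /and3P[_ _ /allP /(_ q qs)].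
  by case/and3P.
(* Finiteness of the other variations, read off from one partition of [p], is what allows them to be
   moved to the other side below. *)
have SF : (\sum_(p <- s) TV p.1 p.2 F)%E \is a fin_num.
  move: pp; rewrite le_eqVlt => /orP[/eqP pe|pp].
    have := step [::]; rewrite /variation big_geq // add0e => K.
    rewrite ge0_fin_numE // (le_lt_trans _ (ltry e)) //.
    apply: le_trans (K _); last by split=> //=; apply/eqP.
    by rewrite leeDr // lee_fin sumr_ge0.
  rewrite ge0_fin_numE // (le_lt_trans _ (ltry e)) //.
  apply: le_trans (step [:: p.2] _); last exact: itv_partition1.
  have v0 : 0 <= variation p.1 p.2 F [:: p.2] by rewrite variation_zip sumr_ge0.
  by rewrite addeA leeDr // adde_ge0 // lee_fin // sumr_ge0.
have TVle : (TV p.1 p.2 F <=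
    (e - \sum_(p <- s0) `|F p.2 - F p.1| -
     fine (\sum_(p <- s) TV p.1 p.2 F))%:E)%E.
  apply: ge_ereal_sup => _ [_ [l pl <-] <-]; rewrite lee_fin.
  have := step l pl; rewrite -(fineK SF) -!EFinD lee_fin; lra.
rewrite -(fineK SF) in step *.
apply: le_trans (leeD2l _ (leeD2r _ TVle)) _.
by rewrite -!EFinD lee_fin; lra.
Qed.

(** Pieces shorter than the [d] belonging to the bound 1 have variation at most 1, and finitely many
    of them cover the interval. *)
Lemma ac_BV a b F : a < b -> ac a b F -> BV a b F.
Proof.
move=> ab acF; apply/bounded_variationP; first exact: ltW.
have [d d0 H] := acF 1 ltr01.
have T1 c c' : a <= c -> c <= c' -> c' <= b -> c' - c < d ->
    (TV c c' F <= 1%:E)%E.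
  move=> ac_ cc cb ccd.
  have := @ac_TV_le a b F 1 d (fun s h1 h2 => ltW (H s h1 h2)) [:: (c, c')].
  by rewrite !big_seq1 /=; apply=> //; rewrite /subitvs /= ac_ cc cb.
pose M := (Num.truncn ((b - a) / d)).+1.
have hM : (b - a) / M%:R < d.
  rewrite ltr_pdivrMr ?ltr0n // mulrC -ltr_pdivrMr //.
  exact: truncnS_gt.
have M0 : 0 < M%:R :> R by rewrite ltr0n.
pose h := (b - a) / M%:R.
have h0 : 0 < h by rewrite divr_gt0 // subr_gt0.
have Mh : a + M%:R * h = b by rewrite /h mulrC divfK ?gt_eqF // addrC subrK.
have K k : (k <= M)%N -> (TV a (a + k%:R * h) F <= k%:R%:E)%E.
  elim: k => [|k IH] kM; first by rewrite mul0r addr0 total_variationxx.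
  have st : a + k%:R * h <= a + k.+1%:R * h.
    by rewrite lerD2l ler_wpM2r ?ler_nat // ltW.
  have ak : a <= a + k%:R * h by rewrite lerDl mulr_ge0 // ltW.
  rewrite (total_variationD F ak st) -[X in (_ <= X%:E)%E]natr1 EFinD.
  apply: leeD; first exact: IH (ltnW kM).
  apply: T1 => //; first by rewrite -[leRHS]Mh lerD2l ler_wpM2r ?ler_nat // ltW.
  by apply: le_lt_trans hM; rewrite -/h -natr1; lra.
rewrite ge0_fin_numE; last exact/total_variation_ge0/ltW.
by rewrite -{1}Mh (le_lt_trans (K M _)) // ltry.
Qed.

(** By additivity the increments of the variation function are variations over subintervals, which
    [ac_TV_le] controls; halving [e] restores the strict inequality. *)
Lemma ac_total_variation a b F : a < b -> ac a b F ->
  ac a b (fun x => fine (TV a x F)).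
Proof.
move=> ab acF e e0; have bv := ac_BV ab acF.
have [d d0 H] := acF (e / 2) (divr_gt0 e0 (ltr0Sn _ 1)).
exists d => // s sok sd.
have := ac_TV_le (fun s h1 h2 => ltW (H s h1 h2)) sok sd.
have fin c c' : a <= c -> c <= c' -> c' <= b -> TV c c' F \is a fin_num.
  move=> ac_ cc cb; apply/bounded_variationP => //.
  apply: (bounded_variationl _ cb) => //.
  by apply: (bounded_variationr _ _ bv) => //; rewrite (le_trans cc).
have -> : (\sum_(p <- s) TV p.1 p.2 F)%E =
    (\sum_(p <- s) `|fine (TV a p.2 F) - fine (TV a p.1 F)|)%:E.
  rewrite -sumEFin big_seq [RHS]big_seq; apply: eq_bigr => p ps.
  move/andP : sok => [/allP /(_ p ps) /and3P[ap pp pb] _].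
  have a2 := le_trans ap pp.
  rewrite (total_variationD F ap pp) fineD ?fin //; last exact: le_trans pb.
  rewrite addrAC subrr add0r ger0_norm ?fineK ?fin //.
  exact/fine_ge0/total_variation_ge0.
by rewrite lee_fin => /le_lt_trans; apply; lra.
Qed.

(** Composition with this retraction onto [a, b] extends a function to the line by constants and
    keeps monotonicity and absolute continuity, as a cumulative function requires. *)
Definition clamp a b (x : R) := Num.max a (Num.min b x).

Lemma clamp_le a b (x y : R) : x <= y -> clamp a b x <= clamp a b y.
Proof.
by move=> xy; rewrite /clamp; apply: le_max2 => //; apply: le_min2.
Qed.

Lemma clamp_in a b (x : R) : a <= b -> a <= clamp a b x <= b.
Proof.
by move=> ab; rewrite /clamp le_max lexx /= ge_max ab ge_min lexx.
Qed.

Lemma clamp_id a b (x : R) : a <= x <= b -> clamp a b x = x.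
Proof.
by move=> /andP[ax xb]; rewrite /clamp (min_idPr xb) (max_idPr ax).
Qed.

Lemma clamp_lip a b (x y : R) : a <= b -> x <= y ->
  clamp a b y - clamp a b x <= y - x.
Proof.
move=> ab xy; rewrite /clamp /Num.max /Num.min.
by case: (ltP b y) => ?; case: (ltP b x) => ?; do 2 case: ltP => ?; lra.
Qed.

Lemma ac_clamp a b F : a <= b -> ac a b F -> forall c d,
  ac c d (F \o clamp a b).
Proof.
move=> ab acF c d e e0; have [r r0 H] := acF e e0; exists r => // s sok sr.
pose g (p : R * R) := (clamp a b p.1, clamp a b p.2).
have := H [seq g p | p <- s]; rewrite !big_map /=; apply.
  move/andP: sok => [al pws]; apply/andP; split.
    rewrite all_map; apply/allP => p ps /=.
    have /and3P[_ pp _] := allP al p ps.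
    by rewrite clamp_le // (andP (clamp_in p.1 ab)).1 (andP (clamp_in p.2 ab)).2.
  rewrite pairwise_map; apply: sub_pairwise pws => p q /=; exact: clamp_le.
apply: le_lt_trans sr; rewrite big_seq [leRHS]big_seq; apply: ler_sum => p ps.
move/andP: sok => [/allP /(_ p ps) /and3P[_ pp _] _]; exact: clamp_lip.
Qed.

Lemma ac_sub_fun a b F G : ac a b F -> ac a b G -> ac a b (fun x => F x - G x).
Proof.
move=> acF acG e e0; have e2 := divr_gt0 e0 (ltr0Sn R 1).
have [d1 d10 H1] := acF _ e2; have [d2 d20 H2] := acG _ e2.
exists (Num.min d1 d2); first by rewrite lt_min d10.
move=> s sok; rewrite lt_min => /andP[s1 s2].
apply: (@le_lt_trans _ _ (\sum_(p <- s) (`|F p.2 - F p.1| + `|G p.2 - G p.1|))).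
  apply: ler_sum => p _; rewrite -[X in _ <= _ + X]normrN.
  by apply: le_trans (ler_normD _ _); rewrite le_eqVlt; apply/orP; left; apply/eqP; congr (`| _ |); ring.
rewrite big_split /=; have := H1 s sok s1; have := H2 s sok s2; lra.
Qed.

(** * The Lebesgue-Stieltjes measure of a monotone absolutely continuous function *)

Section StieltjesDomination.
Variables (G : R -> R) (A B : R).
Hypotheses (AB : A < B) (ndG : {homo G : x y / x <= y})
  (acG : forall c d, ac c d G).

Lemma ac_continuous : continuous G.
Proof.
move=> x; apply/cvgrPdist_lt => e e0.
have [d d0 H] := ac_dist (acG (x - 1) (x + 1)) e0.
near=> y; apply: H; first by apply/andP; split; lra.
  suff : `|x - y| < 1 by rewrite ltr_distl => /andP[? ?]; apply/andP; split; lra.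
  by near: y; exists 1 => //=.
by near: y; exists d => //=.
Unshelve. all: by end_near. Qed.

Let rcG : right_continuous G.
Proof. by move=> x; apply: cvg_at_right_filter; exact: ac_continuous. Qed.

Let Gc : cumulative R R := HB.pack G (isCumulative.Build R _ R G ndG rcG).

Let mu := lebesgue_stieltjes_measure Gc.

Let muoc (x y : R) : x <= y -> mu `]x, y]%classic = (G y - G x)%:E.
Proof.
move=> xy; have -> : mu `]x, y]%classic = ((wlength Gc)^*%mu `]x, y]%classic)%E by [].
rewrite measurable_mu_extE /=;
  last exact: is_ocitv.
by rewrite wlength_itv_bnd.
Qed.

Let mD : measurable (`]A, B[%classic : set (measurableTypeR R)).
Proof. exact: measurable_itv. Qed.

Let muD : (mu `]A, B[%classic < +oo)%E.
Proof.
apply: (@le_lt_trans _ _ (mu `]A, B]%classic)); last by rewrite muoc ?ltry // ltW.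
by apply: le_measure; rewrite ?inE; [exact: measurable_itv..|exact: subset_itv_oo_oc].
Qed.

(** The restriction to a bounded interval makes the measure finite, as Radon-Nikodym is applied to
    it. *)
Let nu : {finite_measure set (measurableTypeR R) -> \bar R} := mfrestr mD muD.

(** An open set is a countable disjoint union of open intervals. Finitely many of them form an
    admissible family, and the bound passes to the limit of the partial sums. *)
Let mu_open (U : set R) (e d : R) :
  (forall s, subitvs A B s -> \sum_(p <- s) (p.2 - p.1) < d ->
     \sum_(p <- s) `|G p.2 - G p.1| <= e) ->
  open U -> U `<=` `]A, B[ -> (lebesgue_measure U < d%:E)%E ->
  (mu U <= e%:E)%E.
Proof.
move=> H oU UAB Ud.
pose J := open_disjoint_itv oU.
have JE i : J i = `]inf (J i), sup (J i)[%classic.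
  have [J0|/set0P J0] := eqVneq (J i) set0.
    by rewrite J0 inf0 sup0 set_itvoo0.
  have sub : J i `<=` `]A, B[.
    apply: subset_trans UAB; rewrite [X in _ `<=` X](open_disjoint_itv_bigcup oU).
    exact: bigcup_sup.
  have := interval_bounded_interior (@open_disjoint_itv_is_interval _ _ oU i).
  rewrite (_ : (J i)^° = J i); last first.
    apply/seteqP; split; first exact: interior_subset.
    by have := @open_disjoint_itv_open _ _ oU i; rewrite openE.
  move=> h.
  transitivity [set r | inf (J i) < r < sup (J i)].
    apply: h.
    + by exists A => x /sub /=; rewrite in_itv /= => /andP[/ltW].
    + by exists B => x /sub /=; rewrite in_itv /= => /andP[_ /ltW].
  by apply/seteqP; split=> x /=; rewrite in_itv.
have sub i : J i `<=` `]A, B[.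
  apply: subset_trans UAB; rewrite [X in _ `<=` X](open_disjoint_itv_bigcup oU).
  exact: bigcup_sup.
have mJ i : measurable (J i : set (measurableTypeR R)).
  by rewrite JE; exact: measurable_itv.
have triv := @open_disjoint_itv_trivIset _ _ oU.
have bounds i : J i !=set0 -> [/\ A <= inf (J i), inf (J i) < sup (J i) & sup (J i) <= B].
  move=> J0; split.
  - apply: lb_le_inf => // x /sub /=; by rewrite in_itv /= => /andP[/ltW].
  - case: J0 => x Jx; have : (`]inf (J i), sup (J i)[%classic) x by rewrite -JE.
    by rewrite /= in_itv /= => /andP[]; exact: lt_trans.
  - apply: ge_sup => // x /sub /=; by rewrite in_itv /= => /andP[_ /ltW].
have inJ k (z : R) : inf (J k) < z < sup (J k) -> J k z.
  by move=> zk; rewrite JE /= in_itv.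
have UE : U = \bigcup_i J i := open_disjoint_itv_bigcup oU.
have -> : mu U = (\sum_(0 <= i <oo) mu (J i))%E.
  rewrite [in LHS]UE; apply: measure_semi_bigcup => //.
  by rewrite -UE; exact: open_measurable.
apply: lime_le; first exact: is_cvg_nneseries.
apply: nearW => N.
(* [subitvs] wants the intervals from left to right, hence the sorting. Empty components are removed
   because [inf] and [sup] of the empty set are default values, possibly outside [A, B]. *)
pose idx := sort (fun i j => inf (J i) <= inf (J j)) [seq i <- index_iota 0 N | `[< J i !=set0 >]].
have sumE (f : nat -> R) (m : nat -> \bar R) :
    (forall i, J i !=set0 -> (m i <= (f i)%:E)%E) -> (forall i, ~ (J i !=set0) -> m i = 0%E) ->
    (\sum_(0 <= i < N) m i <= (\sum_(i <- idx) f i)%:E)%E.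
  move=> h1 h2; rewrite (perm_big _ (permEl (perm_sort _ _))) /= big_filter -sumEFin.
  rewrite [leRHS]big_mkcond; apply: lee_sum => i _; case: ifPn => /asboolP Ji; first exact: h1.
  by rewrite h2.
apply: (le_trans (sumE (fun i => G (sup (J i)) - G (inf (J i))) _ _ _)).
- move=> i Ji; have [_ ltJ _] := bounds i Ji.
  rewrite -muoc; last exact: ltW.
  apply: le_measure; rewrite ?inE; [exact: mJ|exact: measurable_itv|].
  by rewrite [X in X `<=` _]JE; exact: subset_itv_oo_oc.
- by move=> i /set0P/negP/negPn/eqP ->; exact: measure0.
rewrite lee_fin.
pose s := [seq (inf (J i), sup (J i)) | i <- idx].
have idxJ i : i \in idx -> J i !=set0.
  by rewrite mem_sort mem_filter => /andP[/asboolP].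
have := H s; rewrite !big_map /= => /(_ _ _) K.
apply: le_trans (K _ _); first by apply: ler_sum => i _; exact: ler_norm.
- apply/andP; split.
    apply/allP => p /mapP[i /idxJ /bounds [h1 h2 h3] ->] /=.
    by rewrite h1 ltW.
  rewrite pairwise_map.
  have pw1 : pairwise (fun i j => inf (J i) <= inf (J j)) idx.
    rewrite -sorted_pairwise; last by move=> ? ? ?; exact: le_trans.
    by apply: sort_sorted => i j; exact: le_total.
  have pw2 : pairwise (fun i j => i != j) idx.
    by rewrite -uniq_pairwise sort_uniq filter_uniq // iota_uniq.
  have : pairwise [rel i j | (inf (J i) <= inf (J j)) && (i != j)] idx.
    by rewrite pairwise_relI; apply/andP.
  move=> pws; apply: (sub_in_pairwise _ (allss idx) pws).
  move=> i j /idxJ/bounds[_ i1 _] /idxJ/bounds[_ j1 _] /= /andP[ij nij].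
  (* Otherwise two distinct components would overlap, and the midpoint below would lie in both. *)
  rewrite leNgt; apply/negP => lt.
  have [z] : (J i `&` J j) !=set0.
    exists ((inf (J j) + Num.min (sup (J i)) (sup (J j))) / 2).
    have m1 : Num.min (sup (J i)) (sup (J j)) <= sup (J i) by rewrite ge_min lexx.
    have m2 : Num.min (sup (J i)) (sup (J j)) <= sup (J j) by rewrite ge_min lexx orbT.
    have m3 : inf (J j) < Num.min (sup (J i)) (sup (J j)) by rewrite lt_min lt.
    by split; apply: inJ; apply/andP; split; lra.
  move=> [zi zj]; move: nij => /eqP; apply.
  by apply: triv => //; exists z.
- rewrite -lte_fin; apply: le_lt_trans Ud.
  apply: (@le_trans _ _ (\sum_(0 <= i < N) lebesgue_measure (J i))%E).
    rewrite (perm_big _ (permEl (perm_sort _ _))) /= big_filter -sumEFin.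
    rewrite [leLHS]big_mkcond; apply: lee_sum => i _; case: ifPn => // /asboolP Ji.
    rewrite [X in (_ <= lebesgue_measure X)%E]JE lebesgue_measure_itv /= lte_fin.
    by have [_ -> _] := bounds i Ji; rewrite EFinB.
  rewrite [X in (_ <= lebesgue_measure X)%E]UE measure_semi_bigcup //; last first.
    by rewrite -UE; exact: open_measurable.
  by apply: nneseries_lim_ge => i _ _; exact: measure_ge0.
Qed.

(** Outer regularity encloses a null set in an open set of length below [d], to which [mu_open]
    applies; [e] is arbitrary. *)
Let nu_dom : nu `<< (@lebesgue_measure R).
Proof.
move=> N N0 X mX XN; have X0 : lebesgue_measure X = 0%E by exact: N0.
rewrite /nu /= /mfrestr /mrestr.
have XD0 : lebesgue_measure (X `&` `]A, B[) = 0%E.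
  apply/eqP; rewrite eq_le measure_ge0 andbT -X0.
  by apply: le_measure; rewrite ?inE //; apply: measurableI.
apply/eqP; rewrite eq_le; apply/andP; split; last exact: measure_ge0.
apply/lee_addgt0Pr => e e0; rewrite add0e.
have [d d0 H] := acG A B e0.
have XDlt : (lebesgue_measure (X `&` `]A, B[) < +oo)%E by rewrite XD0.
have [U [oU XU Ud]] :=
  @lebesgue_regularity_outer R (X `&` `]A, B[) d (measurableI _ _ mX mD) XDlt d0.
pose V := U `&` `]A, B[.
have oV : open V by apply: openI => //; exact: itv_open.
apply: (@le_trans _ _ (mu V)).
  apply: le_measure; rewrite ?inE; [exact: measurableI|exact: open_measurable|].
  by move=> x [xX xD]; split => //; apply: XU.
apply: (@mu_open V e d) => //.
- by move=> s sok sd; apply/ltW/H.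
- by move=> x [].
- apply: le_lt_trans Ud; apply: (@le_trans _ _ (lebesgue_measure U)).
    by apply: le_measure; rewrite ?inE; [exact: open_measurable|exact: open_measurable|move=> x []].
  have -> := @measureDI _ _ _ (@lebesgue_measure R) U (X `&` `]A, B[)
    (open_measurable oU) (measurableI _ _ mX mD).
  rewrite [X in (_ + X)%E](_ : _ = 0%E) ?adde0 //.
  apply/eqP; rewrite eq_le measure_ge0 andbT -XD0; apply: le_measure; rewrite ?inE.
  + by apply: measurableI; [exact: open_measurable|exact: measurableI].
  + exact: measurableI.
  + by move=> x [].
Qed.

(** The density is that of Radon-Nikodym. Integrals from minus infinity are the form in which it
    will be differentiated; the restricted measure has no mass to the left of [A]. *)
Lemma ac_mono_density : exists2 f : R -> R,
  (@lebesgue_measure R).-integrable setT (EFin \o f) &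
  forall x, A < x < B -> G x - G A = \int[lebesgue_measure]_(t in `]-oo, x]) f t.
Proof.
have [f [f0 ffin intf fE]] := radon_nikodym_sigma_finite nu_dom.
have fEq : EFin \o (fine \o f) = f by apply/funext => x /=; rewrite fineK.
exists (fine \o f); first by rewrite fEq.
move=> x /andP[Ax xB].
rewrite /Rintegral [X in _ = fine X](_ : _ = \int[lebesgue_measure]_(t in `]-oo, x]) f t)%E;
  last by apply: eq_integral => t _ /=; rewrite fineK.
rewrite -fE; last exact: measurable_itv.
transitivity (fine (mu `]A, x]%classic)); first by rewrite muoc ?ltW.
congr (fine (lebesgue_stieltjes_measure Gc _)).
apply/(@seteqP R); split => y /=; rewrite !in_itv /=; last by case=> -> /andP[->].
by move=> /andP[Ay yx]; rewrite yx Ay (le_lt_trans yx xB).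
Qed.

End StieltjesDomination.

Lemma integrable_itv (i : interval R) (f : R -> R) :
  (@lebesgue_measure R).-integrable setT (EFin \o f) ->
  (@lebesgue_measure R).-integrable [set` i] (EFin \o f).
Proof. by apply: integrableS => //; exact: measurable_itv. Qed.

(** Jordan decomposition: with V the variation function, V and V - F are nondecreasing and
    absolutely continuous, so each has a density. *)
Lemma ac_density a b F : a < b -> ac a b F ->
  exists2 f : R -> R, (@lebesgue_measure R).-integrable setT (EFin \o f) &
  forall x, a <= x <= b -> F x - F a =
    \int[lebesgue_measure]_(t in `]-oo, x]) f t -
    \int[lebesgue_measure]_(t in `]-oo, a]) f t.
Proof.
move=> ab acF; have ab' := ltW ab.
pose V x := fine (TV a x F); pose W x := V x - F x.
have acV : ac a b V := ac_total_variation ab acF.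
have acW : ac a b W by exact: ac_sub_fun.
have bv := ac_BV ab acF.
have fin x : a <= x <= b -> TV a x F \is a fin_num.
  move=> /andP[ax xb]; apply/bounded_variationP => //.
  exact: (bounded_variationl _ xb).
have VD x y : a <= x -> x <= y -> y <= b -> V y - V x = fine (TV x y F).
  move=> ax xy yb; rewrite /V (total_variationD F ax xy) fineD ?fin ?ax //=.
  - by rewrite addrAC subrr add0r.
  - by rewrite (le_trans xy).
  - apply/bounded_variationP => //; apply: (bounded_variationl _ yb) => //.
    by apply: (bounded_variationr _ _ bv) => //; rewrite (le_trans xy).
have VF x y : a <= x -> x <= y -> y <= b -> `|F y - F x| <= V y - V x.
  move=> ax xy yb; rewrite VD // -lee_fin fineK ?total_variation_ge //.
  apply/bounded_variationP => //; apply: (bounded_variationl _ yb) => //.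
  by apply: (bounded_variationr _ _ bv) => //; rewrite (le_trans xy).
have ndV : {homo V \o clamp a b : x y / x <= y}.
  move=> x y xy /=; have /andP[? ?] := clamp_in x ab'.
  have /andP[? ?] := clamp_in y ab'; rewrite -subr_ge0.
  by apply: le_trans (VF _ _ _ (clamp_le _ _ xy) _) => //.
have ndW : {homo W \o clamp a b : x y / x <= y}.
  move=> x y xy /=; have /andP[? ?] := clamp_in x ab'.
  have /andP[? ?] := clamp_in y ab'; rewrite /W.
  have := VF (clamp a b x) (clamp a b y); rewrite clamp_le // => /(_ _ isT _) K.
  by have := le_trans (ler_norm _) (K _ _); lra.
(* The margin puts the closed interval [a, b] inside the open interval on which the densities
   represent V and W. *)
have AB : a - 1 < b + 1 by lra.
have [f1 if1 E1] := ac_mono_density AB ndV (ac_clamp ab' acV).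
have [f2 if2 E2] := ac_mono_density AB ndW (ac_clamp ab' acW).
exists (fun x => f1 x - f2 x).
  exact: (integrableB measurableT if1 if2).
move=> x /[dup] xab /andP[ax xb].
have IB y : \int[lebesgue_measure]_(t in `]-oo, y]) (f1 t - f2 t) =
    \int[lebesgue_measure]_(t in `]-oo, y]) f1 t -
    \int[lebesgue_measure]_(t in `]-oo, y]) f2 t.
  have i1 := integrable_itv `]-oo, y] if1.
  have i2 := integrable_itv `]-oo, y] if2.
  by rewrite RintegralB.
rewrite !IB -!E1 -?E2; try by apply/andP; split; lra.
rewrite /= (clamp_id (_ : a <= a <= b)) ?lexx // (clamp_id xab) /W; ring.
Qed.

Lemma integrable_locally_setT (f : R -> R) :
  (@lebesgue_measure R).-integrable setT (EFin \o f) ->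
  locally_integrable setT f.
Proof.
by move=> intf; have := integrable_locally measurableT intf; rewrite patch_setT.
Qed.

(** Lebesgue's differentiation theorem, applied to the density of F. *)
Theorem ac_FTC a b F : a < b -> ac a b F ->
  exists f : R -> R, [/\ (@lebesgue_measure R).-integrable setT (EFin \o f),
  {ae lebesgue_measure, forall x, a < x < b -> derivable F x 1 /\ derive1 F x = f x} &
  F b - F a = \int[lebesgue_measure]_(t in `]a, b[) f t].
Proof.
move=> ab acF; have [f intf FE] := ac_density ab acF.
exists f; split => //.
  have := @FTC1Ny _ f (fun y => integrable_itv `]-oo, y] intf)
    (integrable_locally_setT intf).
  apply: filterS; first exact: (ae_filter_ringOfSetsType lebesgue_measure).
  move=> x [dx fx] xab.
  have alg (u v p q : R) : p - q = u - v -> p = u + (q - v) by lra.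
  pose c := F a - \int[lebesgue_measure]_(t in `]-oo, a]) f t.
  have E : \near x, F x = \int[lebesgue_measure]_(t in `]-oo, x]) f t + c.
    near=> y; have yab : a <= y <= b.
      suff : y \in `]a, b[ by rewrite in_itv /= => /andP[/ltW -> /ltW ->].
      by near: y; apply: near_in_itvoo; rewrite in_itv.
    exact: alg (FE y yab).
  by have [? ->] := near_derive1_shift E dx.
rewrite FE ?lexx ?ltW //.
rewrite Rintegral_itvB ?bnd_simp //; [|exact: integrable_itv|exact: ltW].
by apply/esym/Rintegral_itv_bndo_bndc; exact: integrable_itv.
Unshelve. all: by end_near. Qed.

Corollary ac_ae_derivable a b F : a < b -> ac a b F ->
  {ae lebesgue_measure, forall x, a < x < b -> derivable F x 1}.
Proof.
move=> ab /(ac_FTC ab)[f [_ + _]]; 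
apply: filterS; first exact: (ae_filter_ringOfSetsType lebesgue_measure).
by move=> x H /H; case.
Qed.

(** The form used later: an explicit formula [h] replaces the derivative, and it has to be checked
    only where F is differentiable. *)
Corollary ac_integral a b F (h : R -> R) : a < b -> ac a b F ->
  (@lebesgue_measure R).-integrable `]a, b[ (EFin \o h) ->
  {ae lebesgue_measure, forall x, a < x < b -> derivable F x 1 -> derive1 F x = h x} ->
  F b - F a = \int[lebesgue_measure]_(t in `]a, b[) h t.
Proof.
move=> ab /(ac_FTC ab)[f [intf fF ->]] inth hF; rewrite /Rintegral; congr fine.
apply: ae_eq_integral => //.
- exact: measurable_int (integrable_itv _ intf).
- exact: measurable_int inth.
- apply: filterS2 fF hF; first exact: (ae_filter_ringOfSetsType lebesgue_measure).
  move=> x H1 H2 /=; rewrite in_itv /= => xab; congr EFin.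
  by have [/(H2 xab) <- <-] := H1 xab.
Qed.

End AbsolutelyContinuous.

(** * Orders of magnitude at an endpoint *)

Section Endpoint.
Variable R : realType.
Implicit Types (b : bool) (f g : R -> R) (x y : R).

(* [b = false] stands for the endpoint 1 and [b = true] for -1; [endvar b x] is
   the distance from x in (-1,1) to that endpoint. *)
Definition endsign b : R := (-1) ^+ b.

Definition endvar b x : R := 1 - endsign b * x.

Lemma sgsg b : endsign b * endsign b = 1.
Proof. by case: b; rewrite /endsign ?expr0 ?expr1 ?mulrNN mulr1. Qed.

Lemma sgN b : endsign (~~ b) = - endsign b.
Proof. by case: b; rewrite /endsign ?expr0 ?expr1 ?opprK. Qed.

Lemma endsign_neq0 b : endsign b != 0.
Proof. by case: b; rewrite /endsign ?expr0 ?expr1 ?oppr_eq0 oner_neq0. Qed.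

Lemma norm_endsign b : `|endsign b| = 1.
Proof. by rewrite /endsign normrX normrN normr1 expr1n. Qed.

Lemma ttN b x : endvar (~~ b) x = 2 - endvar b x.
Proof. by rewrite /endvar sgN; ring. Qed.

Lemma endvar_in b x : (-1 < x < 1) = (0 < endvar b x < 2).
Proof.
by case: b; rewrite /endvar /endsign ?expr0 ?expr1; apply/andP/andP => -[? ?]; split; lra.
Qed.

(** Formulated through the distance, so that one argument covers both endpoints; [E_left] and
    [E_right] lead back to the filters of the statement. *)
Definition endfilter b : set_system R :=
  [set P | exists2 d : R, 0 < d & forall x, 0 < endvar b x < d -> P x].

Lemma endvar_pt b (d : R) : 0 < d -> exists x, 0 < endvar b x < d.
Proof.
move=> d0; exists (endsign b * (1 - d / 2)); rewrite /endvar mulrA sgsg.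
by apply/andP; split; lra.
Qed.

Global Instance E_filter b : ProperFilter (endfilter b).
Proof.
apply: Build_ProperFilter.
- by move=> [d d0 H]; have [x /H] := endvar_pt b d0.
split.
- by exists 1.
- move=> P Q [d d0 H] [d' d0' H'].
  exists (Num.min d d'); first by rewrite lt_min d0.
  by move=> x; rewrite lt_min => /and3P[? ? ?]; split; [apply: H|apply: H']; apply/andP.
- by move=> P Q PQ [d d0 H]; exists d => // x /H /PQ.
Qed.

Lemma E_left : endfilter false = (1 : R)^'-.
Proof.
apply/funext => P; apply/propext; split => -[d /= d0 H].
  exists d => // x /=; rewrite distrC => xd x1; apply: H.
  by move: xd; rewrite /endvar /endsign expr0 mul1r ltr_distlC => /andP[? ?]; apply/andP; split; lra.
exists d => // x; rewrite /endvar /endsign expr0 mul1r => /andP[? ?].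
by apply: H => /=; [rewrite ger0_norm; lra|lra].
Qed.

Lemma E_right : endfilter true = (-1 : R)^'+.
Proof.
apply/funext => P; apply/propext; split => -[d /= d0 H].
  exists d => // x /=; rewrite distrC => xd x1; apply: H.
  by move: xd; rewrite /endvar /endsign expr1 mulN1r ltr_distlC => /andP[? ?]; apply/andP; split; lra.
exists d => // x; rewrite /endvar /endsign expr1 mulN1r => /andP[? ?].
by apply: H => /=; [rewrite ltr0_norm; lra|lra].
Qed.

Lemma endvar_dist b x y : `|endvar b x - endvar b y| = `|x - y|.
Proof.
rewrite /endvar (_ : _ - _ = endsign b * (y - x)); last by ring.
by rewrite normrM norm_endsign mul1r distrC.
Qed.

(** The points close to the endpoint, without the endpoint, form an open set. Hence identities valid
    near the endpoint may be differentiated there. *)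
Lemma E_nbhs b (P : set R) : endfilter b P -> endfilter b [set x | \forall y \near x, P y].
Proof.
move=> [d d0 H]; exists d => // x /andP[x0 xd] /=.
exists (Num.min (endvar b x) (d - endvar b x)) => /=; first by rewrite lt_min x0 subr_gt0.
move=> y /=; rewrite -(endvar_dist b) lt_min => /andP[].
rewrite !ltr_distlC => /andP[? ?] /andP[? ?]; apply: H.
by apply/andP; split; lra.
Qed.

Lemma E_itv b : \forall x \near endfilter b, 0 < endvar b x < 1.
Proof. by exists 1. Qed.

Lemma E_in b : \forall x \near endfilter b, -1 < x < 1.
Proof. by exists 2 => // x; rewrite (endvar_in b). Qed.

Definition endpow b (s : R) x : R := endvar b x `^ s.

Lemma endpow_gt0 b s x : 0 < endvar b x -> 0 < endpow b s x.
Proof. by move=> t0; rewrite /endpow powR_gt0. Qed.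

Lemma endpow_ge0 b s x : 0 <= endpow b s x.
Proof. exact: powR_ge0. Qed.

Lemma pwD b s s' x : 0 < endvar b x -> endpow b (s + s') x = endpow b s x * endpow b s' x.
Proof. by move=> t0; rewrite /endpow powRD // (gt_eqF t0) /= implybT. Qed.

Lemma pw0 b x : endpow b 0 x = 1. Proof. exact: powRr0. Qed.

Lemma pw1 b x : 0 < endvar b x -> endpow b 1 x = endvar b x.
Proof. by move=> /ltW t0; rewrite /endpow powRr1. Qed.

Lemma is_derive_endvar b x : is_derive x 1 (endvar b) (- endsign b).
Proof.
rewrite /endvar; apply: is_derive_eq.
by rewrite add0r mul1r /GRing.scale /= mulr1.
Qed.

Lemma is_derive_endpow b s x : 0 < endvar b x ->
  is_derive x 1 (endpow b s) (- (endsign b * s) * endpow b (s - 1) x).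
Proof.
move=> t0; have d1 := is_derive_endvar b x; have d2 := is_derive1_powR s t0.
have := @is_derive1_comp _ (fun y => y `^ s) (endvar b) x _ _ d2 d1.
move=> h; have -> : - (endsign b * s) * endpow b (s - 1) x = s * endvar b x `^ (s - 1) * - endsign b.
  by rewrite /endpow; ring.
exact: h.
Qed.

Lemma derivable_endpow b s x : 0 < endvar b x -> derivable (endpow b s) x 1.
Proof. by move/(is_derive_endpow s) => []. Qed.

Lemma derive1_endpow b s x : 0 < endvar b x ->
  derive1 (endpow b s) x = - (endsign b * s) * endpow b (s - 1) x.
Proof. by move/(is_derive_endpow s) => h; rewrite derive1E derive_val. Qed.

Lemma E_derive1 b f g : (\forall x \near endfilter b, f x = g x) ->
  \forall x \near endfilter b, derive1 f x = derive1 g x.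
Proof. by move=> /E_nbhs; apply: filterS => x; exact: near_derive1. Qed.

Lemma E_derivable b f g : (\forall x \near endfilter b, f x = g x) ->
  (\forall x \near endfilter b, derivable f x 1) -> \forall x \near endfilter b, derivable g x 1.
Proof. by move=> /E_nbhs; apply: filterS2 => x; exact: near_derivable. Qed.

Lemma derive1M f g x : derivable f x 1 -> derivable g x 1 ->
  derive1 (fun y => f y * g y) x = derive1 f x * g x + f x * derive1 g x.
Proof.
move=> df dg; rewrite !derive1E (deriveM df dg) /GRing.scale /=.
by rewrite addrC mulrC.
Qed.

Lemma E_t b : \forall x \near endfilter b, 0 < endvar b x.
Proof. by apply: filterS (E_itv b) => x /andP[]. Qed.

Lemma E_tN b : \forall x \near endfilter b, 1 < endvar (~~ b) x < 2.
Proof.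
by apply: filterS (E_itv b) => x /andP[? ?]; rewrite ttN; apply/andP; split; lra.
Qed.

(* Powers of t = endvar b: for [sh = 1] the i-th derivative is O(t^(s - i)), for
   [sh = 0] all derivatives up to order N are O(t^s). *)
Fixpoint endO b (sh s : R) (N : nat) f : Prop :=
  (exists M : R, \forall x \near endfilter b, `|f x| <= M * endpow b s x) /\
  match N with
  | 0 => True
  | N'.+1 => (\forall x \near endfilter b, derivable f x 1) /\
             endO b sh (s - sh) N' (derive1 f)
  end.

Section class.
Variables (b : bool) (sh : R).

Lemma endO_bound s N f : endO b sh s N f ->
  exists M : R, \forall x \near endfilter b, `|f x| <= M * endpow b s x.
Proof. by case: N => [|N] []. Qed.

Lemma endO_congr s N f g : (\forall x \near endfilter b, f x = g x) ->
  endO b sh s N f -> endO b sh s N g.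
Proof.
elim: N s f g => [|N IH] s f g fg [[M fM] H]; split=> //=.
- by exists M; apply: filterS2 fg fM => x ->.
- by exists M; apply: filterS2 fg fM => x ->.
- case: H => df H; split; first exact: E_derivable fg df.
  exact: IH (E_derive1 fg) H.
Qed.

Lemma endO_S s N f : endO b sh s N.+1 f -> endO b sh s N f.
Proof.
elim: N s f => [|N IH] s f [fM [df H]]; split=> //; split => //.
exact: IH.
Qed.

Lemma endO_leN s N N' f : (N' <= N)%N -> endO b sh s N f -> endO b sh s N' f.
Proof.
by move=> /subnK <-; elim: (N - N')%N => [|k IH] //; rewrite addSn => /endO_S.
Qed.

Lemma endO_le s s' N f : s' <= s -> endO b sh s N f -> endO b sh s' N f.
Proof.
elim: N s s' f => [|N IH] s s' f ss [[M fM] H].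
  split=> //; exists `|M|; near=> x; apply: (@le_trans _ _ (M * endpow b s x)).
    by near: x.
  apply: (@le_trans _ _ (`|M| * endpow b s x)).
    by rewrite ler_wpM2r ?endpow_ge0 ?ler_norm.
  rewrite ler_wpM2l //; apply: ger_powR => //.
  have : 0 < endvar b x < 1 by near: x; exact: E_itv.
  by move=> /andP[-> /ltW ->].
have [df {}H] := H; split; last by split=> //; apply: IH H; rewrite lerD2r.
exists `|M|; near=> x; apply: (@le_trans _ _ (M * endpow b s x)).
  by near: x.
apply: (@le_trans _ _ (`|M| * endpow b s x)).
  by rewrite ler_wpM2r ?endpow_ge0 ?ler_norm.
rewrite ler_wpM2l //; apply: ger_powR => //.
have : 0 < endvar b x < 1 by near: x; exact: E_itv.
by move=> /andP[-> /ltW ->].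
Unshelve. all: by end_near. Qed.

Lemma endO_D s N f : endO b sh s N.+1 f -> endO b sh (s - sh) N (derive1 f).
Proof. by case=> _ []. Qed.

Lemma endO_derivable s N f : endO b sh s N.+1 f -> \forall x \near endfilter b, derivable f x 1.
Proof. by case=> _ []. Qed.

Lemma endO_zero s N : endO b sh s N (fun=> 0).
Proof.
elim: N s => [|N IH] s; split=> //.
- by exists 0; near=> x; rewrite normr0 mul0r.
- by exists 0; near=> x; rewrite normr0 mul0r.
- split; first by near=> x; exact: derivable_cst.
  by rewrite derive1_const.
Unshelve. all: by end_near. Qed.

Lemma endO_add s N f g : endO b sh s N f -> endO b sh s N g ->
  endO b sh s N (fun x => f x + g x).
Proof.
elim: N s f g => [|N IH] s f g [[M fM] H] [[M' gM] H'].
  split=> //; exists (M + M'); apply: filterS2 fM gM => x h h'.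
  by rewrite mulrDl (le_trans (ler_normD _ _)) // lerD.
split; first (exists (M + M'); apply: filterS2 fM gM => x h h';
  by rewrite mulrDl (le_trans (ler_normD _ _)) // lerD).
move: H H' => [df H] [dg H']; split.
  by apply: filterS2 df dg => x; exact: derivableD.
apply: endO_congr (IH _ _ _ H H').
by apply: filterS2 df dg => x dfx dgx; rewrite derive1D.
Qed.

Lemma endO_eq s s' N f : s = s' -> endO b sh s N f -> endO b sh s' N f.
Proof. by move->. Qed.

Lemma endO_mul s s' N f g : endO b sh s N f -> endO b sh s' N g ->
  endO b sh (s + s') N (fun x => f x * g x).
Proof.
elim: N s s' f g => [|N IH] s s' f g Hf Hg; have [M fM] := endO_bound Hf;
    have [M' gM] := endO_bound Hg.
  split=> //; exists (M * M'); near=> x.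
  have t0 : 0 < endvar b x by near: x; exact: E_t.
  by rewrite pwD // mulrACA normrM ler_pM //; near: x.
split.
  exists (M * M'); near=> x.
  have t0 : 0 < endvar b x by near: x; exact: E_t.
  by rewrite pwD // mulrACA normrM ler_pM //; near: x.
have df := endO_derivable Hf; have dg := endO_derivable Hg; split.
  by apply: filterS2 df dg => x; exact: derivableM.
apply: (@endO_congr _ _ (fun x => derive1 f x * g x + f x * derive1 g x)).
  by apply: filterS2 df dg => x dfx dgx; rewrite derive1M.
apply: endO_add.
  by apply: (@endO_eq (s - sh + s')); [ring|apply: IH (endO_D Hf) (endO_S Hg)].
by apply: (@endO_eq (s + (s' - sh))); [ring|apply: IH (endO_S Hf) (endO_D Hg)].
Unshelve. all: by end_near. Qed.

Lemma endO_cst c N : 0 <= sh -> endO b sh 0 N (fun=> c).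
Proof.
move=> sh0; case: N => [|N]; (split; first by
  exists `|c|; near=> x; rewrite pw0 mulr1) => //.
split; first by near=> x; exact: derivable_cst.
by rewrite derive1_const; exact: endO_zero.
Unshelve. all: by end_near. Qed.

Lemma endO_scale s N f c : 0 <= sh -> endO b sh s N f -> endO b sh s N (fun x => c * f x).
Proof.
move=> sh0 H; apply: (@endO_eq (0 + s)); first by rewrite add0r.
exact: endO_mul (endO_cst _ _ sh0) H.
Qed.

Lemma endO_opp s N f : 0 <= sh -> endO b sh s N f -> endO b sh s N (fun x => - f x).
Proof.
move=> sh0 H; apply: endO_congr (endO_scale (-1) sh0 H).
by near=> x; rewrite mulN1r.
Unshelve. all: by end_near. Qed.

Lemma endO_sub s N f g : 0 <= sh -> endO b sh s N f -> endO b sh s N g ->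
  endO b sh s N (fun x => f x - g x).
Proof. by move=> sh0 Hf Hg; exact: endO_add Hf (endO_opp sh0 Hg). Qed.

Lemma endO_sum (I : eqType) (r : seq I) (P : pred I) s N (F : I -> R -> R) :
  (forall i, i \in r -> P i -> endO b sh s N (F i)) ->
  endO b sh s N (fun x => \sum_(i <- r | P i) F i x).
Proof.
elim: r => [|i r IH] H.
  by apply: endO_congr (endO_zero _ _); near=> x; rewrite big_nil.
have Hr : endO b sh s N (fun x => \sum_(i <- r | P i) F i x).
  by apply: IH => j jr; apply: H; rewrite inE jr orbT.
have [Pi|nPi] := boolP (P i); last first.
  by apply: endO_congr Hr; near=> x; rewrite big_cons (negbTE nPi).
have Hi := H i (mem_head _ _) Pi.
by apply: endO_congr (endO_add Hi Hr); near=> x; rewrite big_cons Pi.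
Unshelve. all: by end_near. Qed.

End class.

Definition iderive (k : nat) f : R -> R := iter k (fun g : R -> R => derive1 g) f.

Lemma DnS k f : iderive k.+1 f = iderive k (derive1 f).
Proof. by rewrite /iderive iterSr. Qed.

Lemma endO_iderive b sh s N k f : endO b sh s (k + N) f ->
  endO b sh (s - sh * k%:R) N (iderive k f).
Proof.
elim: k s f => [|k IH] s f H; first by rewrite mulr0 subr0.
rewrite DnS; apply: (@endO_eq _ _ (s - sh - sh * k%:R)).
  by rewrite -natr1; ring.
exact: IH (endO_D H).
Qed.

Lemma endO_endpow b s N : endO b 1 s N (endpow b s).
Proof.
elim: N s => [|N IH] s; (split; first (exists 1; near=> x;
  by rewrite mul1r ger0_norm ?endpow_ge0)) => //.
split; first by near=> x; apply: derivable_endpow; near: x; exact: E_t.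
apply: endO_congr (endO_scale (- (endsign b * s)) ler01 (IH (s - 1))).
by near=> x; rewrite derive1_endpow //; near: x; exact: E_t.
Unshelve. all: by end_near. Qed.

(** Near one endpoint the distance to the other lies in (1, 2), so its powers and all their
    derivatives are bounded, which is more than either value of [sh] asks for. *)
Lemma endO_endpowN b sh s N : 0 <= sh -> endO b sh 0 N (endpow (~~ b) s).
Proof.
move=> sh0; have bd (r : R) : \forall x \near endfilter b, `|endpow (~~ b) r x| <= 2 `^ `|r| * endpow b 0 x.
  near=> x; have /andP[t1 t2] : 1 < endvar (~~ b) x < 2 by near: x; exact: E_tN.
  rewrite pw0 mulr1 ger0_norm ?endpow_ge0 //.
  apply: (@le_trans _ _ (endvar (~~ b) x `^ `|r|)).
    by apply: ler_powR; [exact: ltW|exact: ler_norm].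
  by apply: ge0_ler_powR; rewrite ?nnegrE ?normr_ge0 //; lra.
elim: N s => [|N IH] s; (split; first by exists (2 `^ `|s|)) => //.
split.
  near=> x; apply: derivable_endpow.
  have /andP[t1 t2] : 1 < endvar (~~ b) x < 2 by near: x; exact: E_tN.
  by lra.
apply: (@endO_congr _ _ _ _ (fun x => - (endsign (~~ b) * s) * endpow (~~ b) (s - 1) x)).
  near=> x; rewrite derive1_endpow //.
  have /andP[t1 t2] : 1 < endvar (~~ b) x < 2 by near: x; exact: E_tN.
  by lra.
apply: (@endO_le _ _ 0); first by rewrite sub0r oppr_le0.
by apply: endO_scale.
Unshelve. all: by end_near. Qed.

Lemma endvar_cvg b : endvar b @ endfilter b --> (0 : R)^'+.
Proof.
move=> P [d /= d0 H]; exists d => // x /andP[x0 xd]; apply: H => //=.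
by rewrite sub0r normrN gtr0_norm.
Qed.

Lemma endpow_cvg0 b s : 0 < s -> endpow b s @ endfilter b --> (0 : R).
Proof. by move=> s0; exact: cvg_comp (endvar_cvg b) (powR_cvg0 s0). Qed.

Lemma endO_cvg0 b sh s N f : 0 < s -> endO b sh s N f -> f @ endfilter b --> (0 : R).
Proof.
move=> s0 /endO_bound[M fM].
have h : (fun x => M * endpow b s x) @ endfilter b --> (0 : R).
  by rewrite -[X in _ --> X](mulr0 M); apply: cvgMr; exact: endpow_cvg0.
apply/cvgrPdist_le => e e0; move/cvgrPdist_le : h => /(_ e e0).
apply: filterS2 fM => x h1 h2; rewrite sub0r normrN (le_trans h1) //.
by move: h2; rewrite sub0r normrN; apply: le_trans; rewrite ler_norm.
Qed.

Lemma endpowN_cvg b s : endpow (~~ b) s @ endfilter b --> 2 `^ s.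
Proof.
have t2 : endvar (~~ b) @ endfilter b --> (2 : R).
  have -> : endvar (~~ b) = (fun x => 2 - endvar b x) by apply/funext => x; exact: ttN.
  rewrite -[X in _ --> X]subr0; apply: cvgB; first exact: cvg_cst.
  by apply: cvg_trans (endvar_cvg b) _; exact: cvg_within.
apply: (cvg_comp (endvar (~~ b)) (fun y => y `^ s) t2).
have [h _] := is_derive1_powR s (ltr0Sn R 1).
by move/derivable1_diffP/differentiable_continuous : h.
Qed.

Lemma E_cvg_eq b f g (L : R) : (\forall x \near endfilter b, f x = g x) ->
  f @ endfilter b --> L -> g @ endfilter b --> L.
Proof. by move=> fg; apply: cvg_trans; exact: near_eq_cvg. Qed.

Lemma E_cvg_cst b (L : R) : (fun=> L) @ endfilter b --> L.
Proof. exact: cvg_cst. Qed.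

Lemma E_cvg_sum b (T : eqType) (r : seq T) (F : T -> R -> R) (L : T -> R) :
  (forall i, i \in r -> F i @ endfilter b --> L i) ->
  (fun x => \sum_(i <- r) F i x) @ endfilter b --> \sum_(i <- r) L i.
Proof.
elim: r => [|i r IH] H.
  rewrite big_nil; apply: (E_cvg_eq (f := fun=> 0)); last exact: E_cvg_cst.
  by apply: nearW => x; rewrite big_nil.
have Hr : (fun x => \sum_(i <- r) F i x) @ endfilter b --> \sum_(i <- r) L i.
  by apply: IH => j jr; apply: H; rewrite inE jr orbT.
rewrite big_cons; apply: (E_cvg_eq (f := fun x => F i x + \sum_(i <- r) F i x)).
  by apply: nearW => x; rewrite big_cons.
exact: (cvgD (H i (mem_head _ _)) Hr).
Qed.

Lemma E_cvg_unique b f (L L' : R) : f @ endfilter b --> L -> f @ endfilter b --> L' -> L = L'.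
Proof. by move=> h h'; rewrite -(cvg_lim (@Rhausdorff R) h) (cvg_lim (@Rhausdorff R) h'). Qed.

(** A two-point estimate with a vanishing gauge gives the limit and the rate of convergence at
    once. *)
Lemma E_cauchy b f (G : R -> R) : G @ endfilter b --> (0 : R) ->
  (exists2 d : R, 0 < d & forall x y, 0 < endvar b x < d -> 0 < endvar b y < d ->
     `|f x - f y| <= G x + G y) ->
  exists2 L : R, f @ endfilter b --> L & \forall x \near endfilter b, `|f x - L| <= G x.
Proof.
move=> G0 [d d0 H].
have cf : cvg (f @ endfilter b).
  apply/cauchy_cvgP/cauchy_exP => e e0.
  have e2 : 0 < e / 2 by rewrite divr_gt0.
  move/cvgrPdist_lt : (G0) => /(_ _ e2)[d' d'0 H'].
  have m0 : 0 < Num.min d d' by rewrite lt_min d0.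
  have [x] := endvar_pt b m0.
  rewrite lt_min => /and3P[x0 xd xd']; exists (f x).
  exists (Num.min d d'); first by rewrite lt_min d0.
  move=> y; rewrite lt_min => /and3P[y0 yd yd'] /=.
  have := H x y; rewrite x0 xd y0 yd => /(_ isT isT).
  have := H' x; have := H' y; rewrite x0 xd' y0 yd' => /(_ isT) + /(_ isT).
  rewrite !sub0r !normrN => /(le_lt_trans (ler_norm _)) + /(le_lt_trans (ler_norm _)).
  by rewrite /ball /=; lra.
exists (lim (f @ endfilter b)) => //; exists d => // x xd.
have h : (fun y => `|f x - f y|) @ endfilter b --> `|f x - lim (f @ endfilter b)|.
  by apply: cvg_norm; apply: cvgB => //; exact: cvg_cst.
have h' : (fun y => G x + G y) @ endfilter b --> G x.
  by rewrite -[X in _ --> X]addr0; apply: cvgD => //; exact: cvg_cst.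
apply: (ler_cvg_to h h'); exists d => // y yd; exact: H.
Qed.

(** Monotonicity takes the place of integration: corrected by a suitable multiple of t^(s + 1),
    whose derivative dominates f', both f and -f become monotone, which is a two-point estimate for
    [E_cauchy]. *)
Lemma growth b f s M : -1 < s -> (\forall x \near endfilter b, derivable f x 1) ->
  (\forall x \near endfilter b, `|derive1 f x| <= M * endpow b s x) ->
  exists2 L : R, f @ endfilter b --> L & endO b 1 (s + 1) 0 (fun x => f x - L).
Proof.
move=> s1 df f'; pose C := `|M| / (s + 1).
have s10 : 0 < s + 1 by lra.
have C0 : 0 <= C by rewrite divr_ge0 // ltW.
have G0 : (fun x => C * endpow b (s + 1) x) @ endfilter b --> (0 : R).
  by rewrite -[X in _ --> X](mulr0 C); apply: cvgMr; exact: endpow_cvg0.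
have [|L fL HL] := @E_cauchy b f _ G0; last by exists L => //; split=> //; exists C.
have [d d0 H] : \forall x \near endfilter b, derivable f x 1 /\ `|derive1 f x| <= M * endpow b s x.
  by apply: filterS2 df f'.
exists d => // x y xd yd.
have J u v z : 0 < endvar b u < d -> 0 < endvar b v < d -> u <= z <= v -> 0 < endvar b z < d.
  by case: (b) => /andP[+ +] /andP[+ +] /andP[]; rewrite /endvar /endsign ?expr0 ?expr1 => *;
    apply/andP; split; lra.
(* With C = |M| / (s + 1) the corrected function has derivative e f' + |M| t^s, nonnegative for both
   signs [e]. *)
have mono (e : R) : `|e| = 1 -> forall u v, 0 < endvar b u < d -> 0 < endvar b v < d ->
    u <= v -> e * f u - endsign b * C * endpow b (s + 1) u <= e * f v - endsign b * C * endpow b (s + 1) v.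
  move=> e1 u v ud vd uv.
  pose h z := e * f z - endsign b * C * endpow b (s + 1) z.
  have hd z : u <= z <= v -> is_derive z 1 h (e * derive1 f z + `|M| * endpow b s z).
    move=> uzv; have zd := J _ _ _ ud vd uzv.
    have [dfz _] := H z zd; have /andP[z0 _] := zd.
    have d1 : is_derive z 1 f (derive1 f z) by rewrite derive1E; exact: derivableP.
    have d2 := is_derive_endpow (s + 1) z0.
    apply: is_derive_eq.
    rewrite /GRing.scale /= addrK /C.
    have -> : endsign b * (`|M| / (s + 1)) * (- (endsign b * (s + 1)) * endpow b s z) =
      - (endsign b * endsign b) * ((s + 1) / (s + 1)) * `|M| * endpow b s z by ring.
    by rewrite sgsg divff ?gt_eqF //; ring.
  have dh z : z \in `[u, v] -> derivable h z 1 by rewrite in_itv /= => /hd[].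
  have := @ger0_derive1_le_cc _ h u v; apply; rewrite ?in_itv /= ?lexx ?uv //.
  - by move=> z; rewrite in_itv /= => /andP[/ltW uz /ltW zv]; apply: dh; rewrite in_itv /= uz.
  - move=> z; rewrite in_itv /= => /andP[/ltW uz /ltW zv].
    have uzv : u <= z <= v by rewrite uz.
    have h1 := hd z uzv; rewrite derive1E derive_val.
    have [_ h2] := H z (J _ _ _ ud vd uzv).
    have h3 : `|e * derive1 f z| <= `|M| * endpow b s z.
      rewrite normrM e1 mul1r (le_trans h2) // ler_wpM2r ?endpow_ge0 // ler_norm //.
    by move: h3; rewrite ler_norml => /andP[? ?]; lra.
  - exact: derivable_within_continuous.
have key u v : 0 < endvar b u < d -> 0 < endvar b v < d -> u <= v ->
    `|f u - f v| <= C * endpow b (s + 1) u + C * endpow b (s + 1) v.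
  move=> ud vd uv.
  have := mono 1 (normr1 _) u v ud vd uv.
  have := mono (-1) _ u v ud vd uv; rewrite normrN normr1 => /(_ erefl).
  have := mulr_ge0 C0 (endpow_ge0 b (s + 1) u); have := mulr_ge0 C0 (endpow_ge0 b (s + 1) v).
  rewrite ler_norml; case: (b); rewrite /endsign ?expr0 ?expr1 => *; apply/andP; split; lra.
have [xy|/ltW yx] := leP x y; first exact: key.
by rewrite distrC [leRHS]addrC; exact: key.
Qed.

End Endpoint.

(** * Functions with a locally absolutely continuous derivative *)

Section Interior.
Variable R : realType.
Implicit Types (f g : R -> R) (x y : R).

Lemma I_nbhs x : -1 < x < 1 -> \forall y \near x, -1 < y < 1.
Proof.
move=> xI; have h : x \in `](-1 : R), 1[ by rewrite in_itv.
by apply: filterS (near_in_itvoo h) => y; rewrite in_itv.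
Qed.

Lemma I_derive1 f g : (forall x, -1 < x < 1 -> f x = g x) ->
  forall x, -1 < x < 1 -> derive1 f x = derive1 g x.
Proof. by move=> fg x /I_nbhs xI; apply: near_derive1; apply: filterS xI. Qed.

Lemma I_derivable f g : (forall x, -1 < x < 1 -> f x = g x) ->
  forall x, -1 < x < 1 -> derivable f x 1 -> derivable g x 1.
Proof. by move=> fg x /I_nbhs xI; apply: near_derivable; apply: filterS xI. Qed.

Lemma ac_congr a b f g : (forall x, a <= x <= b -> f x = g x) ->
  ac a b f -> ac a b g.
Proof.
move=> fg acf e e0; have [d d0 H] := acf e e0; exists d => // s sok sd.
apply: le_lt_trans (H s sok sd); rewrite big_seq [leRHS]big_seq.
apply: ler_sum => p ps; case/andP: sok => /allP /(_ p ps) /and3P[ap pp pb] _.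
rewrite !fg //; first by rewrite ap (le_trans pp).
by rewrite pb (le_trans ap).
Qed.

Lemma ac_lip a b f (M : R) :
  (forall x y, a <= x -> x <= y -> y <= b -> `|f y - f x| <= M * (y - x)) ->
  ac a b f.
Proof.
move=> H e e0; have M0 : 0 < `|M| + 1 by rewrite ltr_wpDl.
exists (e / (`|M| + 1)); first exact: divr_gt0.
move=> s sok; rewrite ltr_pdivlMr // => sd.
apply: le_lt_trans sd; rewrite mulr_suml big_seq [leRHS]big_seq.
apply: ler_sum => p ps; case/andP: sok => /allP /(_ p ps) /and3P[ap pp pb] _.
apply: (le_trans (H _ _ ap pp pb)); rewrite mulrC ler_wpM2l ?subr_ge0 //.
by rewrite (le_trans (ler_norm _)) // lerDl.
Qed.

Lemma ac_add a b f g : ac a b f -> ac a b g -> ac a b (fun x => f x + g x).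
Proof.
move=> acf acg; apply: (@ac_congr _ _ (fun x => f x - (0 - g x))).
  by move=> x _; rewrite sub0r opprK.
apply: ac_sub_fun => //; apply: ac_sub_fun => //.
by apply: (ac_lip (M := 0)) => x y _ _ _; rewrite subrr normr0 mul0r.
Qed.

Lemma ac_bounded a b f : a <= b -> ac a b f ->
  exists M : R, forall x, a <= x <= b -> `|f x| <= M.
Proof.
rewrite le_eqVlt => /predU1P[<- _|ab acf].
  by exists `|f a| => x /andP[? ?]; rewrite (_ : x = a) //; apply/eqP; rewrite eq_le; apply/andP.
have bv := ac_BV ab acf.
exists (`|f a| + fine (total_variation a b f)) => x /andP[ax xb].
have h : `|f x - f a| <= fine (total_variation a b f).
  rewrite -lee_fin fineK; last by apply/bounded_variationP => //; exact: ltW.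
  apply: (le_trans (total_variation_ge f ax)).
  by rewrite (total_variationD f ax xb) leeDl // total_variation_ge0.
by rewrite -[f x](subrK (f a)) addrC (le_trans (ler_normD _ _)) // lerD2l.
Qed.

Lemma ac_mul a b f g : a <= b -> ac a b f -> ac a b g ->
  ac a b (fun x => f x * g x).
Proof.
move=> ab acf acg; have [M fM] := ac_bounded ab acf; have [M' gM] := ac_bounded ab acg.
have M0 : 0 <= M by rewrite (le_trans _ (fM a _)) // lexx.
have M'0 : 0 <= M' by rewrite (le_trans _ (gM a _)) // lexx.
move=> e e0.
have e1 : 0 < e / 2 / (M' + 1) by rewrite !divr_gt0 // ltr_wpDl.
have e2 : 0 < e / 2 / (M + 1) by rewrite !divr_gt0 // ltr_wpDl.
have [d1 d10 H1] := acf _ e1; have [d2 d20 H2] := acg _ e2.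
exists (Num.min d1 d2); first by rewrite lt_min d10.
move=> s sok; rewrite lt_min => /andP[/(H1 s sok) s1 /(H2 s sok) s2].
move: s1; rewrite ltr_pdivlMr ?ltr_wpDl // => s1.
move: s2; rewrite ltr_pdivlMr ?ltr_wpDl // => s2.
apply: (@le_lt_trans _ _ ((\sum_(p <- s) `|f p.2 - f p.1|) * (M' + 1) +
  (\sum_(p <- s) `|g p.2 - g p.1|) * (M + 1))); last by lra.
rewrite !mulr_suml -big_split /= big_seq [leRHS]big_seq.
apply: ler_sum => p ps; case/andP: sok => /allP /(_ p ps) /and3P[ap pp pb] _.
have -> : f p.2 * g p.2 - f p.1 * g p.1 =
  (f p.2 - f p.1) * g p.2 + (g p.2 - g p.1) * f p.1 by ring.
rewrite (le_trans (ler_normD _ _)) // !normrM lerD // ler_wpM2l //.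
  by rewrite (le_trans (gM _ _)) ?lerDl // pb (le_trans ap).
by rewrite (le_trans (fM _ _)) ?lerDl // ap (le_trans pp).
Qed.

Definition acI f := forall a b, -1 < a -> a <= b -> b < 1 -> ac a b f.

Lemma MVT_le a b f (M : R) : (forall x, a <= x <= b -> derivable f x 1) ->
  (forall x, a <= x <= b -> `|derive1 f x| <= M) ->
  forall x y, a <= x -> x <= y -> y <= b -> `|f y - f x| <= M * (y - x).
Proof.
move=> df Mf x y ax; rewrite le_eqVlt => /predU1P[<-|xy] yb.
  by rewrite !subrr normr0 mulr0.
have sub z : z \in `[x, y] -> a <= z <= b.
  by rewrite in_itv /= => /andP[xz zy]; rewrite (le_trans ax xz) (le_trans zy yb).
have d1 z : z \in `]x, y[ -> is_derive z 1 f (derive1 f z).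
  move=> zxy; rewrite derive1E; apply/derivableP/df/sub.
  by move: zxy; rewrite !in_itv /= => /andP[/ltW -> /ltW ->].
have [|z zxy ->] := MVT xy d1.
  by apply: derivable_within_continuous => z /sub; exact: df.
rewrite normrM (gtr0_norm (_ : 0 < y - x)) ?subr_gt0 //.
apply: ler_wpM2r; first by rewrite subr_ge0 ltW.
by apply/Mf/sub; move: zxy; rewrite !in_itv /= => /andP[/ltW -> /ltW ->].
Qed.

Lemma I_const f : (forall x, -1 < x < 1 -> derivable f x 1) ->
  (forall x, -1 < x < 1 -> derive1 f x = 0) ->
  forall x y, -1 < x < 1 -> -1 < y < 1 -> f x = f y.
Proof.
move=> df f0; suff H x y : -1 < x -> x <= y -> y < 1 -> f x = f y.
  move=> x y /andP[x1 x2] /andP[y1 y2]; have [xy|/ltW yx] := leP x y; first exact: H.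
  by apply/esym; exact: H.
move=> x1 xy y1; apply/esym/eqP; rewrite -subr_eq0 -normr_le0.
rewrite -[leRHS](mul0r (y - x)); apply: (@MVT_le x y) => // z /andP[xz zy].
  by apply: df; rewrite (lt_le_trans x1 xz) (le_lt_trans zy y1).
by rewrite f0 ?normr0 // (lt_le_trans x1 xz) (le_lt_trans zy y1).
Qed.

Lemma acI_C1 f : (forall x, -1 < x < 1 -> derivable f x 1) ->
  acI (derive1 f) -> acI f.
Proof.
move=> df acf a b a1 ab b1; have [M fM] := ac_bounded ab (acf a b a1 ab b1).
apply: (ac_lip (M := M)); apply: MVT_le => // x /andP[ax xb].
by apply: df; rewrite (lt_le_trans a1 ax) (le_lt_trans xb b1).
Qed.

(** The regularity of the maximal domain is [acder (2 * n).-1]; having [acder m] for every m stands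
    for smoothness. *)
Fixpoint acder (N : nat) f : Prop :=
  match N with
  | 0 => acI f
  | N'.+1 => (forall x, -1 < x < 1 -> derivable f x 1) /\ acder N' (derive1 f)
  end.

Lemma acder_congr N f g : (forall x, -1 < x < 1 -> f x = g x) -> acder N f -> acder N g.
Proof.
elim: N f g => [|N IH] f g fg /=.
  move=> acf a b a1 ab b1; apply: ac_congr (acf a b a1 ab b1) => x /andP[ax xb].
  by apply: fg; rewrite (lt_le_trans a1 ax) (le_lt_trans xb b1).
move=> [df H]; split; last exact: IH (I_derive1 fg) H.
by move=> x xI; exact: (I_derivable fg xI (df x xI)).
Qed.

Lemma acder_S N f : acder N.+1 f -> acder N f.
Proof.
by elim: N f => [|N IH] f /= [df H]; [exact: acI_C1|split=> //; exact: IH].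
Qed.

Lemma acder_leN N N' f : (N' <= N)%N -> acder N f -> acder N' f.
Proof. by move=> /subnK <-; elim: (N - N')%N => [|k IH] //; rewrite addSn => /acder_S. Qed.

Lemma acder_derivable N f : (0 < N)%N -> acder N f ->
  forall x, -1 < x < 1 -> derivable f x 1.
Proof. by case: N => // N _ []. Qed.

Lemma acder_D N f : acder N.+1 f -> acder N (derive1 f).
Proof. by case. Qed.

Lemma acder_cst N (c : R) : acder N (fun=> c).
Proof.
elim: N c => [|N IH] c /=.
  by move=> a b _ _ _; apply: (ac_lip (M := 0)) => x y _ _ _; rewrite subrr normr0 mul0r.
split; first by move=> x _; exact: derivable_cst.
by rewrite derive1_const; exact: IH.
Qed.

Lemma acder_add N f g : acder N f -> acder N g -> acder N (fun x => f x + g x).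
Proof.
elim: N f g => [|N IH] f g /=.
  by move=> acf acg a b a1 ab b1; apply: ac_add; [exact: acf|exact: acg].
move=> [df Hf] [dg Hg]; split.
  by move=> x xI; apply: derivableD; [exact: df|exact: dg].
apply: acder_congr (IH _ _ Hf Hg) => x xI.
by rewrite (derive1D (df x xI) (dg x xI)).
Qed.

Lemma acder_mul N f g : acder N f -> acder N g -> acder N (fun x => f x * g x).
Proof.
elim: N f g => [|N IH] f g.
  by move=> acf acg a b a1 ab b1; apply: ac_mul => //; [exact: acf|exact: acg].
move=> Hf Hg; have [df Hf'] := Hf; have [dg Hg'] := Hg; split.
  by move=> x xI; apply: derivableM; [exact: df|exact: dg].
apply: acder_congr (acder_add (IH _ _ Hf' (acder_S Hg)) (IH _ _ (acder_S Hf) Hg')) => x xI.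
by rewrite (derive1M (df x xI) (dg x xI)).
Qed.

Lemma acder_scale N (c : R) f : acder N f -> acder N (fun x => c * f x).
Proof. exact/acder_mul/acder_cst. Qed.

Lemma acder_sub N f g : acder N f -> acder N g -> acder N (fun x => f x - g x).
Proof.
move=> Hf Hg; apply: acder_congr (acder_add Hf (acder_scale (-1) Hg)) => x _.
by rewrite mulN1r.
Qed.

Lemma acder_sum (T : eqType) (r : seq T) N (F : T -> R -> R) :
  (forall i, i \in r -> acder N (F i)) -> acder N (fun x => \sum_(i <- r) F i x).
Proof.
elim: r => [|i r IH] H.
  by apply: acder_congr (acder_cst N 0) => x _; rewrite big_nil.
have Hr : acder N (fun x => \sum_(i <- r) F i x).
  by apply: IH => j jr; apply: H; rewrite inE jr orbT.
apply: acder_congr (acder_add (H i (mem_head _ _)) Hr) => x _.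
by rewrite big_cons.
Qed.

Lemma acder_id N : acder N id.
Proof.
case: N => [|N] /=.
  move=> a b _ _ _; apply: (ac_lip (M := 1)) => x y _ xy _.
  by rewrite mul1r ger0_norm ?subr_ge0.
split; first by move=> x _; exact: derivable_id.
by apply: acder_congr (acder_cst N 1) => x _; rewrite derive1_id.
Qed.

Lemma acder_exp N f m : acder N f -> acder N (fun x => f x ^+ m).
Proof.
move=> Hf; elim: m => [|m IH]; first exact: acder_cst.
by apply: acder_congr (acder_mul Hf IH) => x _; rewrite exprS.
Qed.

Lemma acder_endpow N b (s : R) : acder N (endpow b s).
Proof.
elim: N s => [|N IH] s /=; last first.
  split.
    by move=> x; rewrite (endvar_in b) => /andP[t0 _]; exact: derivable_endpow.
  apply: acder_congr (acder_scale (- (endsign R b * s)) (IH (s - 1))) => x.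
  by rewrite (endvar_in b) => /andP[t0 _]; rewrite derive1_endpow.
move=> u v u1 uv v1.
have tb x : u <= x <= v -> Num.min (endvar b u) (endvar b v) <= endvar b x.
  move=> /andP[ux xv]; rewrite ge_min /endvar /endsign; case: (b); rewrite ?expr0 ?expr1.
    by apply/orP; left; lra.
  by apply/orP; right; lra.
have tu : 0 < endvar b u.
  by have := endvar_in b u; rewrite u1 (le_lt_trans uv v1) => /esym/andP[].
have tv : 0 < endvar b v.
  by have := endvar_in b v; rewrite v1 (lt_le_trans u1 uv) => /esym/andP[].
have tI x : u <= x <= v -> 0 < endvar b x.
  by move=> /tb; apply: lt_le_trans; rewrite lt_min tu.
have dpw x : u <= x <= v -> derivable (endpow b s) x 1.
  by move=> /tI; exact: derivable_endpow.
pose m := Num.min (endvar b u) (endvar b v).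
have m0 : 0 < m by rewrite lt_min tu.
(* The sign of s - 1 is not known: the first summand bounds the power at distances up to 1, the
   second at distances from 1 to 2. *)
pose M := `|s| * (m `^ (- `|s - 1|) + 2 `^ `|s - 1|).
apply: (ac_lip (M := M)); apply: MVT_le => // x xuv.
have t0 := tI x xuv; rewrite derive1_endpow // normrM normrN normrM norm_endsign mul1r.
rewrite ler_wpM2l // ger0_norm ?endpow_ge0 // /endpow.
have t2 : endvar b x <= 2.
  have : -1 < x < 1.
    by case/andP: xuv => ux xv; rewrite (lt_le_trans u1 ux) (le_lt_trans xv v1).
  by rewrite (endvar_in b) => /andP[_ /ltW].
have [t1|/ltW t1] := leP 1 (endvar b x).
  apply: (@le_trans _ _ (endvar b x `^ `|s - 1|)).
    by apply: ler_powR => //; exact: ler_norm.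
  apply: ler_wpDl; first exact: powR_ge0.
  by apply: ge0_ler_powR; rewrite ?nnegrE //; exact: ltW.
apply: (@le_trans _ _ (endvar b x `^ (- `|s - 1|))).
  apply: ger_powR; first by rewrite t0.
  by rewrite lerNl -normrN ler_norm.
apply: ler_wpDr; first exact: powR_ge0.
rewrite !powRN lef_pV2 ?posrE ?powR_gt0 //.
by apply: ge0_ler_powR; rewrite ?nnegrE //; [exact: ltW|exact: ltW|exact: tb].
Qed.

Lemma acder_iderive N k f : acder (k + N) f -> acder N (iderive k f).
Proof.
elim: k f => [|k IH] f H //; rewrite DnS; exact: IH (acder_D H).
Qed.

Lemma iderive_derive1 k f : derive1 (iderive k f) = iderive k.+1 f.
Proof. by []. Qed.

Lemma I_iderive k f g : (forall x, -1 < x < 1 -> f x = g x) ->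
  forall x, -1 < x < 1 -> iderive k f x = iderive k g x.
Proof. by elim: k f g => [|k IH] f g fg //; rewrite !DnS; apply: IH; exact: I_derive1. Qed.

Lemma iderive_add k f g : acder k f -> acder k g ->
  forall x, -1 < x < 1 -> iderive k (fun y => f y + g y) x = iderive k f x + iderive k g x.
Proof.
elim: k f g => [|k IH] f g // [df Hf] [dg Hg] x xI; rewrite !DnS -IH //.
by apply: I_iderive => // y yI; rewrite (derive1D (df y yI) (dg y yI)).
Qed.

Lemma iderive_scale k (c : R) f : acder k f ->
  forall x, -1 < x < 1 -> iderive k (fun y => c * f y) x = c * iderive k f x.
Proof.
elim: k f => [|k IH] f // [df Hf] x xI; rewrite !DnS -IH //.
by apply: (@I_iderive k) => // y yI; exact: (derive1Ml c (df y yI)).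
Qed.

Lemma iderive_sub k f g : acder k f -> acder k g ->
  forall x, -1 < x < 1 -> iderive k (fun y => f y - g y) x = iderive k f x - iderive k g x.
Proof.
move=> Hf Hg x xI.
rewrite (@I_iderive k (fun y => f y - g y) (fun y => f y + (-1) * g y)) //; last first.
  by move=> y _; rewrite mulN1r.
by rewrite iderive_add // ?iderive_scale ?mulN1r //; exact: acder_scale.
Qed.

Lemma iderive_const k (c : R) : iderive k.+1 (fun=> c : R) = fun=> 0.
Proof.
elim: k c => [|k IH] c; first exact: derive1_const.
by rewrite DnS derive1_const IH.
Qed.

(** * Vanishing jets and Taylor polynomials *)

Definition jet0 x N f := forall i, (i < N)%N -> iderive i f x = 0.

Section jets.
Variable x : R.
Hypothesis xI : -1 < x < 1.

Lemma jet0_congr N f g : (forall y, -1 < y < 1 -> f y = g y) -> jet0 x N f -> jet0 x N g.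
Proof. by move=> fg Z i iN; rewrite -(I_iderive i fg xI); exact: Z. Qed.

Lemma jet0_leN N N' f : (N' <= N)%N -> jet0 x N f -> jet0 x N' f.
Proof. by move=> NN Z i iN; apply: Z; exact: leq_trans NN. Qed.

Lemma jet0_D N f : jet0 x N.+1 f -> jet0 x N (derive1 f).
Proof. by move=> Z i iN; rewrite -DnS; exact: Z. Qed.

Lemma jet0_cons N f : f x = 0 -> jet0 x N (derive1 f) -> jet0 x N.+1 f.
Proof. by move=> f0 Z [|i] // iN; rewrite DnS; exact: Z. Qed.

Lemma jet0_add N f g : acder N.-1 f -> acder N.-1 g -> jet0 x N f -> jet0 x N g ->
  jet0 x N (fun y => f y + g y).
Proof.
case: N => [|N] //= Hf Hg Zf Zg i iN.
by rewrite iderive_add // ?Zf ?Zg ?addr0 //; [exact: acder_leN Hf|exact: acder_leN Hg].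
Qed.

Lemma jet0_mul N f g : acder N.-1 f -> acder N.-1 g -> jet0 x N f -> jet0 x N (fun y => f y * g y).
Proof.
case: N => [|N] //=; elim: N f g => [|N IH] f g Hf Hg Zf.
  by case=> // _; rewrite /iderive /= (Zf 0%N isT : f x = 0) mul0r.
apply: jet0_cons; first by rewrite (Zf 0%N isT : f x = 0) mul0r.
have [df Hf'] := Hf; have [dg Hg'] := Hg.
apply: (@jet0_congr _ (fun y => derive1 f y * g y + f y * derive1 g y)).
  by move=> y yI; rewrite (derive1M (df y yI) (dg y yI)).
apply: jet0_add => /=.
- exact: acder_mul Hf' (acder_S Hg).
- exact: acder_mul (acder_S Hf) Hg'.
- exact: IH Hf' (acder_S Hg) (jet0_D Zf).
- by apply: IH (acder_S Hf) Hg' _; exact: jet0_leN Zf.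
Qed.

(** Each term of Leibniz's formula at x either keeps [u] undifferentiated, hence vanishes, or spends
    a derivative on [u] and leaves fewer than N for f. *)
Lemma jet0_mulS N f u : acder N f -> acder N u -> u x = 0 -> jet0 x N f ->
  jet0 x N.+1 (fun y => u y * f y).
Proof.
elim: N f u => [|N IH] f u Hf Hu u0 Zf.
  by case=> // _; rewrite /iderive /= u0 mul0r.
apply: jet0_cons; first by rewrite u0 mul0r.
have [df Hf'] := Hf; have [du Hu'] := Hu.
apply: (@jet0_congr _ (fun y => f y * derive1 u y + u y * derive1 f y)).
  by move=> y yI; rewrite (derive1M (du y yI) (df y yI)) [f y * _]mulrC.
apply: jet0_add => /=.
- exact: acder_mul (acder_S Hf) Hu'.
- exact: acder_mul (acder_S Hu) Hf'.
- exact: (@jet0_mul N.+1 _ _ (acder_S Hf) Hu' Zf).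
- exact: IH Hf' (acder_S Hu) u0 (jet0_D Zf).
Qed.

Lemma jet0_pow m u : (forall N, acder N u) -> u x = 0 -> jet0 x m (fun y => u y ^+ m).
Proof.
move=> Hu u0; elim: m => [|m IH] //.
apply: (@jet0_congr _ (fun y => u y * u y ^+ m)); first by move=> y _; rewrite exprS.
by apply: jet0_mulS => //; exact: acder_exp.
Qed.

Lemma iderive_pow m : forall y, -1 < y < 1 ->
  iderive m (fun y => (y - x) ^+ m) y = m`!%:R.
Proof.
elim: m => [|m IH] y yI; first by rewrite /iderive /= expr0.
have Ku N : acder N (fun y => y - x) by apply: acder_sub; [exact: acder_id|exact: acder_cst].
rewrite DnS (@I_iderive m _ (fun z => m.+1%:R * (z - x) ^+ m)) //.
  by rewrite iderive_scale ?IH // ?factS ?natrM //; exact: acder_exp.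
move=> z zI.
have -> : (fun z => (z - x) ^+ m.+1) = (fun z => z ^+ m.+1) \o (fun z => z - x) by [].
have dz : derivable (fun z => z - x) z 1 := acder_derivable (isT : (0 < 1)%N) (Ku 1%N) zI.
have de : derivable (@GRing.exp R ^~ m.+1) (z - x) 1 by exact: exprn_derivable.
rewrite (derive1_comp dz de).
rewrite exp_derive1 derive1D; [|exact: derivable_id|exact: derivable_cst].
by rewrite derive1_const derive1_id addr0 mulr1 /GRing.scale.
Qed.

Lemma taylor N f : acder N f -> exists2 T : R -> R, (forall m, acder m T) &
  jet0 x N.+1 (fun y => f y - T y).
Proof.
move=> Hf; suff H m : (m <= N.+1)%N -> exists2 T : R -> R, (forall m, acder m T) &
    jet0 x m (fun y => f y - T y) by exact: H.
elim: m => [|m IH] mN; first by exists (fun=> 0) => // m; exact: acder_cst.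
have [T KT ZT] := IH (ltnW mN).
have Ku M : acder M (fun y => y - x) by apply: acder_sub; [exact: acder_id|exact: acder_cst].
(* The m-th derivative of (y - x)^m is m!, so this coefficient removes the derivative of order m at
   x and leaves the lower ones zero. *)
pose c := iderive m (fun y => f y - T y) x / m`!%:R.
exists (fun y => T y + c * (y - x) ^+ m).
  by move=> M; apply: acder_add => //; apply: acder_scale; exact: acder_exp.
have KfT : acder m (fun y => f y - T y) by apply: acder_sub => //; exact: acder_leN Hf.
have Kp : acder m (fun y => c * (y - x) ^+ m) by apply: acder_scale; exact: acder_exp.
move=> i; rewrite ltnS => im.
rewrite (@I_iderive i _ (fun y => (f y - T y) - c * (y - x) ^+ m)) //; last first.
  by move=> y _; rewrite opprD addrA.
rewrite iderive_sub //; [|exact: acder_leN KfT|exact: acder_leN Kp].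
rewrite iderive_scale //; last by apply: acder_exp.
move: im; rewrite leq_eqVlt => /predU1P[->|im].
  by rewrite iderive_pow // divfK ?subrr // pnatr_eq0 -lt0n fact_gt0.
rewrite ZT // (jet0_pow (m := m) Ku) ?subrr ?mulr0 ?subr0 //.
Qed.

End jets.

End Interior.

(** * The Jacobi expression on real functions *)

Section DeriveLinear.
Variable R : realType.
Implicit Types (f g : R -> R) (x c : R).

Lemma derivable_cmul c f x : derivable f x 1 -> derivable (fun y => c * f y) x 1.
Proof. by move=> df; exact: (derivableM (derivable_cst c x 1) df). Qed.

Lemma derivable_lin f g c x : derivable f x 1 -> derivable g x 1 ->
  derivable (fun y => f y + c * g y) x 1.
Proof. by move=> df dg; exact: (derivableD df (derivable_cmul (c := c) dg)). Qed.

Lemma derive1_lin f g c x : derivable f x 1 -> derivable g x 1 ->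
  derive1 (fun y => f y + c * g y) x = derive1 f x + c * derive1 g x.
Proof. by move=> df dg; rewrite (derive1D df (derivable_cmul (c := c) dg)) (derive1Ml c dg). Qed.

End DeriveLinear.

Section Jacobi.
Variable R : realType.
Variables (al be : R) (n : nat) (C : nat -> R).
Hypothesis hn : (0 < n)%N.
Implicit Types (f g : R -> R) (x y : R).

Definition endexp (b : bool) : R := if b then be else al.

Lemma jweightE b (k : R) x :
  jweight (al + k) (be + k) x = endpow b (endexp b + k) x * endpow (~~ b) (endexp (~~ b) + k) x.
Proof.
rewrite /jweight /endpow /endvar /endexp; case: b => /=; rewrite /endsign ?expr0 ?expr1 ?mul1r ?mulN1r ?opprK //.
by rewrite mulrC.
Qed.

Lemma jweight0E b x : jweight al be x = endpow b (endexp b) x * endpow (~~ b) (endexp (~~ b)) x.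
Proof. by have := jweightE b 0 x; rewrite !addr0. Qed.

Lemma jweight_gt0 x : -1 < x < 1 -> 0 < jweight al be x.
Proof.
move=> xI; have := xI; rewrite (endvar_in false) => /andP[t0 _].
have := xI; rewrite (endvar_in true) => /andP[t1 _].
by rewrite (jweight0E false) mulr_gt0 // endpow_gt0.
Qed.

Lemma acder_jweight N (k : R) : acder N (jweight (al + k) (be + k)).
Proof.
apply: acder_congr (acder_mul (acder_endpow N false (al + k)) (acder_endpow N true (be + k))) => x _.
by rewrite (jweightE false).
Qed.

Lemma acder_jweightV N : acder N (fun x => (jweight al be x)^-1).
Proof.
apply: acder_congr (acder_mul (acder_endpow N false (- al)) (acder_endpow N true (- be))) => x _.
by rewrite (jweight0E false) /endpow !powRN invfM.
Qed.

Definition real_flux f x : R := jweight (al + 1) (be + 1) x * derive1 f x.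

Definition real_expr f x : R := - (jweight al be x)^-1 * derive1 (real_flux f) x.

Definition real_pow (k : nat) f : R -> R := iter k real_expr f.

Definition real_coef (k : nat) x : R := C k * jweight (al + k%:R) (be + k%:R) x.

(* The quasi-derivative of order 2n - j, in closed form. *)
Definition real_quasi (j : nat) f x : R :=
  \sum_(j <= k < n.+1) (-1) ^+ (k + j) * iderive (k - j) (fun y => real_coef k y * iderive k f y) x.

(** The double sum of the sesquilinear form, summed over k first: the derivative of order j - 1 is
    then multiplied by the quasi-derivative of order 2n - j. *)
Definition real_bracket f g x : R :=
  \sum_(1 <= j < n.+1) (real_quasi j g x * iderive j.-1 f x - real_quasi j f x * iderive j.-1 g x).

Lemma acder_ra N k : acder N (real_coef k).
Proof. exact/acder_scale/acder_jweight. Qed.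

Lemma acder_term N j k f : (j <= k <= n)%N -> acder (N + (2 * n - j)) f ->
  acder N (iderive (k - j) (fun y => real_coef k y * iderive k f y)).
Proof.
move=> /andP[jk kn] Hf; apply: acder_iderive; apply: acder_mul; first exact: acder_ra.
by apply: acder_iderive; apply: acder_leN Hf; lia.
Qed.

Lemma acder_term' N j k f : (j <= k <= n)%N -> acder (N + (2 * n - j)) f ->
  acder (k - j + N) (fun y => real_coef k y * iderive k f y).
Proof.
move=> /andP[jk kn] Hf; apply: acder_mul; first exact: acder_ra.
by apply: acder_iderive; apply: acder_leN Hf; lia.
Qed.

Lemma acder_Sj N j f : acder (N + (2 * n - j)) f -> acder N (real_quasi j f).
Proof.
move=> Hf; apply: acder_sum => k; rewrite mem_index_iota ltnS => jk.
exact/acder_scale/acder_term.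
Qed.

Lemma derive1_sum (T : eqType) (r : seq T) (F : T -> R -> R) x :
  (forall i, i \in r -> derivable (F i) x 1) ->
  derivable (fun y => \sum_(i <- r) F i y) x 1 /\
  derive1 (fun y => \sum_(i <- r) F i y) x = \sum_(i <- r) derive1 (F i) x.
Proof.
elim: r => [|i r IH] H.
  have -> : (fun y => \sum_(i <- [::]) F i y) = (fun=> 0).
    by apply/funext => y; rewrite big_nil.
  by rewrite big_nil derive1_const; split=> //; exact: derivable_cst.
have [dr er] : derivable (fun y => \sum_(i <- r) F i y) x 1 /\
    derive1 (fun y => \sum_(i <- r) F i y) x = \sum_(i <- r) derive1 (F i) x.
  by apply: IH => j jr; apply: H; rewrite inE jr orbT.
have di := H i (mem_head _ _).
have -> : (fun y => \sum_(i <- i :: r) F i y) = (fun y => F i y + \sum_(i <- r) F i y).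
  by apply/funext => y; rewrite big_cons.
by split; [exact: (derivableD di dr)|rewrite big_cons (derive1D di dr) er].
Qed.

Lemma derive1_Sj j f x : (j < n)%N -> -1 < x < 1 -> acder (2 * n - j) f ->
  derive1 (real_quasi j.+1 f) x =
  \sum_(j.+1 <= k < n.+1) (-1) ^+ (k + j.+1) *
    iderive (k - j) (fun y => real_coef k y * iderive k f y) x.
Proof.
move=> jn xI Hf; have Ht k : (j.+1 <= k <= n)%N ->
    acder 1 (iderive (k - j.+1) (fun y => real_coef k y * iderive k f y)).
  by move=> jk; apply: acder_term => //; apply: acder_leN Hf; lia.
have [|_ ->] := @derive1_sum _ (index_iota j.+1 n.+1)
    (fun k y => (-1) ^+ (k + j.+1) * iderive (k - j.+1) (fun y => real_coef k y * iderive k f y) y) x.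
  move=> k; rewrite mem_index_iota ltnS => /Ht/(acder_scale ((-1) ^+ (k + j.+1))) h.
  exact: (acder_derivable (isT : (0 < 1)%N) h xI).
rewrite big_seq [RHS]big_seq; apply: eq_bigr => k.
rewrite mem_index_iota ltnS => jk.
rewrite (derive1Ml _ (acder_derivable (isT : (0 < 1)%N) (Ht k jk) xI)) iderive_derive1.
by rewrite subnSK //; case/andP: jk.
Qed.

Lemma Sj_rec j f x : (j <= n)%N ->
  real_quasi j f x = real_coef j x * iderive j f x +
    \sum_(j.+1 <= k < n.+1) (-1) ^+ (k + j) * iderive (k - j) (fun y => real_coef k y * iderive k f y) x.
Proof.
move=> jn; rewrite /real_quasi big_ltn ?ltnS // addnn -signr_odd odd_double expr0 mul1r.
by rewrite subnn.
Qed.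

(** The recursion of the quasi-derivatives, recovered from the closed form: [real_quasi j] has one
    more term, k = j, than the derivative of [real_quasi j.+1], and the opposite signs. *)
Lemma derive1_SjS j f x : (0 < j < n)%N -> -1 < x < 1 -> acder (2 * n).-1 f ->
  derive1 (real_quasi j.+1 f) x = real_coef j x * iderive j f x - real_quasi j f x.
Proof.
move=> /andP[j0 jn] xI Hf; rewrite derive1_Sj //; last by apply: acder_leN Hf; lia.
rewrite Sj_rec; last exact: ltnW.
rewrite opprD addrA subrr add0r -sumrN; apply: eq_bigr => k _.
by rewrite addnS exprS mulN1r mulNr.
Qed.

Lemma Sjn f x : real_quasi n f x = real_coef n x * iderive n f x.
Proof. by rewrite Sj_rec // big_geq ?addr0. Qed.

Hypothesis hCr : forall q, (forall m, acder m q) -> forall x, -1 < x < 1 ->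
  real_pow n q x = (jweight al be x)^-1 *
    \sum_(1 <= k < n.+1) (-1) ^+ k * iderive k (fun y => real_coef k y * iderive k q y) x.

Lemma acder_rflux N f : acder N.+1 f -> acder N (real_flux f).
Proof. by move=> Hf; apply: acder_mul; [exact: acder_jweight|exact: acder_D]. Qed.

Lemma acder_rell N f : acder N.+2 f -> acder N (real_expr f).
Proof.
move=> Hf; apply: acder_congr (acder_scale (-1) (acder_mul (acder_jweightV N) (acder_D (acder_rflux Hf)))) => x _.
by rewrite /real_expr mulN1r mulNr.
Qed.

Lemma rellkS k f : real_pow k.+1 f = real_pow k (real_expr f).
Proof. by rewrite /real_pow iterSr. Qed.

Lemma acder_rellk N k f : acder (N + 2 * k) f -> acder N (real_pow k f).
Proof.
elim: k f => [|k IH] f Hf; first by rewrite muln0 addn0 in Hf.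
by rewrite rellkS; apply: IH; apply: acder_rell; apply: acder_leN Hf; lia.
Qed.

(** The last stage of ell^n f that makes sense at every point. It has order 2n - 1, like
    [real_quasi 1], with which it will be identified. *)
Definition topflux f := real_flux (real_pow n.-1 f).

Lemma acder_topflux N f : acder (N + (2 * n).-1) f -> acder N (topflux f).
Proof. by move=> Hf; apply: acder_rflux; apply: acder_rellk; apply: acder_leN Hf; lia. Qed.

(** True at every point by the definition of [real_expr], whatever value [derive1] takes where there
    is no derivative. *)
Lemma derive1_topflux f x : -1 < x < 1 ->
  derive1 (topflux f) x = - (jweight al be x * real_pow n f x).
Proof.
move=> xI; have w0 := jweight_gt0 xI.
rewrite -(prednK hn) /real_pow iterS -/(real_pow _ f) /real_expr -/(topflux f).
by rewrite mulNr mulrN opprK mulrA divff ?gt_eqF // mul1r.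
Qed.

Section linearity.
Variables (f g : R -> R) (c : R).

Lemma rell_lin N : acder N.+2 f -> acder N.+2 g -> forall x, -1 < x < 1 ->
  real_expr (fun y => f y + c * g y) x = real_expr f x + c * real_expr g x.
Proof.
move=> Hf Hg x xI; rewrite /real_expr.
have Hff := acder_rflux Hf; have Hfg := acder_rflux Hg.
have -> : derive1 (real_flux (fun y => f y + c * g y)) x =
    derive1 (fun y => real_flux f y + c * real_flux g y) x.
  apply: I_derive1 xI => y yI; rewrite /real_flux.
  have df := acder_derivable (ltn0Sn _) Hf yI; have dg := acder_derivable (ltn0Sn _) Hg yI.
  by rewrite (derive1_lin c df dg); ring.
have df := acder_derivable (ltn0Sn _) Hff xI; have dg := acder_derivable (ltn0Sn _) Hfg xI.
rewrite (derive1_lin c df dg).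
by move: (derive1 (real_flux f) x) (derive1 (real_flux g) x) => p q; ring.
Qed.

End linearity.

Lemma rell_congr f g : (forall x, -1 < x < 1 -> f x = g x) ->
  forall x, -1 < x < 1 -> real_expr f x = real_expr g x.
Proof.
move=> fg x xI; rewrite /real_expr.
have h y : -1 < y < 1 -> real_flux f y = real_flux g y.
  by move=> yI; rewrite /real_flux (I_derive1 fg yI).
by rewrite (I_derive1 h xI).
Qed.

Lemma rellk_congr k f g : (forall x, -1 < x < 1 -> f x = g x) ->
  forall x, -1 < x < 1 -> real_pow k f x = real_pow k g x.
Proof.
elim: k f g => [|k IH] f g fg x xI; first exact: fg.
by rewrite !rellkS; exact: (IH _ _ (rell_congr fg) x xI).
Qed.

Lemma rellk_lin f g c k N : acder (N + 2 * k) f -> acder (N + 2 * k) g -> 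
  forall x, -1 < x < 1 ->
  real_pow k (fun y => f y + c * g y) x = real_pow k f x + c * real_pow k g x.
Proof.
elim: k f g => [|k IH] f g // Hf Hg x xI; rewrite !rellkS.
have e : (N + 2 * k.+1)%N = (N + 2 * k).+2 by lia.
rewrite e in Hf Hg.
rewrite -IH //; [|exact: acder_rell|exact: acder_rell].
by apply: (@rellk_congr k _ _ _ x xI) => y yI; exact: rell_lin Hf Hg _ yI.
Qed.

Lemma topflux_lin f g c : acder (2 * n).-1 f -> acder (2 * n).-1 g -> forall x, -1 < x < 1 ->
  topflux (fun y => f y + c * g y) x = topflux f x + c * topflux g x.
Proof.
move=> Hf Hg x xI; rewrite /topflux /real_flux.
have e : (2 * n).-1 = (1 + 2 * n.-1)%N by lia.
rewrite e in Hf Hg.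
have -> : derive1 (real_pow n.-1 (fun y => f y + c * g y)) x =
    derive1 (fun y => real_pow n.-1 f y + c * real_pow n.-1 g y) x.
  by apply: I_derive1 xI => y yI; exact: rellk_lin Hf Hg _ yI.
have df := acder_derivable (isT : (0 < 1)%N) (acder_rellk Hf) xI.
have dg := acder_derivable (isT : (0 < 1)%N) (acder_rellk Hg) xI.
by rewrite (derive1_lin c df dg); ring.
Qed.

Lemma Sj_lin j f g c : acder (2 * n - j) f -> acder (2 * n - j) g -> forall x, -1 < x < 1 ->
  real_quasi j (fun y => f y + c * g y) x = real_quasi j f x + c * real_quasi j g x.
Proof.
move=> Hf Hg x xI; rewrite /real_quasi mulr_sumr -big_split /= big_seq [RHS]big_seq.
apply: eq_bigr => k; rewrite mem_index_iota ltnS => /andP[jk kn].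
have Kf : acder k f by apply: acder_leN Hf; lia.
have Kg : acder k g by apply: acder_leN Hg; lia.
rewrite (@I_iderive _ (k - j) _ (fun y => real_coef k y * iderive k f y + c * (real_coef k y * iderive k g y))) //.
  have kjn : (j <= k <= n)%N by rewrite jk.
  have h1 : acder (k - j) (fun y => real_coef k y * iderive k f y).
    by rewrite -[(k - j)%N]addn0; apply: acder_term'.
  have h2 : acder (k - j) (fun y => real_coef k y * iderive k g y).
    by rewrite -[(k - j)%N]addn0; apply: acder_term'.
  by rewrite iderive_add ?iderive_scale //; [ring|exact: acder_scale].
move=> y yI; rewrite (iderive_add Kf (acder_scale c Kg) yI) (iderive_scale c Kg yI); ring.
Qed.

(** * Dependence of the flux and of the quasi-derivatives on finite jets *)

Section locality.
Variable x : R.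
Hypothesis xI : -1 < x < 1.

Lemma jet0_rell N f : (0 < N)%N -> acder N.+1 f -> jet0 x N.+2 f -> jet0 x N (real_expr f).
Proof.
case: N => [|N] // _ Hf Zf.
have h1 : jet0 x N.+2 (real_flux f).
  apply: (@jet0_congr _ x xI _ (fun y => derive1 f y * jweight (al + 1) (be + 1) y)).
    by move=> y _; rewrite mulrC.
  exact: (@jet0_mul _ x xI N.+2 _ _ (acder_D Hf) (acder_jweight N.+1 1) (jet0_D Zf)).
apply: (@jet0_congr _ x xI _ (fun y => derive1 (real_flux f) y * - (jweight al be y)^-1)).
  by move=> y _; rewrite mulrC.
have h2 : acder N (fun y => - (jweight al be y)^-1).
  by apply: acder_congr (acder_scale (-1) (acder_jweightV N)) => y _; rewrite mulN1r.
exact: (@jet0_mul _ x xI N.+1 _ _ (acder_D (acder_rflux Hf)) h2 (jet0_D h1)).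
Qed.

Lemma jet0_rellk N k f : (0 < N)%N -> acder (N + 2 * k).-1 f -> jet0 x (N + 2 * k) f ->
  jet0 x N (real_pow k f).
Proof.
move=> N0; elim: k f => [|k IH] f Hf Zf; first by rewrite muln0 addn0 in Zf.
have e : (N + 2 * k.+1)%N = (N + 2 * k).+2 by lia.
rewrite e in Hf Zf; rewrite rellkS; apply: IH.
  by apply: acder_rell; apply: acder_leN Hf; lia.
by apply: jet0_rell => //; lia.
Qed.

Lemma jet0_topflux f : acder (2 * n).-1 f -> jet0 x (2 * n) f -> topflux f x = 0.
Proof.
move=> Hf Zf; have e : (2 * n)%N = (2 + 2 * n.-1)%N by lia.
rewrite e in Hf Zf; rewrite /topflux /real_flux.
by rewrite (jet0_rellk (isT : (0 < 2)%N) Hf Zf (isT : (1 < 2)%N) : derive1 _ x = 0) mulr0.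
Qed.

Lemma jet0_S1 f : acder (2 * n).-1 f -> jet0 x (2 * n) f -> real_quasi 1 f x = 0.
Proof.
move=> Hf Zf; rewrite /real_quasi big_seq; apply: big1 => k; rewrite mem_index_iota ltnS => /andP[k1 kn].
have Zk : jet0 x (2 * n - k) (iderive k f).
  by move=> i ik; rewrite /iderive -iterD; apply: Zf; lia.
have Kk : acder (2 * n - k).-1 (iderive k f) by apply: acder_iderive; apply: acder_leN Hf; lia.
have Zm := jet0_mul xI Kk (acder_ra _ k) Zk.
rewrite (@I_iderive _ (k - 1) _ (fun y => iderive k f y * real_coef k y) _ x xI); last first.
  by move=> y _; rewrite mulrC.
by rewrite Zm ?mulr0 //; lia.
Qed.

End locality.

(** Both terms have derivative -w ell^n q, the flux by definition and the quasi-derivative by the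
    identity that defines the constants. *)
Lemma topflux_S1_smooth q x y : (forall m, acder m q) -> -1 < x < 1 -> -1 < y < 1 ->
  topflux q x - real_quasi 1 q x = topflux q y - real_quasi 1 q y.
Proof.
move=> Kq xI yI.
have KP : acder 1 (topflux q) by exact: acder_topflux.
have KS : acder 1 (real_quasi 1 q) by exact: acder_Sj.
apply: (@I_const _ (fun z => topflux q z - real_quasi 1 q z)) => // z zI.
  exact: (acder_derivable (isT : (0 < 1)%N) (acder_sub KP KS) zI).
have dP := acder_derivable (isT : (0 < 1)%N) KP zI.
have dS := acder_derivable (isT : (0 < 1)%N) KS zI.
have -> : (fun z => topflux q z - real_quasi 1 q z) = (fun z => topflux q z + (-1) * real_quasi 1 q z).
  by apply/funext => u; rewrite mulN1r.
rewrite (derive1_lin (-1) dP dS) derive1_topflux // derive1_Sj // hCr //.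
rewrite mulVKf ?gt_eqF ?jweight_gt0 // mulN1r -opprD.
rewrite -big_split /= big1 ?oppr0 // => k _.
by rewrite subn0 addn1 exprS mulN1r mulNr addrN.
Qed.

(* For smooth f the difference of the two endpoint_values is constant, and it only depends
   on the jet of f: given x and y, change f to have a zero jet at y without
   changing its jet at x. *)
Theorem topflux_S1 f x : acder (2 * n).-1 f -> -1 < x < 1 -> topflux f x = real_quasi 1 f x.
Proof.
move=> Hf xI; pose N := (2 * n)%N.
have [y yI xy] : exists2 y, -1 < y < 1 & x != y.
  have [x0|x0] := ltP x 0.
    by exists 0; [apply/andP; split; lra|rewrite lt_eqF].
  by exists (- 2^-1); [apply/andP; split; lra|rewrite gt_eqF //; lra].
have [T KT ZT] := taylor xI Hf.
have Ku m : acder m (fun z => (x - y)^-1 * (z - y)).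
  by apply: acder_scale; apply: acder_sub; [exact: acder_id|exact: acder_cst].
(* [u] is affine with value 1 at x and 0 at y; the cut-off 1 - (1 - u^N)^N equals 1 to order N at x
   and vanishes to order N at y. *)
pose u z := (x - y)^-1 * (z - y).
pose v z := 1 - u z ^+ N.
pose h z := 1 - v z ^+ N.
have ux : u x = 1 by rewrite /u mulVf // subr_eq0.
have uy : u y = 0 by rewrite /u subrr mulr0.
have N0 : (0 < N)%N by rewrite /N; lia.
have Kv m : acder m v by apply: acder_sub; [exact: acder_cst|exact/acder_exp/Ku].
have Kh m : acder m h by apply: acder_sub; [exact: acder_cst|exact/acder_exp/Kv].
have vx : v x = 0 by rewrite /v ux expr1n subrr.
have Zhx : jet0 x N (fun z => v z ^+ N) := jet0_pow xI Kv vx.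
have Zuy : jet0 y N (fun z => u z ^+ N) := jet0_pow yI Ku uy.
have Zhy : jet0 y N h.
  suff H m : jet0 y N (fun z => 1 - v z ^+ m) by exact: H.
  elim: m => [|m IH].
    have -> : (fun z => 1 - v z ^+ 0) = (fun=> 0).
      by apply/funext => z; rewrite expr0 subrr.
    by move=> [|i] // _; rewrite iderive_const.
  (* Since 1 - v = u^N, the function 1 - v^(m + 1) equals (1 - v^m) v + u^N. *)
  apply: (@jet0_congr _ y yI _ (fun z => (1 - v z ^+ m) * v z + u z ^+ N)).
    by move=> z _; rewrite exprS /v; ring.
  apply: jet0_add => //.
  - by apply: acder_mul => //; apply: acder_sub; [exact: acder_cst|exact/acder_exp/Kv].
  - exact/acder_exp/Ku.
  - by apply: jet0_mul => //; apply: acder_sub; [exact: acder_cst|exact/acder_exp/Kv].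
pose q z := T z * h z.
have Kq m : acder m q by exact: acder_mul.
have Zq : jet0 y N q.
  apply: (@jet0_congr _ y yI _ (fun z => h z * T z)); first by move=> z _; rewrite mulrC.
  exact: jet0_mul.
have Kfq : acder (2 * n).-1 (fun z => f z + (-1) * q z) by apply: acder_add => //; exact: acder_scale.
have Zfq : jet0 x N (fun z => f z + (-1) * q z).
  apply: (@jet0_congr _ x xI _ (fun z => (f z - T z) + v z ^+ N * T z)).
    by move=> z _; rewrite /q /h; ring.
  have KfT : acder N.-1 (fun z => f z - T z) by exact: acder_sub.
  apply: jet0_add => //.
  - by apply: acder_mul => //; exact: acder_exp.
  - by move: ZT; rewrite (_ : (2 * n).-1.+1 = N) // prednK.
  - by apply: jet0_mul => //; exact: acder_exp.
have Sq0 g : acder (2 * n).-1 g -> acder (2 * n - 1) g by rewrite subn1.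
have := jet0_topflux xI Kfq Zfq; rewrite topflux_lin // => /eqP.
rewrite mulN1r subr_eq0 => /eqP ->.
have := jet0_S1 xI Kfq Zfq; rewrite Sj_lin //; last exact: Sq0.
move=> /eqP; rewrite mulN1r subr_eq0 => /eqP ->.
have := topflux_S1_smooth Kq xI yI.
rewrite (jet0_topflux yI (Kq _) Zq) (jet0_S1 yI (Kq _) Zq) subrr => /eqP.
by rewrite subr_eq0 => /eqP.
Qed.

(** Carries the identity for the constants over from smooth functions to the regularity of the
    maximal domain. *)
Lemma derive1_S1 f x : acder (2 * n).-1 f -> -1 < x < 1 ->
  derive1 (real_quasi 1 f) x = - (jweight al be x * real_pow n f x).
Proof.
move=> Hf xI; rewrite -derive1_topflux //; apply/esym; apply: I_derive1 xI => y yI.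
exact: topflux_S1.
Qed.

Lemma rbrC f g x : real_bracket g f x = - real_bracket f g x.
Proof. by rewrite /real_bracket -sumrN; apply: eq_bigr => j _; rewrite opprB. Qed.

Lemma acder_rbr f g : acder (2 * n).-1 f -> acder (2 * n).-1 g -> acder 0 (real_bracket f g).
Proof.
move=> Hf Hg; apply: acder_sum => j; rewrite mem_index_iota ltnS => /andP[j0 jn].
by apply: acder_sub; apply: acder_mul; try (apply: acder_Sj; apply: acder_leN Hf; lia);
  try (apply: acder_Sj; apply: acder_leN Hg; lia); apply: acder_iderive; [apply: acder_leN Hf|apply: acder_leN Hg]; lia.
Qed.

(** Lagrange's identity. The contributions of consecutive j telescope, the last one vanishes by the
    symmetry of a_n f^(n) g^(n), and j = 1 leaves ell^n. The differentiability of [real_quasi 1]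
    will hold almost everywhere only, hence as a hypothesis at the point. *)
Lemma derive1_rbr f g x : acder (2 * n).-1 f -> acder (2 * n).-1 g -> -1 < x < 1 ->
  derivable (real_quasi 1 f) x 1 -> derivable (real_quasi 1 g) x 1 ->
  derivable (real_bracket f g) x 1 /\
  derive1 (real_bracket f g) x = jweight al be x * (real_pow n f x * g x - f x * real_pow n g x).
Proof.
move=> Hf Hg xI df dg.
have dS h j : acder (2 * n).-1 h -> derivable (real_quasi 1 h) x 1 -> (0 < j <= n)%N ->
    derivable (real_quasi j h) x 1.
  move=> Hh dh /andP[j0 jn]; have [->|j1] := eqVneq j 1%N; first exact: dh.
  by apply: (acder_derivable (isT : (0 < 1)%N)) xI; apply: acder_Sj; apply: acder_leN Hh; lia.
have dD h j : acder (2 * n).-1 h -> (0 < j <= n)%N -> derivable (iderive j.-1 h) x 1.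
  move=> Hh /andP[j0 jn].
  by apply: (acder_derivable (isT : (0 < 1)%N)) xI; apply: acder_iderive; apply: acder_leN Hh; lia.
pose F j y := real_quasi j g y * iderive j.-1 f y - real_quasi j f y * iderive j.-1 g y.
pose T j := real_quasi j g x * iderive j f x - real_quasi j f x * iderive j g x.
have dFE j : (0 < j <= n)%N -> derivable (F j) x 1 /\
    derive1 (F j) x = derive1 (real_quasi j g) x * iderive j.-1 f x - derive1 (real_quasi j f) x * iderive j.-1 g x + T j.
  move=> jn; have a1 := dS _ _ Hg dg jn; have a2 := dS _ _ Hf df jn.
  have a3 := dD _ _ Hf jn; have a4 := dD _ _ Hg jn.
  have m1 : derivable (fun y => real_quasi j g y * iderive j.-1 f y) x 1 by exact: (derivableM a1 a3).
  have m2 : derivable (fun y => real_quasi j f y * iderive j.-1 g y) x 1 by exact: (derivableM a2 a4).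
  have -> : F j = (fun y => real_quasi j g y * iderive j.-1 f y + (-1) * (real_quasi j f y * iderive j.-1 g y)).
    by apply/funext => y; rewrite mulN1r.
  split; first exact: (derivable_lin (c := -1) m1 m2).
  rewrite (derive1_lin (-1) m1 m2) (derive1M a1 a3) (derive1M a2 a4) !iderive_derive1.
  by rewrite prednK; [rewrite /T; ring|case/andP: jn].
have [|dr ->] := @derive1_sum _ (index_iota 1 n.+1) F x.
  by move=> j; rewrite mem_index_iota ltnS => /dFE[].
split=> //.
have Tn : T n = 0 by rewrite /T !Sjn; ring.
have E1 : derive1 (F 1%N) x = derive1 (real_quasi 1 g) x * f x - derive1 (real_quasi 1 f) x * g x + T 1%N.
  by have [_ ->] := dFE 1%N hn.
have Ej j : (1 <= j < n)%N -> derive1 (F j.+1) x = T j.+1 - T j.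
  move=> /andP[j0 jn]; have [_ ->] := dFE j.+1 jn.
  rewrite !derive1_SjS //; try (by rewrite j0 jn).
  by rewrite /T /=; ring.
rewrite big_ltn // big_add1 /= big_nat.
under eq_bigr => j jn do rewrite Ej //.
rewrite -big_nat telescope_sumr // E1 Tn !derive1_S1 //; ring.
Qed.

Lemma rbr_integral f g x y : acder (2 * n).-1 f -> acder (2 * n).-1 g ->
  -1 < x -> x < y -> y < 1 ->
  let h z := jweight al be z * (real_pow n f z * g z - f z * real_pow n g z) in
  (@lebesgue_measure R).-integrable `]x, y[ (EFin \o h) ->
  real_bracket f g y - real_bracket f g x = \int[lebesgue_measure]_(z in `]x, y[) h z.
Proof.
move=> Hf Hg x1 xy y1 h inth; apply: ac_integral => //.
  by apply: (acder_rbr Hf Hg) => //; exact: ltW.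
have acS k : acder (2 * n).-1 k -> ac x y (real_quasi 1 k).
  move=> Hk; suff : acder 0 (real_quasi 1 k) by apply=> //; exact: ltW.
  by apply: acder_Sj; apply: acder_leN Hk; lia.
apply: filterS2 (ac_ae_derivable xy (acS _ Hf)) (ac_ae_derivable xy (acS _ Hg)).
  exact: (ae_filter_ringOfSetsType lebesgue_measure).
move=> z df dg zxy _.
have zI : -1 < z < 1.
  by case/andP: zxy => xz zy; rewrite (lt_trans x1 xz) (lt_trans zy y1).
by have [_ ->] := derive1_rbr Hf Hg zI (df zxy) (dg zxy).
Qed.

Lemma topflux_integral f x y : acder (2 * n).-1 f -> -1 < x -> x < y -> y < 1 ->
  let h z := - (jweight al be z * real_pow n f z) in
  (@lebesgue_measure R).-integrable `]x, y[ (EFin \o h) ->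
  topflux f y - topflux f x = \int[lebesgue_measure]_(z in `]x, y[) h z.
Proof.
move=> Hf x1 xy y1 h inth; apply: ac_integral => //.
  suff : acder 0 (topflux f) by apply=> //; exact: ltW.
  exact: acder_topflux.
apply: (@filterS _ _ (ae_filter_ringOfSetsType lebesgue_measure) setT); last exact: filterT.
move=> z _ zxy _; rewrite derive1_topflux //.
by case/andP: zxy => xz zy; rewrite (lt_trans x1 xz) (lt_trans zy y1).
Qed.

End Jacobi.

(** * Expansion of the maximal domain at an endpoint *)

Section LinearSum.
Variable R : realType.

(** The operators met here are linear only on regular functions and at points of (-1, 1), so sums
    are treated once for an abstract [T]. *)
Lemma lin_sum (T : (R -> R) -> R -> R) (N : nat) :
  (forall (f g : R -> R) (c : R), acder N f -> acder N g -> forall x, -1 < x < 1 ->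
    T (fun y => f y + c * g y) x = T f x + c * T g x) ->
  forall (r : seq nat) (c : nat -> R) (F : nat -> R -> R),
  (forall i, i \in r -> acder N (F i)) -> forall x, -1 < x < 1 ->
  T (fun y => \sum_(i <- r) c i * F i y) x = \sum_(i <- r) c i * T (F i) x.
Proof.
move=> Tlin r c F; elim: r => [|i r IH] H x xI.
  (* The combination 0 + (-1) 0 gives T 0 = T 0 - T 0. *)
  have := Tlin (fun=> 0) (fun=> 0) (-1) (acder_cst N 0) (acder_cst N 0) x xI.
  have -> : (fun y : R => 0 + -1 * 0) = (fun=> 0) :> (R -> R).
    by apply/funext => y; rewrite mulr0 addr0.
  rewrite mulN1r subrr big_nil => T0.
  have -> : (fun y => \sum_(i <- [::]) c i * F i y) = (fun=> 0).
    by apply/funext => y; rewrite big_nil.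
  exact: T0.
have Hr j : j \in r -> acder N (F j) by move=> jr; apply: H; rewrite inE jr orbT.
have Ks : acder N (fun y => \sum_(i <- r) c i * F i y).
  by apply: acder_sum => j /Hr; exact: acder_scale.
rewrite big_cons -(IH Hr x xI) addrC -(Tlin _ _ _ Ks (H i (mem_head _ _)) x xI).
by congr (T _ x); apply/funext => y; rewrite big_cons addrC.
Qed.

(** How the coefficients of an expansion of f follow from those of ell f, up to a free first
    value. *)
Lemma solve_recurrence (L M tgt : nat -> R) (c0 : R) :
  (forall i, L i.+1 != 0) -> exists c : nat -> R,
  c 0%N = c0 /\ forall i, c i.+1 * L i.+1 + c i * M i = tgt i.
Proof.
move=> L0.
pose c := fix c (i : nat) : R := if i is i'.+1 then (tgt i' - c i' * M i') / L i'.+1 else c0.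
by exists c; split=> // i /=; rewrite divfK // subrK.
Qed.

End LinearSum.

Section EndpointExpansion.
Variable R : realType.
Variables (al be : R) (n : nat) (C : nat -> R).
Hypothesis hal : 0 < al < 1.
Hypothesis hbe : 0 < be < 1.
Hypothesis hn : (0 < n)%N.
Hypothesis hCr : forall q : R -> R, (forall m, acder m q) -> forall x, -1 < x < 1 ->
  real_pow al be n q x = (jweight al be x)^-1 *
    \sum_(1 <= k < n.+1) (-1) ^+ k * iderive k (fun y => real_coef al be C k y * iderive k q y) x.
Variable b : bool.
Implicit Types (f g : R -> R) (x y s : R).

Local Notation a := (endexp al be b).
Local Notation a' := (endexp al be (~~ b)).
Local Notation w := (jweight al be).
Local Notation rell := (real_expr al be).
Local Notation rellk := (real_pow al be).
Local Notation rflux := (real_flux al be).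
Local Notation ra := (real_coef al be C).
Local Notation Sj := (real_quasi al be n C).
Local Notation rbr := (real_bracket al be n C).
Local Notation endO := (endO b).
Local Notation E := (endfilter b).
Local Notation q i := (endpow b (i%:R - a)).

Lemma a_in : 0 < a < 1.
Proof. by rewrite /endexp; case: b. Qed.

Let a0 : 0 < a. Proof. by case/andP: a_in. Qed.
Let a1 : a < 1. Proof. by case/andP: a_in. Qed.

Let t0 x : -1 < x < 1 -> 0 < endvar b x.
Proof. by rewrite (endvar_in b) => /andP[]. Qed.

Let t0' x : -1 < x < 1 -> 0 < endvar (~~ b) x.
Proof. by rewrite (endvar_in (~~ b)) => /andP[]. Qed.

Lemma nearI (P : R -> Prop) : (forall x, -1 < x < 1 -> P x) -> \forall x \near E, P x.
Proof.
by move=> H; near=> x; apply: H; near: x; exact: E_in.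
Unshelve. all: by end_near. Qed.

(** * Orders of the weights and the action of ell on powers of the distance *)

Lemma endO_jweight (k : R) N : endO 1 (a + k) N (jweight (al + k) (be + k)).
Proof.
apply: (endO_congr (f := fun x => endpow b (a + k) x * endpow (~~ b) (a' + k) x)).
  by apply: nearI => x _; rewrite (jweightE _ _ b).
by apply: (@endO_eq _ _ _ (a + k + 0)); [rewrite addr0|apply: endO_mul; [exact: endO_endpow|exact: endO_endpowN]].
Qed.

Lemma endO_w N : endO 1 a N w.
Proof. by have := endO_jweight 0 N; rewrite !addr0. Qed.

Lemma endO_ra k N : endO 1 (a + k%:R) N (ra k).
Proof. exact/endO_scale/endO_jweight. Qed.

Lemma endO_wV N : endO 1 (- a) N (fun x => (w x)^-1).
Proof.
apply: (endO_congr (f := fun x => endpow b (- a) x * endpow (~~ b) (- a') x)).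
  by apply: nearI => x _; rewrite (jweight0E _ _ b) /endpow !powRN invfM.
by apply: (@endO_eq _ _ _ (- a + 0)); [rewrite addr0|apply: endO_mul; [exact: endO_endpow|exact: endO_endpowN]].
Qed.

Lemma endO_pV N : endO 1 (- a - 1) N (fun x => (jweight (al + 1) (be + 1) x)^-1).
Proof.
apply: (endO_congr (f := fun x => endpow b (- a - 1) x * endpow (~~ b) (- a' - 1) x)).
  by apply: nearI => x _; rewrite (jweightE _ _ b) /endpow -!opprD !powRN invfM.
by apply: (@endO_eq _ _ _ (- a - 1 + 0)); [rewrite addr0|apply: endO_mul; [exact: endO_endpow|exact: endO_endpowN]].
Qed.

(** ell t^s is [shift_coef s] t^(s - 1) + [diag_coef s] t^s. The former is the indicial polynomial:
    its roots 0 and -a are the exponents at the endpoint, so the powers t^0 and q_0 = t^(-a) produce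
    nothing below themselves. *)
Definition shift_coef s := - (2 * s * (a + s)).
Definition diag_coef s := s * (a + s + a' + 1).

Lemma rflux_endpow s x : -1 < x < 1 ->
  rflux (endpow b s) x = - (endsign R b * s) * (endpow b (a + s) x * endpow (~~ b) (a' + 1) x).
Proof.
move=> xI; rewrite /rflux derive1_endpow ?t0 // (jweightE _ _ b).
have -> : a + s = (a + 1) + (s - 1) by ring.
by rewrite (pwD (a + 1) (s - 1) (t0 xI)); ring.
Qed.

Lemma rell_endpow s x : -1 < x < 1 ->
  rell (endpow b s) x = shift_coef s * endpow b (s - 1) x + diag_coef s * endpow b s x.
Proof.
move=> xI; rewrite /rell (I_derive1 (rflux_endpow s) xI).
have d1 : derivable (endpow b (a + s)) x 1 by exact/derivable_endpow/t0.
have d2 : derivable (endpow (~~ b) (a' + 1)) x 1 by exact/derivable_endpow/t0'.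
have d12 : derivable (fun y => endpow b (a + s) y * endpow (~~ b) (a' + 1) y) x 1.
  exact: (derivableM d1 d2).
rewrite (derive1Ml _ d12) (derive1M d1 d2) !derive1_endpow ?t0 ?t0' // addrK sgN.
have e1 : endpow b (a + s - 1) x = endpow b a x * endpow b (s - 1) x.
  by rewrite -addrA (pwD a (s - 1) (t0 xI)).
have e2 : endpow b (a + s) x = endpow b a x * endpow b s x by rewrite (pwD a s (t0 xI)).
(* Writing the other distance as 2 - t splits the result into the powers s - 1 and s. *)
have e3 : endpow (~~ b) (a' + 1) x = endpow (~~ b) a' x * (2 - endvar b x).
  by rewrite (pwD a' 1 (t0' xI)) (pw1 (t0' xI)) ttN.
have e4 : endpow b s x = endpow b (s - 1) x * endvar b x.
  by rewrite -{1}(subrK 1 s) (pwD (s - 1) 1 (t0 xI)) (pw1 (t0 xI)).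
rewrite e1 e2 e3 e4 (jweight0E _ _ b) /shift_coef /diag_coef.
have w1 : endpow b a x != 0 by rewrite gt_eqF // endpow_gt0 // t0.
have w2 : endpow (~~ b) a' x != 0 by rewrite gt_eqF // endpow_gt0 // t0'.
have : endsign R b = 1 \/ endsign R b = -1 by rewrite /endsign; case: (b); [right|left]; rewrite ?expr0 ?expr1.
move: w1 w2; move: (endpow b a x) (endpow (~~ b) a' x) (endpow b (s - 1) x) (endvar b x) (endsign R b).
by move=> A B P t e A0 B0 [->|->]; field; rewrite A0 B0.
Qed.

Definition endcomb (c d : nat -> R) (m : nat) x : R :=
  \sum_(0 <= i < m) c i * endpow b i%:R x + \sum_(0 <= i < m) d i * q i x.

Lemma acder_comb c d m N : acder N (endcomb c d m).
Proof. by apply: acder_add; apply: acder_sum => i _; apply: acder_scale; exact: acder_endpow. Qed.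

Lemma endO_comb c d m N : endO 1 (- a) N (endcomb c d m).
Proof.
apply: endO_add; apply: endO_sum => i _ _; apply: endO_scale => //.
  apply: endO_le (endO_endpow _ _ _); apply: (@le_trans _ _ 0); last exact: ler0n.
  by rewrite oppr_le0 ltW.
by apply: endO_le (endO_endpow _ _ _); rewrite lerDr ler0n.
Qed.

Lemma lam_int_neq0 i : shift_coef i.+1%:R != 0.
Proof.
rewrite oppr_eq0 !mulf_neq0 ?pnatr_eq0 // gt_eqF // ltr_wpDr //.
Qed.

Lemma lam_shift_neq0 i : shift_coef (i.+1%:R - a) != 0.
Proof.
have i1 : 1 <= i.+1%:R :> R by rewrite ler1n.
rewrite oppr_eq0 !mulf_neq0 ?pnatr_eq0 //; first by rewrite gt_eqF // subr_gt0 (lt_le_trans a1).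
by rewrite addrC subrK pnatr_eq0.
Qed.

Lemma rell_sum (r : seq nat) (c : nat -> R) (F : nat -> R -> R) :
  (forall i, i \in r -> acder 2 (F i)) -> forall x, -1 < x < 1 ->
  rell (fun y => \sum_(i <- r) c i * F i y) x = \sum_(i <- r) c i * rell (F i) x.
Proof.
by apply: lin_sum => f g k Kf Kg x xI; exact: (@rell_lin _ al be f g k 0).
Qed.

Lemma rell_add f g : acder 2 f -> acder 2 g -> forall x, -1 < x < 1 ->
  rell (fun y => f y + g y) x = rell f x + rell g x.
Proof.
move=> Kf Kg x xI; have := @rell_lin _ al be f g 1 0 Kf Kg x xI.
by rewrite mul1r; under [X in rell X _]eq_fun do rewrite mul1r.
Qed.

Lemma rell_sub f g : acder 2 f -> acder 2 g -> forall x, -1 < x < 1 ->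
  rell (fun y => f y - g y) x = rell f x - rell g x.
Proof.
move=> Kf Kg x xI; have := @rell_lin _ al be f g (-1) 0 Kf Kg x xI.
by rewrite mulN1r; under [X in rell X _]eq_fun do rewrite mulN1r.
Qed.

(** As s0 is an exponent of ell, the lowest power loses its shifted term, and the others are
    re-indexed. *)
Lemma rell_comb_sum (s0 : R) (c : nat -> R) m x : shift_coef s0 = 0 -> -1 < x < 1 ->
  rell (fun y => \sum_(0 <= i < m.+1) c i * endpow b (i%:R + s0) y) x =
  \sum_(0 <= i < m) (c i.+1 * shift_coef (i.+1%:R + s0) + c i * diag_coef (i%:R + s0)) * endpow b (i%:R + s0) x
  + c m * diag_coef (m%:R + s0) * endpow b (m%:R + s0) x.
Proof.
move=> l0 xI; rewrite rell_sum //; last by move=> i _; exact: acder_endpow.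
have -> : \sum_(0 <= i < m.+1) c i * rell (endpow b (i%:R + s0)) x =
    \sum_(0 <= i < m.+1) (c i * shift_coef (i%:R + s0) * endpow b (i%:R + s0 - 1) x +
                          c i * diag_coef (i%:R + s0) * endpow b (i%:R + s0) x).
  apply: eq_bigr => i _; rewrite rell_endpow //.
  by move: (shift_coef _) (diag_coef _) (endpow _ _ _) (endpow _ _ _) => A B P Q; ring.
rewrite big_split /= big_nat_recl // add0r l0 mulr0 mul0r add0r.
rewrite [X in _ + X]big_nat_recr //= addrA -big_split /=; congr (_ + _).
apply: eq_bigr => i _; rewrite mulrDl; congr (_ + _); congr (_ * endpow b _ x).
by rewrite -natr1; ring.
Qed.

Lemma lam0 : shift_coef 0 = 0. Proof. by rewrite /shift_coef mulr0 mul0r oppr0. Qed.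
Lemma lamNa : shift_coef (- a) = 0. Proof. by rewrite /shift_coef subrr mulr0 oppr0. Qed.

(** The first m coefficients of the image have the shape of [solve_recurrence]; the two terms of
    order m have not, and go into the remainder in [expansion_step]. *)
Lemma rell_comb c d m x : -1 < x < 1 -> rell (endcomb c d m.+1) x =
  endcomb (fun i => c i.+1 * shift_coef i.+1%:R + c i * diag_coef i%:R)
       (fun i => d i.+1 * shift_coef (i.+1%:R - a) + d i * diag_coef (i%:R - a)) m x
  + c m * diag_coef m%:R * endpow b m%:R x + d m * diag_coef (m%:R - a) * q m x.
Proof.
move=> xI; rewrite /endcomb rell_add //; try by apply: acder_sum => i _; apply: acder_scale; exact: acder_endpow.
have H1 := @rell_comb_sum 0 c m x lam0 xI.
have H2 := @rell_comb_sum (- a) d m x lamNa xI.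
have e1 : (fun y => \sum_(0 <= i < m.+1) c i * endpow b (i%:R + 0) y) =
    (fun y => \sum_(0 <= i < m.+1) c i * endpow b i%:R y).
  by apply/funext => y; apply: eq_bigr => i _; rewrite addr0.
rewrite {}e1 in H1; rewrite {}H1 {}H2.
have -> : \sum_(0 <= i < m) (c i.+1 * shift_coef (i.+1%:R + 0) + c i * diag_coef (i%:R + 0)) * endpow b (i%:R + 0) x =
    \sum_(0 <= i < m) (c i.+1 * shift_coef i.+1%:R + c i * diag_coef i%:R) * endpow b i%:R x.
  by apply: eq_bigr => i _; rewrite !addr0.
rewrite (addr0 m%:R).
move: (\sum_(0 <= i < m) _) (\sum_(0 <= i < m) _) (c m * _ * _) (d m * _ * _) => A B P Q; ring.
Qed.

Lemma rell_comb_ex c d m : exists c' d', forall x, -1 < x < 1 ->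
  rell (endcomb c d m) x = endcomb c' d' m x.
Proof.
case: m => [|m].
  exists c, d => x xI; rewrite [RHS]/endcomb !big_geq // add0r.
  have H := @rell_sum [::] c (fun=> fun=> 0) (fun i h => acder_cst 2 0) x xI.
  rewrite [RHS]big_nil in H; rewrite -[RHS]H.
  by apply: (@rell_congr _ al be _ _ _ x xI) => y _; rewrite /endcomb !big_geq // big_nil add0r.
pose cc i := (if (i < m)%N then c i.+1 * shift_coef i.+1%:R else 0) + c i * diag_coef i%:R.
pose dd i := (if (i < m)%N then d i.+1 * shift_coef (i.+1%:R - a) else 0) + d i * diag_coef (i%:R - a).
exists cc, dd => x xI; rewrite rell_comb // /endcomb !big_nat_recr //=.
have -> : \sum_(0 <= i < m) cc i * endpow b i%:R x =
    \sum_(0 <= i < m) (c i.+1 * shift_coef i.+1%:R + c i * diag_coef i%:R) * endpow b i%:R x.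
  by apply: eq_big_nat => i /andP[_ im]; rewrite /cc im.
have -> : \sum_(0 <= i < m) dd i * q i x =
    \sum_(0 <= i < m) (d i.+1 * shift_coef (i.+1%:R - a) + d i * diag_coef (i%:R - a)) * q i x.
  by apply: eq_big_nat => i /andP[_ im]; rewrite /dd im.
rewrite /cc /dd !ltnn !add0r.
move: (\sum_(0 <= i < m) _) (\sum_(0 <= i < m) _) => A B; ring.
Qed.

Lemma rellk_comb_ex k c d m : exists c' d', forall x, -1 < x < 1 ->
  rellk k (endcomb c d m) x = endcomb c' d' m x.
Proof.
elim: k c d => [|k IH] c d; first by exists c, d.
have [c1 [d1 H1]] := rell_comb_ex c d m; have [c2 [d2 H2]] := IH c1 d1.
by exists c2, d2 => x xI; rewrite rellkS -H2 //; exact: (@rellk_congr _ al be k _ _ H1 x xI).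
Qed.

(** Flux increments are O(t^((1 + a) / 2)); division by t^(1 + a) and integration give t^(1 - (1 +
    a) / 2), and every further inversion of ell adds one power. *)
Definition remexp (m : nat) : R := m%:R - (1 + a) / 2.

Definition expansion (m N : nat) f := exists c d, endO 1 (remexp m) N (fun x => f x - endcomb c d m x).

(* A solution of a first-order equation rflux h = H is regained from H by
   dividing by the leading coefficient and integrating. *)
Lemma flux_inv (h : R -> R) (ga : R) N : -1 < ga -> (\forall x \near E, derivable h x 1) ->
  endO 1 (a + 1 + ga) N (rflux h) ->
  exists c0 : R, endO 1 (ga + 1) N.+1 (fun x => h x - c0).
Proof.
move=> ga1 dh Hf.
have Hd : endO 1 ga N (derive1 h).
  apply: (endO_congr (f := fun x => (jweight (al + 1) (be + 1) x)^-1 * rflux h x)).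
    near=> x; rewrite /real_flux mulKf // gt_eqF //.
    have xI : -1 < x < 1 by near: x; exact: E_in.
    by rewrite (jweightE _ _ b) mulr_gt0 // endpow_gt0 ?t0 ?t0'.
  by apply: (@endO_eq _ _ _ (- a - 1 + (a + 1 + ga))); [ring|apply: endO_mul (endO_pV N) Hf].
have [M hM] := endO_bound Hd.
have [L _ [hL _]] := growth ga1 dh hM.
have near_shift x : \forall y \near x, (fun y => h y - L) y = h y + - L by exists 1 => /=.
have Ed : \forall x \near E, derive1 h x = derive1 (fun y => h y - L) x.
  near=> x; have dx : derivable h x 1 by near: x.
  by have [_ ->] := near_derive1_shift (near_shift x) dx.
exists L; split; first exact: hL; split.
  near=> x; have dx : derivable h x 1 by near: x.
  by have [] := near_derive1_shift (near_shift x) dx.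
by rewrite addrK; exact: endO_congr Ed Hd.
Unshelve. all: by end_near. Qed.

(** The flux of t^s has order a + s, so among the t^i and q_i only q_0 has a flux not tending to 0;
    the limit of a flux therefore reads off the coefficient d_0. *)
Lemma rflux_endpow_cvg s : - a < s \/ s = 0 -> rflux (endpow b s) @ E --> (0 : R).
Proof.
move=> hs; apply: (E_cvg_eq (f := fun x => - (endsign R b * s) * (endpow b (a + s) x * endpow (~~ b) (a' + 1) x))).
  by apply: nearI => x xI; rewrite rflux_endpow.
case: hs => [as0|->]; last first.
  apply: (E_cvg_eq (f := fun=> 0)); last exact: E_cvg_cst.
  by apply: nearW => x; rewrite mulr0 oppr0 mul0r.
rewrite -[X in _ --> X](mulr0 (- (endsign R b * s))); apply: cvgMr.
rewrite -[X in _ --> X](mul0r (2 `^ (a' + 1))); apply: cvgM; last exact: endpowN_cvg.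
by apply: endpow_cvg0; rewrite -(subrr a) ltrD2l.
Qed.

Lemma rflux_pwNa x : -1 < x < 1 -> rflux (endpow b (- a)) x = endsign R b * a * endpow (~~ b) (a' + 1) x.
Proof. by move=> xI; rewrite rflux_endpow // subrr pw0 mul1r mulrN opprK. Qed.

Lemma remexp_ge m : (0 < m)%N -> - a <= remexp m.
Proof.
move=> m0; have : 1 <= m%:R :> R by rewrite ler1n.
by move: a0 a1; rewrite /remexp; lra.
Qed.

Lemma endO_expansion m N f : (0 < m)%N -> expansion m N f -> endO 1 (- a) N f.
Proof.
move=> m0 [c [d H]]; apply: (endO_congr (f := fun x => endcomb c d m x + (f x - endcomb c d m x))).
  by apply: nearW => x; rewrite addrC subrK.
by apply: endO_add; [exact: endO_comb|apply: endO_le H; exact: remexp_ge].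
Qed.

Lemma rflux_sum (r : seq nat) (c : nat -> R) (F : nat -> R -> R) :
  (forall i, i \in r -> acder 1 (F i)) -> forall x, -1 < x < 1 ->
  rflux (fun y => \sum_(i <- r) c i * F i y) x = \sum_(i <- r) c i * rflux (F i) x.
Proof.
apply: lin_sum => f g k Kf Kg x xI; rewrite /real_flux.
have df := acder_derivable (isT : (0 < 1)%N) Kf xI.
have dg := acder_derivable (isT : (0 < 1)%N) Kg xI.
rewrite (derive1_lin k df dg); move: (derive1 f x) (derive1 g x) => u v; ring.
Qed.

Lemma rflux_lin f g (k : R) x : acder 1 f -> acder 1 g -> -1 < x < 1 ->
  rflux (fun y => f y + k * g y) x = rflux f x + k * rflux g x.
Proof.
move=> Kf Kg xI; rewrite /real_flux.
have df := acder_derivable (isT : (0 < 1)%N) Kf xI.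
have dg := acder_derivable (isT : (0 < 1)%N) Kg xI.
rewrite (derive1_lin k df dg); move: (derive1 f x) (derive1 g x) => u v; ring.
Qed.

Lemma rflux_comb_cvg c d m :
  rflux (endcomb c d m.+1) @ E --> d 0%N * (endsign R b * a * 2 `^ (a' + 1)).
Proof.
pose G x := \sum_(0 <= i < m.+1) c i * rflux (endpow b i%:R) x +
            \sum_(0 <= i < m.+1) d i * rflux (q i) x.
have h : {near E, G =1 rflux (endcomb c d m.+1)}.
  apply: nearI => x xI; rewrite /G.
  rewrite -!rflux_sum //; try (by move=> i _; exact: acder_endpow).
  have K1 : acder 1 (fun y => \sum_(0 <= i < m.+1) c i * endpow b i%:R y).
    by apply: acder_sum => i _; apply: acder_scale; exact: acder_endpow.
  have K2 : acder 1 (fun y => \sum_(0 <= i < m.+1) d i * q i y).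
    by apply: acder_sum => i _; apply: acder_scale; exact: acder_endpow.
  have := rflux_lin 1 K1 K2 xI; rewrite mul1r => <-.
  by congr (rflux _ x); apply/funext => y; rewrite mul1r.
apply: (E_cvg_eq h).
have -> : d 0%N * (endsign R b * a * 2 `^ (a' + 1)) =
    \sum_(i <- index_iota 0 m.+1) c i * 0 +
    \sum_(i <- index_iota 0 m.+1) d i * (if i is 0%N then endsign R b * a * 2 `^ (a' + 1) else 0).
  rewrite [X in _ = X + _]big1; last by move=> i _; rewrite mulr0.
  by rewrite big_nat_recl // big1 ?addr0 ?add0r // => i _; rewrite mulr0.
apply: cvgD; apply: (@E_cvg_sum R b _ (index_iota 0 m.+1) (fun i x => _ i * rflux (endpow b _) x)) => i _; apply: cvgMr.
  apply: rflux_endpow_cvg; case: i => [|i]; [by right|left].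
  by rewrite (lt_le_trans (_ : - a < 0)) ?oppr_lt0.
case: i => [|i]; last first.
  by apply: rflux_endpow_cvg; left; rewrite ltrDr.
have h0 : \forall x \near E, endsign R b * a * endpow (~~ b) (a' + 1) x = rflux (q 0%N) x.
  by apply: nearI => x xI; rewrite sub0r rflux_pwNa.
by apply: (E_cvg_eq h0); apply: cvgMr; exact: endpowN_cvg.
Qed.

Lemma derive1_rflux f x : -1 < x < 1 -> derive1 (rflux f) x = - (w x * rell f x).
Proof.
move=> xI; rewrite /real_expr mulNr mulrN opprK mulrA divff ?mul1r //.
by rewrite gt_eqF // jweight_gt0.
Qed.

Lemma endO_derive1_rflux s N f : endO 1 s N (rell f) -> endO 1 (a + s) N (derive1 (rflux f)).
Proof.
move=> H; apply: (endO_congr (f := fun x => - (w x * rell f x))).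
  by apply: nearI => x xI; rewrite derive1_rflux.
by apply: endO_opp => //; exact: endO_mul (endO_w N) H.
Qed.

Lemma near_derivable_I N f : (0 < N)%N -> acder N f -> \forall x \near E, derivable f x 1.
Proof. by move=> N0 Kf; apply: nearI => x xI; exact: (acder_derivable N0 Kf xI). Qed.

Let flux_coef : endsign R b * a * 2 `^ (a' + 1) != 0.
Proof. by rewrite !mulf_neq0 ?endsign_neq0 ?gt_eqF ?powR_gt0. Qed.

Let remexp_gt m : (0 < m)%N -> -1 < remexp m.
Proof. by move=> /remexp_ge; move: a0 a1; lra. Qed.

(** The constant of integration is absorbed by the coefficient of t^0. *)
Lemma expansion_shift m N f c d c0 :
  endO 1 (remexp m.+1) N (fun x => (f x - endcomb c d m.+1 x) - c0) -> expansion m.+1 N f.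
Proof.
move=> H; exists (fun i => if i is 0%N then c 0%N + c0 else c i), d.
apply: endO_congr H; apply: nearW => x; rewrite /endcomb [in RHS]big_nat_recl // [in LHS]big_nat_recl //.
by rewrite pw0; move: (\sum_(0 <= i < m) _) => A; move: (\sum_(0 <= i < m.+1) _) => B; ring.
Qed.

(** A combination whose image under ell matches the expansion of ell f is subtracted, and the
    difference is integrated twice. The two free constants are d_0, fixed by the limit of the flux,
    and c_0, the last constant of integration. *)
Lemma expansion_step m N f : acder 2 f -> (0 < m)%N -> expansion m N (rell f) -> expansion m.+1 N.+2 f.
Proof.
move=> Kf m0 Xg; have [c [d Hr]] := Xg.
have Kflux : acder 1 (rflux f) by exact: acder_rflux.
have dflux := near_derivable_I (isT : (0 < 1)%N) Kflux.
have H0 : endO 1 0 0 (derive1 (rflux f)).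
  apply: (@endO_eq _ _ _ (a - a)); first by rewrite subrr.
  by apply: endO_derive1_rflux; apply: endO_leN (endO_expansion m0 Xg).
have [M hM] := endO_bound H0.
have m10 : -1 < 0 :> R by rewrite oppr_lt0.
have [L fL _] := growth m10 dflux hM.
(* The value of d_0 for which the flux of the combination also tends to L. *)
pose kap := L / (endsign R b * a * 2 `^ (a' + 1)).
have [c' [c'0 Hc']] := @solve_recurrence R (fun i => shift_coef i%:R) (fun i => diag_coef i%:R) c 0 lam_int_neq0.
have [d' [d'0 Hd']] := @solve_recurrence R (fun i => shift_coef (i%:R - a)) (fun i => diag_coef (i%:R - a)) d kap lam_shift_neq0.
pose F := endcomb c' d' m.+1; pose h x := f x - F x.
have KF N' : acder N' F by exact: acder_comb.
have Kh : acder 2 h by exact: (acder_sub Kf (KF 2%N)).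
have Hh : endO 1 (remexp m) N (rell h).
  apply: (endO_congr (f := fun x => (rell f x - endcomb c d m x) -
      (c' m * diag_coef m%:R * endpow b m%:R x + d' m * diag_coef (m%:R - a) * q m x))).
    apply: nearI => x xI; rewrite (rell_sub Kf (KF 2%N) xI) (rell_comb c' d' m xI).
    rewrite (_ : endcomb _ _ m x = endcomb c d m x); last first.
      by rewrite /endcomb; congr (_ + _); apply: eq_bigr => i _; rewrite ?Hc' ?Hd'.
    by move: (endcomb _ _ _ _) (rell _ _) => A B; ring.
  apply: endO_sub => //; apply: endO_add; apply: endO_scale => //; apply: endO_le (endO_endpow _ _ _).
    by rewrite /remexp; move: a0; lra.
  by rewrite /remexp; move: a0 a1; lra.
have Kfluxh : acder 1 (rflux h) by exact: acder_rflux.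
have dfluxh := near_derivable_I (isT : (0 < 1)%N) Kfluxh.
have Hd := endO_derive1_rflux Hh.
have [M' hM'] := endO_bound Hd.
have ag : -1 < a + remexp m by move: (remexp_gt m0) a0; lra.
have [L' hL' HL'] := growth ag dfluxh hM'.
(* Without this the flux of h would be small only up to a constant. *)
have L'0 : L' = 0.
  apply: (E_cvg_unique hL').
  have -> : 0 = L - d' 0%N * (endsign R b * a * 2 `^ (a' + 1)).
    by rewrite d'0 /kap divfK // subrr.
  apply: (E_cvg_eq (f := fun x => rflux f x - rflux F x)); last first.
    by apply: cvgB => //; exact: rflux_comb_cvg.
  apply: nearI => x xI; have := rflux_lin (-1) (acder_S Kf) (KF 1%N) xI.
  rewrite mulN1r => <-; congr (rflux _ x); by apply/funext => y; rewrite mulN1r.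
have Hfl : endO 1 (a + 1 + remexp m) N.+1 (rflux h).
  have e1 : a + remexp m + 1 = a + 1 + remexp m by exact: addrAC.
  have e2 : a + remexp m = a + 1 + remexp m - 1 by rewrite -e1 addrK.
  split; last by split; [exact: dfluxh|exact: (endO_eq e2 Hd)].
  have [[M2 hM2] _] := HL'; exists M2; apply: filterS hM2 => x.
  by rewrite L'0 subr0 e1.
have [c0 Hc0] := flux_inv (remexp_gt m0) (near_derivable_I (isT : (0 < 2)%N) Kh) Hfl.
apply: (expansion_shift (c := c') (d := d') (c0 := c0)).
by apply: endO_eq Hc0; rewrite /remexp -natr1; ring.
Qed.

(** There is no expansion of ell f to start from: the Hoelder estimate replaces the first
    integration, and a multiple of q_0 removes the limit of the flux. *)
Lemma expansion_base f (K : R) : acder 1 f ->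
  (exists2 d : R, 0 < d & forall x y, 0 < endvar b x < d -> 0 < endvar b y < d ->
    `|rflux f x - rflux f y| <= K * endpow b ((1 + a) / 2) x + K * endpow b ((1 + a) / 2) y) ->
  expansion 1 1 f.
Proof.
move=> Kf Hf; pose r := (1 + a) / 2.
have r0 : 0 < r by move: a0; rewrite /r; lra.
have G0 : (fun x => K * endpow b r x) @ E --> (0 : R).
  by rewrite -[X in _ --> X](mulr0 K); apply: cvgMr; exact: endpow_cvg0.
have [L fL HL] := E_cauchy G0 Hf.
pose kap := L / (endsign R b * a * 2 `^ (a' + 1)).
pose F := endcomb (fun=> 0) (fun=> kap) 1; pose h x := f x - F x.
have KF N' : acder N' F by exact: acder_comb.
have FE x : -1 < x < 1 -> rflux F x = kap * (endsign R b * a * endpow (~~ b) (a' + 1) x).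
  move=> xI; rewrite -rflux_pwNa //.
  have -> : F = (fun y => 0 + kap * endpow b (- a) y).
    by apply/funext => y; rewrite /F /endcomb !big_nat1 mul0r sub0r.
  by rewrite rflux_lin //; [rewrite /real_flux derive1_const mulr0 add0r|exact: acder_cst|exact: acder_endpow].
(* The flux of q_0 differs from its limit by O(t), within the error t^((1 + a) / 2) because a <
   1. *)
have HF : endO 1 1 0 (fun x => rflux F x - L).
  have m10 : -1 < 0 :> R by rewrite oppr_lt0.
  have Hp := endO_endpowN b (a' + 1) 1 (lexx (0 : R)).
  have [M hM] := endO_bound (endO_eq (subrr 0) (endO_D Hp)).
  have [L1 hL1 HL1] := growth m10 (endO_derivable Hp) hM.
  have L1E := E_cvg_unique hL1 (@endpowN_cvg R b (a' + 1)).
  apply: (endO_congr (f := fun x => kap * (endsign R b * a) * (endpow (~~ b) (a' + 1) x - L1))).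
    apply: nearI => x xI; rewrite FE // L1E /kap.
    have -> : L / (endsign R b * a * 2 `^ (a' + 1)) * (endsign R b * a) * (endpow (~~ b) (a' + 1) x - 2 `^ (a' + 1)) =
      L / (endsign R b * a * 2 `^ (a' + 1)) * (endsign R b * a * endpow (~~ b) (a' + 1) x) -
      L / (endsign R b * a * 2 `^ (a' + 1)) * (endsign R b * a * 2 `^ (a' + 1)) by ring.
    by rewrite (divfK flux_coef).
  by apply: endO_scale => //; apply: endO_eq HL1; rewrite add0r.
have Kh : acder 1 h by exact: (acder_sub Kf (KF 1%N)).
have Hfl : endO 1 (a + 1 + remexp 0) 0 (rflux h).
  apply: (@endO_eq _ _ _ r); first by rewrite /remexp /r mulr0n; lra.
  apply: (endO_congr (f := fun x => (rflux f x - L) - (rflux F x - L))).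
    apply: nearI => x xI; have := rflux_lin (-1) Kf (KF 1%N) xI.
    rewrite mulN1r (_ : (fun y => f y + -1 * F y) = h).
      by move=> ->; ring.
    by apply/funext => y; rewrite mulN1r.
  apply: endO_sub => //; first by split=> //; exists K.
  by apply: endO_le HF; move: a1; rewrite /r; lra.
have g0 : -1 < remexp 0 by move: a1; rewrite /remexp; lra.
have [c0 Hc0] := flux_inv g0 (near_derivable_I (isT : (0 < 1)%N) Kh) Hfl.
apply: (expansion_shift (c := fun=> 0) (d := fun=> kap) (c0 := c0)).
by apply: endO_eq Hc0; rewrite /remexp -natr1; ring.
Qed.

(** Descending from ell^(n - 1) f to f, each step gains one order in the expansion and two
    derivatives of the remainder, from 1 up to 2n - 1. *)
Lemma expansion_Dmax f (K : R) : acder (2 * n).-1 f ->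
  (exists2 d : R, 0 < d & forall x y, 0 < endvar b x < d -> 0 < endvar b y < d ->
    `|topflux al be n f x - topflux al be n f y| <=
       K * endpow b ((1 + a) / 2) x + K * endpow b ((1 + a) / 2) y) ->
  expansion n (2 * n).-1 f.
Proof.
move=> Kf Hf; have H m : (m < n)%N -> expansion m.+1 (2 * m).+1 (rellk (n.-1 - m) f).
  elim: m => [|m IH] mn.
    rewrite subn0 muln0; apply: expansion_base Hf.
    have h : acder (1 + 2 * n.-1) f by apply: (@acder_leN R (2 * n).-1 _ f _ Kf); lia.
    exact: (@acder_rellk R al be n hn 1 n.-1 f h).
  have := IH (ltnW mn); have -> : (n.-1 - m)%N = (n.-1 - m.+1).+1 by lia.
  rewrite /real_pow iterS => H; have -> : (2 * m.+1).+1 = (2 * m).+3 by lia.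
  have h : acder (2 + 2 * (n.-1 - m.+1)) f by apply: (@acder_leN R (2 * n).-1 _ f _ Kf); lia.
  by apply: expansion_step => //; exact: (@acder_rellk R al be n hn 2 _ f h).
have := H n.-1; rewrite prednK // subnn; have -> : (2 * n.-1).+1 = (2 * n).-1 by lia.
by apply.
Qed.

End EndpointExpansion.

(** * Boundary limits at an endpoint *)

Section EndpointLimits.
Variable R : realType.
Variables (al be : R) (n : nat) (C : nat -> R).
Hypothesis hal : 0 < al < 1.
Hypothesis hbe : 0 < be < 1.
Hypothesis hn : (0 < n)%N.
Hypothesis hCr : forall q : R -> R, (forall m, acder m q) -> forall x, -1 < x < 1 ->
  real_pow al be n q x = (jweight al be x)^-1 *
    \sum_(1 <= k < n.+1) (-1) ^+ k * iderive k (fun y => real_coef al be C k y * iderive k q y) x.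
Variable b : bool.
Implicit Types (f g : R -> R) (x y s : R).

Local Notation a := (endexp al be b).
Local Notation a' := (endexp al be (~~ b)).
Local Notation w := (jweight al be).
Local Notation rell := (real_expr al be).
Local Notation rellk := (real_pow al be).
Local Notation rflux := (real_flux al be).
Local Notation ra := (real_coef al be C).
Local Notation Sj := (real_quasi al be n C).
Local Notation rbr := (real_bracket al be n C).
Local Notation endO := (endO b).
Local Notation E := (endfilter b).
Local Notation q i := (endpow b (i%:R - a)).
Local Notation comb := (endcomb al be b).

Let a0 : 0 < a. Proof. by case/andP: (a_in hal hbe b). Qed.
Let a1 : a < 1. Proof. by case/andP: (a_in hal hbe b). Qed.

Let t0 x : -1 < x < 1 -> 0 < endvar b x.
Proof. by rewrite (endvar_in b) => /andP[]. Qed.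

Let t0' x : -1 < x < 1 -> 0 < endvar (~~ b) x.
Proof. by rewrite (endvar_in (~~ b)) => /andP[]. Qed.

Lemma E_iderive f g k : (\forall x \near E, f x = g x) -> \forall x \near E, iderive k f x = iderive k g x.
Proof. by move=> fg; elim: k => [|k IH] //; exact: (E_derive1 IH). Qed.

Lemma E_sum_eq (r : seq nat) (F G : nat -> R -> R) :
  (forall i, \forall x \near E, F i x = G i x) ->
  \forall x \near E, \sum_(i <- r) F i x = \sum_(i <- r) G i x.
Proof.
move=> H; elim: r => [|i r IH]; first by apply: nearW => x; rewrite !big_nil.
by apply: filterS2 (H i) IH => x; rewrite !big_cons => -> ->.
Qed.

Lemma E_Sj j f g : (\forall x \near E, f x = g x) -> \forall x \near E, Sj j f x = Sj j g x.
Proof.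
move=> fg; apply: E_sum_eq => k.
have h : \forall x \near E, ra k x * iderive k f x = ra k x * iderive k g x.
  by apply: filterS (E_iderive k fg) => x ->.
by apply: filterS (E_iderive (k - j) h) => x ->.
Qed.

Lemma E_rbr f f' g g' : (\forall x \near E, f x = f' x) -> (\forall x \near E, g x = g' x) ->
  \forall x \near E, rbr f g x = rbr f' g' x.
Proof.
move=> ef eg; apply: E_sum_eq => j.
near=> x; congr (_ * _ - _ * _); near: x; by [exact: E_Sj|exact: E_iderive].
Unshelve. all: by end_near. Qed.

(** The factor in the k-th derivative of t^s. For s = k = i it is (-1)^i i! at 1 and i! at -1, the
    normalisation in [curly_p] and [curly_m]. *)
Definition falling s k : R := \prod_(l < k) - (endsign R b * (s - l%:R)).

Lemma iderive_endpow s k x : -1 < x < 1 -> iderive k (endpow b s) x = falling s k * endpow b (s - k%:R) x.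
Proof.
elim: k x => [|k IH] x xI; first by rewrite /falling big_ord0 mul1r subr0.
rewrite -iderive_derive1 (I_derive1 IH xI) (derive1Ml _ (derivable_endpow (t0 xI))).
by rewrite (derive1_endpow _ (t0 xI)) /falling big_ord_recr /= -natr1 opprD addrA mulrA.
Qed.

Lemma falling_zero i k : (i < k)%N -> falling i%:R k = 0.
Proof.
move=> ik; rewrite /falling (bigD1 (Ordinal ik)) //= subrr mulr0 oppr0 mul0r //.
Qed.

Lemma falling_diag i : falling i%:R i = (- endsign R b) ^+ i * i`!%:R.
Proof.
elim: i => [|i IH]; first by rewrite /falling big_ord0 expr0 mul1r fact0.
rewrite /falling big_ord_recl /= subr0.
have -> : \prod_(l < i) - (endsign R b * (i.+1%:R - (bump 0 l)%:R)) = falling i%:R i.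
  apply: eq_bigr => l _; rewrite /bump add1n; congr (- (_ * _)).
  by rewrite -!natr1; ring.
by rewrite IH exprS factS natrM; ring.
Qed.

Lemma falling_diag_neq0 i : falling i%:R i != 0.
Proof. by rewrite falling_diag mulf_neq0 ?expf_neq0 ?oppr_eq0 ?endsign_neq0 // pnatr_eq0 -lt0n fact_gt0. Qed.

(** 0 < a < 1 keeps i - a off the integers, so no factor vanishes. *)
Lemma falling_shift_neq0 i k : falling (i%:R - a) k != 0.
Proof.
apply/prodf_neq0 => l _; rewrite oppr_eq0 mulf_neq0 ?endsign_neq0 //.
have [il|li] := leqP i l.
  have : i%:R <= l%:R :> R by rewrite ler_nat.
  by move=> h; rewrite lt_eqF //; move: a0; lra.
have : l%:R + 1 <= i%:R :> R by rewrite natr1 ler_nat.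
by move=> h; rewrite gt_eqF //; move: a1; lra.
Qed.

(** Negative powers never appear: t^i is a polynomial, and [falling] vanishes once k exceeds i. *)
Lemma endO_iderive_pow i k N : endO 1 0 N (iderive k (endpow b (i%:R : R))).
Proof.
apply: (endO_congr (f := fun x => falling i%:R k * endpow b (i%:R - k%:R) x)).
  by apply: nearI => x xI; rewrite iderive_endpow.
have [ki|ik] := leqP k i.
  by apply: endO_scale => //; apply: endO_le (endO_endpow _ _ _); rewrite subr_ge0 ler_nat.
apply: endO_congr (endO_zero b 1 0 N); apply: nearW => x; by rewrite falling_zero // mul0r.
Qed.

Lemma endO_Sj s j f : (1 <= j <= n)%N -> endO 1 s (2 * n).-1 f ->
  endO 1 (a + s - n%:R + j%:R) 0 (Sj j f).
Proof.
move=> /andP[j0 jn] Hf; apply: endO_sum => k; rewrite mem_index_iota ltnS => /andP[jk kn] _.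
apply: endO_scale => //.
have Hk : endO 1 (a + k%:R + (s - 1 * k%:R)) (k - j + 0) (fun y => ra k y * iderive k f y).
  apply: endO_mul; first exact: endO_ra.
  by apply: endO_iderive; apply: endO_leN Hf; lia.
apply: endO_le (endO_iderive Hk); rewrite natrB //.
have : k%:R <= n%:R :> R by rewrite ler_nat.
by lra.
Qed.

(** All derivatives of t^i being bounded, the order is a + j even for i < n, where [endO_Sj] gives
    less. *)
Lemma endO_Sj_pow i j : endO 1 (a + j%:R) 0 (Sj j (endpow b i%:R)).
Proof.
apply: endO_sum => k; rewrite mem_index_iota ltnS => /andP[jk kn] _.
apply: endO_scale => //.
have Hk : endO 1 (a + k%:R + 0) (k - j + 0) (fun y => ra k y * iderive k (endpow b i%:R) y).
  by apply: endO_mul; [exact: endO_ra|exact: endO_iderive_pow].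
by apply: endO_eq (endO_iderive Hk); rewrite natrB //; ring.
Qed.

Lemma derive1_endvar x : derive1 (endvar b) x = - endsign R b.
Proof. by rewrite derive1E; have h := is_derive_endvar b x; rewrite derive_val. Qed.

Lemma endO0_endvar N : endO 0 0 N (endvar b : R -> R).
Proof.
have h0 : exists M : R, \forall x \near E, `|endvar b x| <= M * endpow b 0 x.
  exists 1; near=> x; have /andP[x0 x1] : 0 < endvar b x < 1 by near: x; exact: E_itv.
  by rewrite pw0 mul1r gtr0_norm // ltW.
case: N => [|N]; split=> //; split.
  by apply: nearW => x; have [] := is_derive_endvar b x.
apply: (@endO_eq _ _ _ 0); first by rewrite subrr.
apply: endO_congr (endO_cst b (- endsign R b) N (lexx 0)).
by apply: nearW => x; rewrite derive1_endvar.
Unshelve. all: by end_near. Qed.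

Lemma endO0_pow i N : endO 0 0 N (endpow b (i%:R : R)).
Proof.
elim: i => [|i IH].
  by apply: endO_congr (endO_cst b 1 N (lexx 0)); apply: nearW => x; rewrite pw0.
apply: (endO_congr (f := fun x => endpow b i%:R x * endvar b x)).
  by apply: nearI => x xI; rewrite -natr1 (pwD _ _ (t0 xI)) (pw1 (t0 xI)).
by apply: (@endO_eq _ _ _ (0 + 0)); [rewrite addr0|apply: endO_mul; [exact: IH|exact: endO0_endvar]].
Qed.

Lemma iderive_cvg f m : endO 0 0 m.+1 f -> exists L : R, iderive m f @ E --> L.
Proof.
rewrite -addn1 => H; have H1 := endO_iderive H.
have H2 : endO 0 0 0 (derive1 (iderive m f)).
  by apply: endO_eq (endO_D H1); rewrite mul0r !subr0.
have [M hM] := endO_bound H2.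
have m10 : -1 < 0 :> R by rewrite oppr_lt0.
by have [L hL _] := growth m10 (endO_derivable H1) hM; exists L.
Qed.

Let P i s x := endpow b i x * endpow (~~ b) s x.

Let KKP N i s : acder N (P i s).
Proof. by apply: acder_mul; exact: acder_endpow. Qed.

Let OOP N i s : endO 1 i N (P i s).
Proof. by apply: (@endO_eq _ _ _ (i + 0)); [rewrite addr0|apply: endO_mul; [exact: endO_endpow|exact: endO_endpowN]]. Qed.

Lemma iderive_prod_low m i s : (m < i)%N -> iderive m (P i%:R s) @ E --> (0 : R).
Proof.
move=> mi; apply: (endO_cvg0 (sh := 1) (s := i%:R - 1 * m%:R) (N := 0)).
  by rewrite mul1r subr_gt0 ltr_nat.
by apply: endO_iderive; exact: OOP.
Qed.

Lemma derive1_prod m s x : -1 < x < 1 -> derive1 (P m.+1%:R s) x =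
  - (endsign R b * m.+1%:R) * P m%:R s x + endsign R b * s * P m.+1%:R (s - 1) x.
Proof.
move=> xI; rewrite /P (derive1M (derivable_endpow (t0 xI)) (derivable_endpow (t0' xI))).
rewrite (derive1_endpow _ (t0 xI)) (derive1_endpow _ (t0' xI)) sgN -{2}(natr1 m) addrK.
by move: (endpow _ _ _) (endpow _ _ _) (endpow _ _ _) (endpow _ _ _) => u v u' v'; ring.
Qed.

(** Only the term in which all m derivatives fall on t^m survives in the limit. *)
Lemma iderive_prod_diag m s : iderive m (P m%:R s) @ E --> falling m%:R m * 2 `^ s.
Proof.
elim: m s => [|m IH] s.
  rewrite /falling big_ord0; apply: (E_cvg_eq (f := fun x => 1 * endpow (~~ b) s x)).
    by apply: nearW => x; rewrite /iderive /= /P pw0.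
  by apply: cvgMr; exact: endpowN_cvg.
apply: (E_cvg_eq (f := fun x => - (endsign R b * m.+1%:R) * iderive m (P m%:R s) x +
                                endsign R b * s * iderive m (P m.+1%:R (s - 1)) x)).
  apply: nearI => x xI; rewrite DnS (I_iderive m (@derive1_prod m s) xI).
  rewrite iderive_add //; try exact/acder_scale/KKP.
  by rewrite !iderive_scale //; exact: KKP.
have -> : falling m.+1%:R m.+1 * 2 `^ s =
    - (endsign R b * m.+1%:R) * (falling m%:R m * 2 `^ s) + endsign R b * s * 0.
  by rewrite !falling_diag exprS factS natrM; ring.
by apply: cvgD; apply: cvgMr; [exact: IH|exact: iderive_prod_low].
Qed.

Lemma iderive_prod_cvg m i s : exists L : R, [/\ iderive m (P i%:R s) @ E --> L,
  (m < i)%N -> L = 0 & m = i -> L = falling i%:R i * 2 `^ s].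
Proof.
have [L HL] : exists L : R, iderive m (P i%:R s) @ E --> L.
  apply: iderive_cvg; apply: (@endO_eq _ _ _ (0 + 0)); first by rewrite addr0.
  by apply: endO_mul; [exact: endO0_pow|exact: endO_endpowN].
exists L; split=> // [mi|mi].
  by apply: (E_cvg_unique HL); exact: iderive_prod_low.
by apply: E_cvg_unique HL _; rewrite mi; exact: iderive_prod_diag.
Qed.

(** The fractional power in the weight cancels that of q_i, so that a_k q_i^(k) is smooth up to the
    endpoint. *)
Lemma term_q k i x : -1 < x < 1 ->
  ra k x * iderive k (q i) x = C k * falling (i%:R - a) k * P i%:R (a' + k%:R) x.
Proof.
move=> xI; rewrite iderive_endpow // /real_coef (jweightE _ _ b) /P.
have -> : endpow b i%:R x = endpow b (a + k%:R) x * endpow b (i%:R - a - k%:R) x.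
  by rewrite -(pwD _ _ (t0 xI)); congr (endpow b _ x); ring.
by move: (endpow _ _ _) (endpow _ _ _) (endpow _ _ _) (falling _ _) => u v u' v'; ring.
Qed.

(** The k-th term of [real_quasi j] is a derivative of order k - j of a smooth multiple of t^i,
    tending to 0 for k - j < i. On the diagonal i + j = n only k = n survives, with the factor C
    n. *)
Lemma Sj_q_cvg i j : exists M : R, [/\ Sj j (q i) @ E --> M,
  (j <= n)%N -> (n < i + j)%N -> M = 0 &
  (j <= n)%N -> (i + j = n)%N -> C n != 0 -> M != 0].
Proof.
have [L HL] := choice (fun k => iderive_prod_cvg (k - j) i (a' + k%:R)).
exists (\sum_(j <= k < n.+1) (-1) ^+ (k + j) * (C k * falling (i%:R - a) k * L k)).
split.
- apply: (@E_cvg_sum R b _ (index_iota j n.+1)) => k _; apply: cvgMr.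
  apply: (E_cvg_eq (f := fun x => C k * falling (i%:R - a) k * iderive (k - j) (P i%:R (a' + k%:R)) x)).
    apply: nearI => x xI; rewrite -(iderive_scale _ (KKP _ _ _) xI).
    by apply/esym; apply: I_iderive => // y yI; exact: term_q.
  by apply: cvgMr; have [] := HL k.
- move=> jn nij; rewrite big_nat big1 // => k /andP[jk kn].
  have ki : (k - j < i)%N by lia.
  by have [_ -> //] := HL k; rewrite !mulr0.
- move=> jn ij Cn; rewrite big_nat_recr //= big_nat big1; last first.
    move=> k /andP[jk kn]; have ki : (k - j < i)%N by lia.
    by have [_ -> //] := HL k; rewrite !mulr0.
  have ni : (n - j)%N = i by lia.
  have [_ _ ->//] := HL n.
  rewrite add0r !mulf_neq0 ?expf_neq0 ?oppr_eq0 ?oner_eq0 ?falling_shift_neq0 ?falling_diag_neq0 //.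
Qed.

Lemma endO_rell s N f : endO 1 s N.+2 f -> endO 1 (s - 1) N (rell f).
Proof.
move=> Hf; have H1 : endO 1 (a + s) N.+1 (rflux f).
  apply: (@endO_eq _ _ _ (a + 1 + (s - 1))); first by ring.
  by apply: endO_mul (endO_jweight al be b 1 N.+1) (endO_D Hf).
have H2 : endO 1 (s - 1) N (fun x => (w x)^-1 * derive1 (rflux f) x).
  by apply: (@endO_eq _ _ _ (- a + (a + s - 1))); [ring|apply: endO_mul (endO_wV al be b N) (endO_D H1)].
by apply: endO_congr (endO_opp ler01 H2); apply: nearW => x; rewrite /real_expr mulNr.
Qed.

(** Each ell lowers the leading exponent by one with a nonzero factor [shift_coef], so ell^n t^n
    tends to a nonzero constant. *)
Lemma rellk_pow m : (m <= n)%N -> exists c r, [/\ c != 0, forall N, acder N r,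
  forall N, endO 1 ((n - m)%:R + 1) N r &
  forall x, -1 < x < 1 -> rellk m (endpow b n%:R) x = c * endpow b (n - m)%:R x + r x].
Proof.
elim: m => [|m IH] mn.
  exists 1, (fun=> 0); split; first exact: oner_neq0.
  - by move=> N; exact: acder_cst.
  - by move=> N; exact: endO_zero.
  - by move=> x _; rewrite subn0 mul1r addr0.
have [c [r [c0 Kr Or Er]]] := IH (ltnW mn).
pose l := (n - m.+1)%N; have lE : (n - m = l.+1)%N by rewrite /l; lia.
exists (c * shift_coef al be b l.+1%:R),
  (fun x => c * diag_coef al be b l.+1%:R * endpow b l.+1%:R x + rell r x); split.
- by rewrite mulf_neq0 // lam_int_neq0.
- move=> N; apply: acder_add; first exact/acder_scale/acder_endpow.
  by apply: acder_rell; exact: Kr.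
- move=> N; apply: endO_add.
    by apply: endO_scale => //; rewrite natr1; exact: endO_endpow.
  by have := endO_rell (Or N.+2); rewrite lE -natr1 -/l addrK.
- move=> x xI; rewrite [LHS](rell_congr _ _ Er xI) lE.
  have Kp : acder 2 (fun y => c * endpow b l.+1%:R y) by exact/acder_scale/acder_endpow.
  rewrite (rell_add _ _ Kp (Kr 2%N) xI).
  have := @rell_sum _ al be [:: l.+1] (fun=> c) (fun i => endpow b i%:R) (fun i _ => acder_endpow 2 b i%:R) x xI.
  rewrite big_seq1; under [X in rell X _]eq_fun do rewrite big_seq1.
  move=> ->; rewrite (rell_endpow _ _ _ _ xI) -{2}(natr1 l) addrK -/l.
  by move: (rell r x) (endpow _ _ _) (endpow _ _ _) => u v v'; ring.
Qed.

(* If C n vanished, w ell^n t^n would be O(t^(a+1)) instead of ~ c t^a. *)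
Lemma Cn_neq0 : C n != 0.
Proof.
apply/eqP => Cn0.
have [c [r [c0 _ Or Er]]] := rellk_pow (leqnn n).
have H : endO 1 1 0 (rellk n (endpow b n%:R)).
  pose G x := \sum_(1 <= k < n) (-1) ^+ k * iderive k (fun y => ra k y * iderive k (endpow b n%:R) y) x.
  apply: (endO_congr (f := fun x => (w x)^-1 * G x)).
    apply: nearI => x xI; rewrite (hCr (fun m => acder_endpow m b n%:R) xI) big_nat_recr //=.
    have -> : (fun y => ra n y * iderive n (endpow b n%:R) y) = (fun=> 0).
      by apply/funext => y; rewrite /real_coef Cn0 !mul0r.
    have Dz : iderive n (fun=> 0 : R) x = 0 by rewrite -(prednK hn) iderive_const.
    by rewrite Dz mulr0 addr0.
  apply: (@endO_eq _ _ _ (- a + (a + 1))); first by ring.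
  apply: endO_mul; first exact: endO_wV.
  apply: endO_sum => k; rewrite mem_index_iota => /andP[k0 kn] _; apply: endO_scale => //.
  have Hk : endO 1 (a + k%:R + (n%:R - 1 * k%:R)) (k + 0) (fun y => ra k y * iderive k (endpow b n%:R) y).
    by apply: endO_mul; [exact: endO_ra|apply: endO_iderive; exact: endO_endpow].
  apply: endO_le (endO_iderive Hk).
  have : k%:R + 1 <= n%:R :> R by rewrite natr1 ler_nat.
  by lra.
have h0 := endO_cvg0 ltr01 H.
have hr : r @ E --> (0 : R).
  by apply: endO_cvg0 (Or 0%N); rewrite subnn add0r.
have hc : rellk n (endpow b n%:R) @ E --> c + 0.
  apply: (E_cvg_eq (f := fun x => c + r x)); last by apply: cvgD => //; exact: cvg_cst.
  by apply: nearI => x xI; rewrite Er // subnn pw0 mulr1.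
by move: c0; rewrite -(addr0 c) (E_cvg_unique hc h0) eqxx.
Qed.

Let cvgP_lim f (L : R) : f @ E --> L -> f @ E --> (lim (f @ E) : R).
Proof. by move=> h; apply/cvg_ex; exists L. Qed.

(** * The matrix of limits of the quasi-derivatives of the q_i *)

Definition quasi_endpow_lim j i : R := lim (Sj j (q i) @ E).

Lemma Mq_cvg i j : Sj j (q i) @ E --> quasi_endpow_lim j i.
Proof. by have [M [/cvgP_lim]] := Sj_q_cvg i j. Qed.

Lemma Mq_low i j : (j <= n)%N -> (n < i + j)%N -> quasi_endpow_lim j i = 0.
Proof.
move=> jn ij; have [M [hM M0 _]] := Sj_q_cvg i j.
by rewrite -(M0 jn ij); exact: (E_cvg_unique (@Mq_cvg i j) hM).
Qed.

Lemma Mq_diag i j : (j <= n)%N -> (i + j = n)%N -> quasi_endpow_lim j i != 0.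
Proof.
move=> jn ij; have [M [hM _ M0]] := Sj_q_cvg i j.
have := M0 jn ij Cn_neq0.
by rewrite (E_cvg_unique (@Mq_cvg i j) hM).
Qed.

(** Row n - i involves only d_0, ..., d_i, with a nonzero factor at d_i: forward substitution. *)
Lemma Mq_tri (d : nat -> R) :
  (forall j, (1 <= j <= n)%N -> \sum_(0 <= i < n) d i * quasi_endpow_lim j i = 0) ->
  forall i, (i < n)%N -> d i = 0.
Proof.
move=> H i; elim/ltn_ind: i => i IH iln.
have := H (n - i)%N; rewrite (@big_cat_nat _ _ _ i) //=; last exact: ltnW.
rewrite big_nat big1 ?add0r; last first.
  by move=> l /andP[_ li]; rewrite IH ?mul0r // (ltn_trans li).
rewrite big_ltn // big_nat big1 ?addr0; last first.
  by move=> l /andP[il ln]; rewrite Mq_low ?mulr0 //; lia.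
have -> : (1 <= n - i <= n)%N by lia.
move=> /(_ isT)/eqP; rewrite mulf_eq0 => /orP[/eqP //|].
by rewrite (negbTE (Mq_diag _ _)) //; lia.
Qed.

Local Notation N := (2 * n).-1.

Let KS j f : (1 <= j)%N -> acder N f -> acder (2 * n - j) f.
Proof. by move=> j1; apply: acder_leN; lia. Qed.

Lemma Sj_sum (r : seq nat) j (c : nat -> R) (F : nat -> R -> R) : (1 <= j)%N ->
  (forall i, i \in r -> acder N (F i)) -> forall x, -1 < x < 1 ->
  Sj j (fun y => \sum_(i <- r) c i * F i y) x = \sum_(i <- r) c i * Sj j (F i) x.
Proof.
move=> j1; apply: lin_sum => f g k Kf Kg x xI.
by apply: (Sj_lin al be C hn k _ _ xI); exact: KS.
Qed.

Lemma Sj_add j f g x : (1 <= j)%N -> acder N f -> acder N g -> -1 < x < 1 ->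
  Sj j (fun y => f y + g y) x = Sj j f x + Sj j g x.
Proof.
move=> j1 Kf Kg xI; have := Sj_lin al be C hn 1 (KS j1 Kf) (KS j1 Kg) xI.
by rewrite mul1r; under [X in Sj _ X _]eq_fun do rewrite mul1r.
Qed.

Lemma rbr_lin f f' g (k : R) x : acder N f -> acder N f' -> -1 < x < 1 ->
  rbr (fun y => f y + k * f' y) g x = rbr f g x + k * rbr f' g x.
Proof.
move=> Kf Kf' xI; rewrite /real_bracket mulr_sumr -big_split /=.
apply: eq_big_nat => j /andP[j1 jn].
rewrite (Sj_lin al be C hn k (KS j1 Kf) (KS j1 Kf') xI).
have K1 : acder j.-1 f by apply: acder_leN Kf; lia.
have K2 : acder j.-1 f' by apply: acder_leN Kf'; lia.
rewrite (iderive_add K1 (acder_scale k K2) xI) (iderive_scale k K2 xI).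
move: (Sj _ _ _) (Sj _ _ _) (Sj _ _ _) (iderive _ _ _) (iderive _ _ _) (iderive _ _ _) => A B D u v z.
by ring.
Qed.

Lemma rbr_sum (r : seq nat) (c : nat -> R) (F : nat -> R -> R) g :
  (forall i, i \in r -> acder N (F i)) -> forall x, -1 < x < 1 ->
  rbr (fun y => \sum_(i <- r) c i * F i y) g x = \sum_(i <- r) c i * rbr (F i) g x.
Proof.
by apply: (lin_sum (T := fun f => rbr f g)) => f f' k Kf Kf' x xI; exact: rbr_lin.
Qed.

Lemma rbr_add f f' g x : acder N f -> acder N f' -> -1 < x < 1 ->
  rbr (fun y => f y + f' y) g x = rbr f g x + rbr f' g x.
Proof.
move=> Kf Kf' xI; have := @rbr_lin f f' g 1 x Kf Kf' xI.
by rewrite mul1r; under [X in rbr X _ _]eq_fun do rewrite mul1r.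
Qed.

(** The order is the same for all j: what the quasi-derivative gains with j, the derivative of order
    j - 1 loses. *)
Lemma endO_rbr s s' f g : endO 1 s N f -> endO 1 s' N g ->
  endO 1 (a + s + s' - n%:R + 1) 0 (rbr f g).
Proof.
move=> Hf Hg; apply: endO_sum => j; rewrite mem_index_iota ltnS => /andP[j1 jn] _.
have jE : j%:R = j.-1%:R + 1 :> R by rewrite natr1 prednK.
have D h s1 : endO 1 s1 N h -> endO 1 (s1 - 1 * j.-1%:R) 0 (iderive j.-1 h).
  by move=> Hh; apply: endO_iderive; apply: endO_leN Hh; lia.
have jj : (1 <= j <= n)%N by rewrite j1.
apply: endO_sub => //.
  by apply: endO_eq (endO_mul (endO_Sj jj Hg) (D _ _ Hf)); rewrite jE; ring.
by apply: endO_eq (endO_mul (endO_Sj jj Hf) (D _ _ Hg)); rewrite jE; ring.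
Qed.

Lemma iderive_pow_cvg i k : iderive k (endpow b i%:R) @ E --> (if k == i then falling i%:R i else 0).
Proof.
apply: (E_cvg_eq (f := fun x => falling i%:R k * endpow b (i%:R - k%:R) x)).
  by apply: nearI => x xI; rewrite iderive_endpow.
have [->|ki] := eqVneq k i.
  rewrite -[X in _ --> X]mulr1; apply: cvgMr.
  by apply: (E_cvg_eq (f := fun=> 1)); [apply: nearW => x; rewrite subrr pw0|exact: E_cvg_cst].
have [ik|ik] := ltnP i k.
  rewrite falling_zero //; apply: (E_cvg_eq (f := fun=> 0)); last exact: E_cvg_cst.
  by apply: nearW => x; rewrite mul0r.
rewrite -[X in _ --> X](mulr0 (falling i%:R k)); apply: cvgMr; apply: endpow_cvg0.
by rewrite subr_gt0 ltr_nat ltn_neqAle ki.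
Qed.

(** The derivative of order j - 1 of t^i has a nonzero limit for j = i + 1 only, and the products
    containing S_j t^i are O(t). *)
Lemma rbr_pow_cvg i g (Y : nat -> R) : (i < n)%N -> endO 1 (- a) N g ->
  (forall j, (1 <= j <= n)%N -> Sj j g @ E --> Y j) ->
  rbr (endpow b i%:R) g @ E --> falling i%:R i * Y i.+1.
Proof.
move=> iln Hg HY.
have -> : falling i%:R i * Y i.+1 =
    \sum_(j <- index_iota 1 n.+1) (Y j * (if j.-1 == i then falling i%:R i else 0) - 0).
  rewrite (bigD1_seq i.+1) /=; [|by rewrite mem_index_iota /= ltnS|exact: iota_uniq].
  rewrite eqxx subr0 mulrC big_seq_cond big1 ?addr0 // => j.
  rewrite mem_index_iota => /andP[/andP[j1 jn] ji].
  by rewrite (_ : (j.-1 == i) = false) ?mulr0 ?subr0 //; lia.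
apply: (@E_cvg_sum R b _ (index_iota 1 n.+1)
   (fun j x => Sj j g x * iderive j.-1 (endpow b i%:R) x - Sj j (endpow b i%:R) x * iderive j.-1 g x)) => j.
rewrite mem_index_iota ltnS => jn; apply: cvgB.
  by apply: cvgM; [exact: HY|exact: iderive_pow_cvg].
have Hd : endO 1 (- a - 1 * j.-1%:R) 0 (iderive j.-1 g) by apply: endO_iderive; apply: endO_leN Hg; lia.
apply: (endO_cvg0 (s := a + j%:R + (- a - 1 * j.-1%:R)) _ (endO_mul (endO_Sj_pow i j) Hd)).
have -> : j%:R = j.-1%:R + 1 :> R by rewrite natr1 prednK //; case/andP: jn.
have -> : a + (j.-1%:R + 1) + (- a - 1 * j.-1%:R) = 1 :> R by ring.
exact: ltr01.
Qed.

(** Taylor's formula at the endpoint, a point outside the domain: the expansion of f' is integrated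
    term by term and [growth] supplies the constant. *)
Lemma endpoint_taylor m f : (\forall x \near E, derivable f x 1) ->
  endO 0 0 m.+1 f -> exists e : nat -> R,
  endO 1 m%:R 0 (fun x => f x - \sum_(0 <= i < m) e i * endpow b i%:R x).
Proof.
elim: m f => [|m IH] f df Hf.
  exists (fun=> 0); have [M hM] := endO_bound Hf; split=> //; exists M.
  by apply: filterS hM => x; rewrite big_geq // subr0.
have Hd : endO 0 0 m.+1 (derive1 f) by apply: endO_eq (endO_D Hf); rewrite subrr.
have [e He] := IH _ (endO_derivable Hd) Hd.
(* The sign comes from dt/dx = -endsign. *)
pose e' i := - e i / (endsign R b * i.+1%:R).
pose F x := \sum_(0 <= i < m) e' i * endpow b i.+1%:R x.
have dF x : -1 < x < 1 -> derivable F x 1 /\ derive1 F x = \sum_(0 <= i < m) e i * endpow b i%:R x.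
  move=> xI; have [|dF ->] := @derive1_sum _ _ (index_iota 0 m) (fun i y => e' i * endpow b i.+1%:R y) x.
    by move=> i _; apply: derivable_cmul; exact/derivable_endpow/t0.
  split=> //; apply: eq_bigr => i _.
  rewrite (derive1Ml _ (derivable_endpow (t0 xI))) (derive1_endpow _ (t0 xI)) -{2}(natr1 i) addrK mulrA.
  congr (_ * _); rewrite /e'; field.
  by rewrite addrC natr1 pnatr_eq0 endsign_neq0.
pose h x := f x - F x.
have hE : \forall x \near E, derivable h x 1 /\
    derive1 h x = derive1 f x - \sum_(0 <= i < m) e i * endpow b i%:R x.
  near=> x; have xI : -1 < x < 1 by near: x; exact: E_in.
  have dfx : derivable f x 1 by near: x.
  have [dFx <-] := dF x xI.
  have hh : h = (fun y => f y + (-1) * F y) by apply/funext => y; rewrite mulN1r.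
  rewrite hh; split; first exact: derivable_lin.
  by rewrite (derive1_lin (-1) dfx dFx) mulN1r.
have [M hM] := endO_bound He.
have dh : \forall x \near E, derivable h x 1 by apply: filterS hE => x [].
have hM' : \forall x \near E, `|derive1 h x| <= M * endpow b m%:R x.
  by apply: filterS2 hE hM => x [_ ->].
have m1 : -1 < m%:R :> R by rewrite (lt_le_trans (_ : -1 < 0)) // oppr_lt0.
have [L _ HL] := growth m1 dh hM'.
exists (fun i => if i is i'.+1 then e' i' else L).
rewrite -natr1; apply: endO_congr HL; apply: nearW => x.
by rewrite big_nat_recl // pw0 mulr1 /h /F opprD addrA addrAC.
Unshelve. all: by end_near. Qed.

(** One common fractional power is taken out of all derivatives of order below n, leaving
    nonnegative integer powers. *)
Lemma q_iderive_pre k i x : -1 < x < 1 -> (k < n)%N ->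
  iderive k (q i) x = endpow b (- a - n%:R + 1) x * (falling (i%:R - a) k * endpow b (i + n.-1 - k)%:R x).
Proof.
move=> xI kn; rewrite iderive_endpow // mulrCA -(pwD _ _ (t0 xI)); congr (_ * endpow b _ x).
rewrite natrB ?natrD; last by lia.
have -> : n%:R = n.-1%:R + 1 :> R by rewrite natr1 prednK.
by ring.
Qed.

Lemma endO0_Sj_q i j m : endO 0 0 m (Sj j (q i)).
Proof.
apply: endO_sum => k _ _; apply: endO_scale => //.
apply: (endO_congr (f := fun x => C k * falling (i%:R - a) k * iderive (k - j) (P i%:R (a' + k%:R)) x)).
  apply: nearI => x xI; rewrite -(iderive_scale _ (KKP _ _ _) xI).
  by apply/esym; apply: I_iderive => // y yI; exact: term_q.
apply: endO_scale => //; apply: (@endO_eq _ _ _ (0 + 0 - 0 * (k - j)%:R)); first by ring.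
by apply: endO_iderive; apply: endO_mul; [exact: endO0_pow|exact: endO_endpowN].
Qed.

(** The exponents i + s with i < m are all negative, so a finite limit forces the coefficients to
    vanish one after the other, and the remainder tends to 0. *)
Lemma sum_endpow_lead m (e : nat -> R) (s : R) f (L : R) :
  endO 1 (m%:R + s) 0 (fun x => f x - \sum_(0 <= i < m) e i * endpow b (i%:R + s) x) ->
  m%:R - 1 + s < 0 -> 0 < m%:R + s -> f @ E --> L -> L = 0.
Proof.
move=> H ms0 ms1 fL.
have e0 i : (i < m)%N -> e i = 0.
  elim/ltn_ind: i => i IH im.
  have i0 : i%:R + s < 0.
    have : i%:R + 1 <= m%:R :> R by rewrite natr1 ler_nat.
    by move: ms0; lra.
  pose r x := f x - \sum_(0 <= i < m) e i * endpow b (i%:R + s) x.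
  have H1 : (fun x => endpow b (- (i%:R + s)) x * r x) @ E --> (0 : R).
    apply: endO_cvg0 (endO_mul (endO_endpow b (- (i%:R + s)) 0) H).
    have : i%:R < m%:R :> R by rewrite ltr_nat.
    by lra.
  have H2 : (fun x => endpow b (- (i%:R + s)) x * f x) @ E --> 0 * L.
    by apply: cvgM fL; apply: endpow_cvg0; rewrite oppr_gt0.
  have H3 : (fun x => endpow b (- (i%:R + s)) x * \sum_(0 <= l < m) e l * endpow b (l%:R + s) x) @ E
      --> \sum_(l <- index_iota 0 m) (if l == i then e i else 0).
    apply: (E_cvg_eq (f := fun x => \sum_(0 <= l < m) e l * endpow b (l%:R - i%:R) x)).
      apply: nearI => x xI; rewrite mulr_sumr; apply: eq_bigr => l _.
      rewrite mulrCA -(pwD _ _ (t0 xI)); congr (_ * endpow b _ x); ring.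
    apply: (@E_cvg_sum R b _ (index_iota 0 m) (fun l x => e l * endpow b (l%:R - i%:R) x)) => l _.
    have [->|li] := eqVneq l i.
      apply: (E_cvg_eq (f := fun=> e i)); last exact: E_cvg_cst.
      by apply: nearW => x; rewrite subrr pw0 mulr1.
    have [il|il] := ltnP i l.
      rewrite -[X in _ --> X](mulr0 (e l)); apply: cvgMr; apply: endpow_cvg0.
      by rewrite subr_gt0 ltr_nat.
    have lti : (l < i)%N by rewrite ltn_neqAle li.
    apply: (E_cvg_eq (f := fun=> 0)); last exact: E_cvg_cst.
    by apply: nearW => x; rewrite (IH l lti (ltn_trans lti im)) mul0r.
  have H5 : 0 = 0 * L - \sum_(l <- index_iota 0 m) (if l == i then e i else 0).
    apply: (E_cvg_unique H1).
    apply: (E_cvg_eq (f := fun x => endpow b (- (i%:R + s)) x * f x - endpow b (- (i%:R + s)) x *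
        \sum_(0 <= l < m) e l * endpow b (l%:R + s) x)); last exact: (cvgB H2 H3).
    by apply: nearW => x; rewrite /r mulrBr.
  move: H5; rewrite mul0r sub0r => /eqP; rewrite eq_sym oppr_eq0.
  rewrite (bigD1_seq i) /=; [|by rewrite mem_index_iota|exact: iota_uniq].
  rewrite eqxx big1 ?addr0; first by move/eqP.
  by move=> l /negbTE ->.
apply: (E_cvg_unique fL); apply: (endO_cvg0 ms1 (sh := 1) (N := 0)); apply: endO_congr H.
apply: nearW => x; rewrite big_nat big1 ?subr0 // => i im; by rewrite e0 ?mul0r.
Qed.

(** The derivative is w times products of two functions of order -a, hence O(t^(-a)), so the limit
    exists. The exponents 1 - n - a + k are negative for k < n and positive for k = n, so it is
    0. *)
Lemma rbr_qq_cvg i l : rbr (q i) (q l) @ E --> (0 : R).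
Proof.
have Kq m k : acder k (q m) by exact: acder_endpow.
have dS m x : -1 < x < 1 -> derivable (Sj 1 (q m)) x 1.
  by move=> xI; apply: (acder_derivable (isT : (0 < 1)%N)) xI; apply: acder_Sj => //; exact: Kq.
have dr x : -1 < x < 1 -> derivable (rbr (q i) (q l)) x 1 /\
    derive1 (rbr (q i) (q l)) x = w x * (rellk n (q i) x * q l x - q i x * rellk n (q l) x).
  by move=> xI; exact: (derive1_rbr hn hCr (Kq i _) (Kq l _) xI (dS i x xI) (dS l x xI)).
have Oq m k : endO 1 (- a) k (q m).
  by apply: endO_le (endO_endpow _ _ _); rewrite lerDr.
have Oe m : endO 1 (- a) 0 (rellk n (q m)).
  (* A single q_m is written as a combination, so that ell^n q_m is again one. *)
  pose d k : R := (k == m)%:R.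
  have qE x : q m x = comb (fun=> 0) d m.+1 x.
    rewrite /endcomb big1 ?add0r; last by move=> k _; rewrite mul0r.
    rewrite big_nat_recr //= /d eqxx mul1r big_nat big1 ?add0r // => k /andP[_ km].
    by rewrite ltn_eqF // mul0r.
  have [c' [d' H]] := rellk_comb_ex al be b n (fun=> 0) d m.+1.
  apply: endO_congr (endO_comb hal hbe b c' d' m.+1 0).
  apply: nearI => x xI; rewrite -H //; apply: rellk_congr => // y _; exact/esym/qE.
have H : endO 1 (- a) 0 (derive1 (rbr (q i) (q l))).
  apply: (endO_congr (f := fun x => w x * (rellk n (q i) x * q l x - q i x * rellk n (q l) x))).
    by apply: nearI => x /dr[].
  apply: (@endO_eq _ _ _ (a + (- a - a))); first by ring.
  apply: endO_mul; first exact: endO_w.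
  by apply: endO_sub => //; apply: endO_mul.
have [M hM] := endO_bound H.
have a10 : -1 < - a by rewrite ltrN2.
have dn : \forall x \near E, derivable (rbr (q i) (q l)) x 1 by apply: nearI => x /dr[].
have [L hL _] := growth a10 dn hM.
suff L0 : L = 0 by rewrite -[X in _ --> X]L0.
pose A x := \sum_(1 <= j < n.+1) (Sj j (q l) x * (falling (i%:R - a) j.-1 * endpow b (i + n.-1 - j.-1)%:R x)
    - Sj j (q i) x * (falling (l%:R - a) j.-1 * endpow b (l + n.-1 - j.-1)%:R x)).
have AE x : -1 < x < 1 -> rbr (q i) (q l) x = endpow b (- a - n%:R + 1) x * A x.
  move=> xI; rewrite /A mulr_sumr; apply: eq_big_nat => j /andP[j1 jn].
  have jn' : (j.-1 < n)%N by lia.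
  rewrite !(q_iderive_pre _ xI jn').
  by move: (Sj _ _ _) (Sj _ _ _) (endpow _ _ _) (_ * endpow _ _ _) (_ * endpow _ _ _) => u v z z' z''; ring.
have OA m : endO 0 0 m A.
  apply: endO_sum => j _ _; apply: endO_sub => //;
  (apply: (@endO_eq _ _ _ (0 + 0)); [by rewrite addr0|apply: endO_mul; [exact: endO0_Sj_q|]]);
  by apply: endO_scale => //; exact: endO0_pow.
have [e He] := endpoint_taylor (endO_derivable (OA 1%N)) (OA n.+1).
apply: (@sum_endpow_lead n e (- a - n%:R + 1) (rbr (q i) (q l))) hL.
- apply: (endO_congr (f := fun x => endpow b (- a - n%:R + 1) x *
     (A x - \sum_(0 <= k < n) e k * endpow b k%:R x))).
    apply: nearI => x xI; rewrite AE // mulrBr; congr (_ - _); rewrite mulr_sumr.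
    by apply: eq_bigr => k _; rewrite mulrCA -(pwD _ _ (t0 xI)) addrC.
  by rewrite addrC; apply: endO_mul He; exact: endO_endpow.
- by move: a0; lra.
- by move: a1; lra.
Qed.

(** * Limits of quasi-derivatives and brackets in terms of the expansion *)

Definition expands f (c d : nat -> R) := endO 1 (remexp al be b n) N (fun x => f x - comb c d n x).

Let Kc c d m k : acder k (comb c d m). Proof. exact: acder_comb. Qed.

Let remexp_pos : 0 < a + remexp al be b n - n%:R + 1.
Proof. by rewrite /remexp; move: a0; lra. Qed.

Lemma Sj_comb_cvg c d j : (1 <= j)%N ->
  Sj j (comb c d n) @ E --> \sum_(0 <= i < n) d i * quasi_endpow_lim j i.
Proof.
move=> j1.
apply: (E_cvg_eq (f := fun x => \sum_(0 <= i < n) c i * Sj j (endpow b i%:R) x +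
    \sum_(0 <= i < n) d i * Sj j (q i) x)).
  apply: nearI => x xI.
  rewrite -!(Sj_sum _ j1) //; try by move=> i _; exact: acder_endpow.
  by rewrite -Sj_add //; apply: acder_sum => i _; apply: acder_scale; exact: acder_endpow.
rewrite -[X in _ --> X]add0r; apply: cvgD.
  rewrite [X in _ --> X](_ : 0 = \sum_(i <- index_iota 0 n) c i * 0); last first.
    by rewrite big1 // => i _; rewrite mulr0.
  apply: (@E_cvg_sum R b _ (index_iota 0 n) (fun i x => c i * Sj j (endpow b i%:R) x)) => i _.
  apply: cvgMr; apply: endO_cvg0 (endO_Sj_pow i j).
  by rewrite ltr_wpDr.
apply: (@E_cvg_sum R b _ (index_iota 0 n) (fun i x => d i * Sj j (q i) x)) => i _.
by apply: cvgMr; exact: Mq_cvg.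
Qed.

(** Only the singular part counts: the t^i give order a + j, and the remainder at least (1 + a) /
    2. *)
Lemma Sj_exp_cvg f c d j : acder N f -> expands f c d -> (1 <= j <= n)%N ->
  Sj j f @ E --> \sum_(0 <= i < n) d i * quasi_endpow_lim j i.
Proof.
move=> Kf Hf jn; have j1 : (1 <= j)%N by case/andP: jn.
apply: (E_cvg_eq (f := fun x => Sj j (comb c d n) x + Sj j (fun x => f x - comb c d n x) x)).
  apply: nearI => x xI; rewrite -Sj_add //; last exact: acder_sub.
  by congr (Sj j _ x); apply/funext => y; rewrite addrC subrK.
rewrite -[X in _ --> X]addr0; apply: cvgD; first exact: Sj_comb_cvg.
apply: endO_cvg0 (endO_Sj jn Hf).
have : 1 <= j%:R :> R by rewrite ler1n.
by move: remexp_pos; lra.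
Qed.

(** [dU k] stands for the coefficients of u_k in the q_i near the endpoint; [hU] is the duality
    established for them in [u_exists]. *)
Variable dU : nat -> nat -> R.
Hypothesis hU : forall j k, (1 <= j <= n)%N -> (1 <= k <= n)%N ->
  falling j.-1%:R j.-1 * \sum_(0 <= i < n) dU k i * quasi_endpow_lim j i = (j == k)%:R.

Local Notation U k := (comb (fun=> 0) (dU k) n).

Lemma comb_q d x : comb (fun=> 0) d n x = \sum_(0 <= i < n) d i * q i x.
Proof. by rewrite /endcomb big1 ?add0r // => i _; rewrite mul0r. Qed.

Lemma rbr_UU_cvg k l : rbr (U k) (U l) @ E --> (0 : R).
Proof.
have Kq i m : acder m (q i) by exact: acder_endpow.
have E1 d g x : -1 < x < 1 -> rbr (comb (fun=> 0) d n) g x = \sum_(0 <= i < n) d i * rbr (q i) g x.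
  move=> xI; rewrite -rbr_sum //.
  by rewrite (_ : comb _ d n = (fun y => \sum_(0 <= i < n) d i * q i y)) //; apply/funext => y; rewrite comb_q.
have E2 x : -1 < x < 1 -> rbr (U k) (U l) x =
    \sum_(0 <= i < n) dU k i * \sum_(0 <= m < n) dU l m * rbr (q i) (q m) x.
  move=> xI; rewrite E1 //; apply: eq_bigr => i _; congr (_ * _).
  rewrite rbrC E1 // -sumrN; apply: eq_bigr => m _.
  by rewrite rbrC mulrN opprK.
apply: (E_cvg_eq (f := fun x => \sum_(0 <= i < n) dU k i * \sum_(0 <= m < n) dU l m * rbr (q i) (q m) x)).
  by apply: nearI => x xI; rewrite E2.
rewrite [X in _ --> X](_ : 0 = \sum_(i <- index_iota 0 n) dU k i * \sum_(m <- index_iota 0 n) dU l m * 0); last first.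
  by rewrite big1 // => i _; rewrite big1 ?mulr0 // => m _; rewrite mulr0.
apply: (@E_cvg_sum R b _ (index_iota 0 n) (fun i x => dU k i * \sum_(0 <= m < n) dU l m * rbr (q i) (q m) x)) => i _.
apply: cvgMr.
apply: (@E_cvg_sum R b _ (index_iota 0 n) (fun m x => dU l m * rbr (q i) (q m) x)) => m _.
by apply: cvgMr; exact: rbr_qq_cvg.
Qed.

Lemma endO_expands f c d : expands f c d -> endO 1 (- a) N f.
Proof. by move=> H; apply: (endO_expansion hal hbe hn); exists c, d. Qed.

Section Functions.
Variables (f : R -> R) (c d : nat -> R).
Hypotheses (Kf : acder N f) (Hf : expands f c d).

Definition scaled_quasi k := falling k.-1%:R k.-1 * \sum_(0 <= i < n) d i * quasi_endpow_lim k i.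

Let T x := \sum_(0 <= i < n) c i * endpow b i%:R x.
Let V x := \sum_(1 <= k < n.+1) scaled_quasi k * U k x.

(* The singular part of f is the combination of the U k with coefficients scaled_quasi k:
   their difference has vanishing Sj j for all j, and quasi_endpow_lim is triangular. *)
Lemma exp_U x : comb c d n x = T x + V x.
Proof.
pose d1 i := d i - \sum_(1 <= k < n.+1) scaled_quasi k * dU k i.
have d10 : forall i, (i < n)%N -> d1 i = 0.
  apply: Mq_tri => j jn; apply: (mulfI (falling_diag_neq0 j.-1)); rewrite mulr0.
  have -> : \sum_(0 <= i < n) d1 i * quasi_endpow_lim j i = \sum_(0 <= i < n) d i * quasi_endpow_lim j i -
      \sum_(1 <= k < n.+1) scaled_quasi k * \sum_(0 <= i < n) dU k i * quasi_endpow_lim j i.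
    under [X in _ - X]eq_bigr do rewrite mulr_sumr.
    rewrite exchange_big /= -sumrB; apply: eq_bigr => i _.
    rewrite mulrBl mulr_suml; congr (_ - _); apply: eq_bigr => k _; by rewrite mulrA.
  rewrite mulrBr -/(scaled_quasi j) mulr_sumr (bigD1_seq j) /=; [|by rewrite mem_index_iota|exact: iota_uniq].
  rewrite mulrCA hU // eqxx mulr1 big_seq_cond big1 ?addr0 ?subrr // => k.
  rewrite mem_index_iota ltnS => /andP[kn kj].
  by rewrite mulrCA hU // eq_sym (negbTE kj) mulr0.
rewrite /endcomb /T /V; congr (_ + _).
have -> : \sum_(1 <= k < n.+1) scaled_quasi k * U k x =
    \sum_(0 <= i < n) (\sum_(1 <= k < n.+1) scaled_quasi k * dU k i) * q i x.
  under eq_bigr do rewrite comb_q mulr_sumr.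
  rewrite exchange_big /=; apply: eq_bigr => i _; rewrite mulr_suml.
  by apply: eq_bigr => k _; rewrite mulrA.
apply: eq_big_nat => i /andP[_ iln]; congr (_ * _).
by have /eqP := d10 i iln; rewrite subr_eq0 => /eqP.
Qed.

(** Besides the regular part T and the singular part V, the remainder of f paired with a function of
    order -a gives order (1 - a) / 2 > 0. *)
Lemma rbr_split_cvg g (Y Z : nat -> R) : acder N g -> endO 1 (- a) N g ->
  (forall j, (1 <= j <= n)%N -> Sj j g @ E --> Y j) ->
  (forall k, (1 <= k <= n)%N -> rbr (U k) g @ E --> Z k) ->
  rbr f g @ E --> \sum_(0 <= i < n) c i * (falling i%:R i * Y i.+1) +
    \sum_(1 <= k < n.+1) scaled_quasi k * Z k.
Proof.
move=> Kg Og HY HZ.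
pose r x := f x - comb c d n x.
have KT : acder N T by apply: acder_sum => i _; apply: acder_scale; exact: acder_endpow.
have KV : acder N V by apply: acder_sum => i _; exact: acder_scale.
have Kr : acder N r by exact: acder_sub.
have fE : f = (fun x => (T x + V x) + r x).
  by apply/funext => x; rewrite /r exp_U addrC subrK.
apply: (E_cvg_eq (f := fun x => (\sum_(0 <= i < n) c i * rbr (endpow b i%:R) g x +
    \sum_(1 <= k < n.+1) scaled_quasi k * rbr (U k) g x) + rbr r g x)).
  apply: nearI => x xI; rewrite [in RHS]fE (rbr_add _ (acder_add KT KV) Kr xI) (rbr_add _ KT KV xI).
  by congr (_ + _ + _); rewrite /T /V rbr_sum // => i _; exact: acder_endpow.
rewrite -[X in _ --> X]addr0; apply: cvgD; last first.
  apply: endO_cvg0 (endO_rbr Hf Og).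
  by move: remexp_pos; rewrite /remexp; move: a1; lra.
apply: cvgD.
  apply: (@E_cvg_sum R b _ (index_iota 0 n) (fun i x => c i * rbr (endpow b i%:R) g x)) => i.
  by rewrite mem_index_iota => /andP[_ iln]; apply: cvgMr; exact: rbr_pow_cvg.
apply: (@E_cvg_sum R b _ (index_iota 1 n.+1) (fun k x => scaled_quasi k * rbr (U k) g x)) => k.
by rewrite mem_index_iota => kn; apply: cvgMr; exact: HZ.
Qed.

(** The singular part of f drops out by [rbr_UU_cvg], and duality selects one coefficient of the
    regular part. *)
Lemma rbr_fU_cvg k : (1 <= k <= n)%N -> rbr f (U k) @ E --> c k.-1.
Proof.
move=> kn.
have H := @rbr_split_cvg (U k) (fun j => \sum_(0 <= i < n) dU k i * quasi_endpow_lim j i) (fun=> 0)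
  (Kc _ _ _ _) (endO_comb hal hbe b _ _ _ _) _ _.
have -> : c k.-1 = \sum_(0 <= i < n) c i * (falling i%:R i * \sum_(0 <= l < n) dU k l * quasi_endpow_lim i.+1 l) +
    \sum_(1 <= k < n.+1) scaled_quasi k * 0.
  rewrite [X in _ + X]big1 ?addr0; last by move=> i _; rewrite mulr0.
  rewrite (bigD1_seq k.-1) /=; [|by rewrite mem_index_iota; lia|exact: iota_uniq].
  rewrite (hU (j := k.-1.+1)) //; [|lia].
  rewrite (_ : (k.-1.+1 == k) = true) ?mulr1; last by lia.
  rewrite big_seq_cond big1 ?addr0 // => i.
  rewrite mem_index_iota => /andP[/andP[_ iln] ik].
  rewrite (hU (j := i.+1)) //.
  by rewrite (_ : (i.+1 == k) = false) ?mulr0 //; lia.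
apply: H => [j /andP[j1 _]|l _]; first exact: Sj_comb_cvg.
exact: rbr_UU_cvg.
Qed.

End Functions.

(** The singular part of f meets g through [U_k, g] = -[g, U_k], whose limit is minus a regular
    coefficient of g. *)
Lemma rbr_cvg f g cf df cg dg : acder N f -> acder N g -> expands f cf df -> expands g cg dg ->
  rbr f g @ E --> \sum_(1 <= k < n.+1) (cf k.-1 * scaled_quasi dg k - scaled_quasi df k * cg k.-1).
Proof.
move=> Kf Kg Hf Hg.
have -> : \sum_(1 <= k < n.+1) (cf k.-1 * scaled_quasi dg k - scaled_quasi df k * cg k.-1) =
    \sum_(0 <= i < n) cf i * (falling i%:R i * \sum_(0 <= l < n) dg l * quasi_endpow_lim i.+1 l) +
    \sum_(1 <= k < n.+1) scaled_quasi df k * - cg k.-1.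
  rewrite sumrB -sumrN big_add1 /=; congr (_ + _); apply: eq_bigr => k _.
  by rewrite mulrN.
apply: (@rbr_split_cvg f cf df Kf Hf g (fun j => \sum_(0 <= i < n) dg i * quasi_endpow_lim j i) (fun k => - cg k.-1)) => //.
- exact: endO_expands Hg.
- by move=> j jn; exact: Sj_exp_cvg Hg jn.
- move=> k kn; apply: (E_cvg_eq (f := fun x => - rbr g (U k) x)).
    by apply: nearW => x; rewrite rbrC opprK.
  by apply: cvgN; exact: rbr_fU_cvg Hg _ kn.
Qed.

End EndpointLimits.

(** * The weighted space and the real Green formula *)

Section WeightedL2.
Variable R : realType.
Variables (al be : R).
Hypothesis hal : 0 < al < 1.
Hypothesis hbe : 0 < be < 1.
Implicit Types (f g u v : R -> R) (x y s : R).

Local Notation leb := (@lebesgue_measure R).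
Local Notation w := (jweight al be).
Local Notation I := (@jint R).

Let mI : measurable (I : set (measurableTypeR R)). Proof. exact: measurable_itv. Qed.

Let mitv x y : measurable (`]x, y[%classic : set (measurableTypeR R)).
Proof. exact: measurable_itv. Qed.

Let IP x : I x -> -1 < x < 1.
Proof. by rewrite /jint /= in_itv. Qed.

Definition L2w f := measurable_fun I f /\ leb.-integrable I (fun x => (f x ^+ 2 * w x)%:E).

Lemma measurable_jweight : measurable_fun I w.
Proof.
apply: measurable_funM.
  apply: (measurableT_comp (measurable_powR al)); exact: measurable_funB.
apply: (measurableT_comp (measurable_powR be)); exact: measurable_funD.
Qed.

Lemma jweight_ge0 x : 0 <= w x.
Proof. by rewrite mulr_ge0 // powR_ge0. Qed.

Lemma powR_le2 x s : 0 <= x <= 2 -> 0 < s < 1 -> x `^ s <= 2.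
Proof.
move=> /andP[x0 x2] /andP[s0 s1]; apply: (@le_trans _ _ (2 `^ s)).
  by apply: ge0_ler_powR; rewrite ?nnegrE //; exact: ltW.
rewrite -[leRHS]powRr1 //; apply: ler_powR => //; [by rewrite ler1n|exact: ltW].
Qed.

Lemma jweight_le b x : -1 < x < 1 -> w x <= 2 * endpow b (endexp al be b) x.
Proof.
move=> xI; rewrite (jweight0E _ _ b) mulrC ler_wpM2r ?endpow_ge0 //.
have := xI; rewrite (endvar_in (~~ b)) => /andP[t0 t2].
by apply: powR_le2; [rewrite !ltW|exact: a_in].
Qed.

Lemma jweight_le4 x : -1 < x < 1 -> w x <= 4.
Proof.
move=> xI; apply: (le_trans (jweight_le false xI)).
have := xI; rewrite (endvar_in false) => /andP[t0 t2].
have : endpow false (endexp al be false) x <= 2 by apply: powR_le2; [rewrite !ltW|exact: a_in].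
by lra.
Qed.

Lemma integrable_cstI (c : R) : leb.-integrable I (fun=> c%:E).
Proof.
apply: (measurable_bounded_integrable (f := fun=> c)) => //.
  have := lebesgue_measure_itv `](-1 : R), 1[; rewrite /= => ->.
  by case: ifP; rewrite ?ltry.
by exists `|c|; split=> // M cM x _; exact: ltW.
Qed.

Lemma L2w_1 : L2w (fun=> 1).
Proof.
split; first exact: measurable_cst.
apply: (le_integrable mI _ _ (integrable_cstI 4)) => //.
  apply/measurable_EFinP; apply: measurable_funM => //; exact: measurable_jweight.
move=> x /IP xI; rewrite expr1n mul1r /= lee_fin !ger0_norm ?jweight_ge0 //.
exact: jweight_le4.
Qed.

Lemma le_amgm (p c d : R) : 0 <= p -> `|p * (c * d)| <= `|c ^+ 2 * p + d ^+ 2 * p|.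
Proof.
move=> p0; rewrite -mulrDl normrM [leRHS]normrM (ger0_norm p0) mulrC.
apply: ler_wpM2r => //; rewrite (ger0_norm (addr_ge0 (sqr_ge0 _) (sqr_ge0 _))).
have := sqr_ge0 (`|c| - `|d|); rewrite sqrrB !real_normK ?num_real // -normrM.
have := normr_ge0 (c * d); rewrite mulr2n.
by move: (c ^+ 2) (d ^+ 2) `|_| => P Q S; lra.
Qed.

Lemma integrable_prod u v : L2w u -> L2w v -> leb.-integrable I (fun x => (w x * (u x * v x))%:E).
Proof.
move=> [mu iu] [mv iv]; apply: (le_integrable mI _ _ (integrableD mI iu iv)) => //.
  apply/measurable_EFinP; apply: measurable_funM; first exact: measurable_jweight.
  exact: measurable_funM.
by move=> x _; rewrite /= lee_fin; apply: le_amgm; exact: jweight_ge0.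
Qed.

Lemma itv_subI x y : -1 < x -> y < 1 -> (`]x, y[ : set R) `<=` I.
Proof.
move=> x1 y1 z /=; rewrite !in_itv /= => /andP[xz zy].
by rewrite /jint /= in_itv /= (lt_trans x1 xz) (lt_trans zy y1).
Qed.

Lemma integrable_itvI x y (h : R -> \bar R) : -1 < x -> y < 1 -> leb.-integrable I h ->
  leb.-integrable `]x, y[ h.
Proof. by move=> x1 y1; apply: integrableS => //; exact: itv_subI. Qed.

(* AM-GM: [w |g| <= (th g^2 w + B / th) / 2] where [w <= B]. *)
Lemma weighted_integral_le g (th B : R) x y : L2w g -> -1 < x -> x < y -> y < 1 -> 0 < th ->
  (forall z, x < z < y -> w z <= B) ->
  `|\int[leb]_(z in `]x, y[) (- (w z * g z))| <=
  (th * \int[leb]_(z in I) (g z ^+ 2 * w z) + B / th * (y - x)) / 2.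
Proof.
move=> hg x1 xy y1 th0 wB; have [mg ig] := hg.
have i1 : leb.-integrable I (fun z => (w z * (g z * 1))%:E) by exact: integrable_prod hg L2w_1.
have i2 : leb.-integrable `]x, y[ (fun z => (- (w z * g z))%:E).
  have := integrableN (integrable_itvI x1 y1 i1).
  by apply: eq_integrable => // z _ /=; rewrite mulr1.
have i3 : leb.-integrable `]x, y[ (fun z => (`|- (w z * g z)|)%:E).
  by have := integrable_abse i2; apply: eq_integrable.
have i4 : leb.-integrable `]x, y[ (fun z => (th / 2 * (g z ^+ 2 * w z))%:E).
  by have := integrableZl (mitv _ _) (th / 2) (integrable_itvI x1 y1 ig); apply: eq_integrable.
have i5 : leb.-integrable `]x, y[ (fun z => (B / th / 2)%:E).
  exact: (integrable_itvI x1 y1 (integrable_cstI _)).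
apply: (le_trans (le_normr_Rintegral (mitv _ _) i2)).
apply: (@le_trans _ _ (\int[leb]_(z in `]x, y[) (th / 2 * (g z ^+ 2 * w z) + B / th / 2))).
  apply: le_Rintegral => //.
    have := integrableD (mitv _ _) i4 i5; by apply: eq_integrable.
  move=> z /=; rewrite in_itv /= => zxy; rewrite normrN normrM (ger0_norm (jweight_ge0 z)).
  have h1 : w z / th <= B / th by rewrite ler_pM2r ?invr_gt0 // wB.
  suff h2 : 2 * (w z * `|g z|) <= th * (g z ^+ 2 * w z) + w z / th.
    move: h1 h2; rewrite (mulrAC th).
    move: (w z * `|g z|) (th * (g z ^+ 2 * w z)) (w z / th) (B / th) => p q p' q'; lra.
  have e : th * (g z ^+ 2 * w z) + w z / th - 2 * (w z * `|g z|) =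
      w z / th * (th * `|g z| - 1) ^+ 2.
    rewrite -(real_normK (num_real (g z))); field; exact: lt0r_neq0.
  by rewrite -subr_ge0 e mulr_ge0 ?sqr_ge0 // divr_ge0 ?jweight_ge0 // ltW.
rewrite RintegralD // RintegralZl //; last exact: (integrable_itvI x1 y1 ig).
rewrite Rintegral_cst //.
have -> : fine (leb `]x, y[) = y - x by rewrite lebesgue_measure_itv /= lte_fin xy.
have le1 : \int[leb]_(z in `]x, y[) (g z ^+ 2 * w z) <= \int[leb]_(z in I) (g z ^+ 2 * w z).
  apply: fine_le.
  - exact/integrable_fin_num/(integrable_itvI x1 y1 ig).
  - exact/integrable_fin_num.
  apply: ge0_subset_integral => //; last exact: itv_subI.
    by have [] := integrableP _ _ _ ig.
  by move=> z _; rewrite lee_fin mulr_ge0 ?sqr_ge0 ?jweight_ge0.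
have := ler_wpM2l (ltW th0) le1.
by move: (\int[leb]_(z in _) _) (\int[leb]_(z in _) _) (B / th) => p q r; nra.
Qed.

Lemma topflux_increment n f b : (0 < n)%N -> acder (2 * n).-1 f -> L2w (real_pow al be n f) ->
  exists K : R, exists2 d : R, 0 < d & forall x y, 0 < endvar b x < d -> 0 < endvar b y < d ->
    `|topflux al be n f x - topflux al be n f y| <=
       K * endpow b ((1 + endexp al be b) / 2) x + K * endpow b ((1 + endexp al be b) / 2) y.
Proof.
move=> hn Kf hg; set a := endexp al be b; have /andP[a0 a1] : 0 < a < 1 by exact: a_in.
pose G := \int[leb]_(z in I) (real_pow al be n f z ^+ 2 * w z).
have G0 : 0 <= G by apply: Rintegral_ge0 => z _; rewrite mulr_ge0 ?sqr_ge0 ?jweight_ge0.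
(* Half the sum of G and of the 2 in the bound w <= 2 tau^a. *)
exists ((G + 2) / 2), 1; first exact: ltr01.
suff H x y : x < y -> 0 < endvar b x < 1 -> 0 < endvar b y < 1 ->
    `|topflux al be n f y - topflux al be n f x| <=
       (G + 2) / 2 * endpow b ((1 + a) / 2) x + (G + 2) / 2 * endpow b ((1 + a) / 2) y.
  move=> x y tx ty; have [xy|yx|->] := ltgtP x y.
  - by rewrite distrC; exact: H.
  - by rewrite [leRHS]addrC; exact: H yx ty tx.
  - by rewrite subrr normr0 addr_ge0 // mulr_ge0 ?endpow_ge0 //; lra.
move=> xy tx ty; pose tau := Num.max (endvar b x) (endvar b y).
have ttI (z : R) : 0 < endvar b z < 1 -> -1 < z < 1.
  by rewrite (endvar_in b) => /andP[-> z1] /=; rewrite (lt_trans z1) // ltr1n.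
have /andP[x1 _] := ttI _ tx; have /andP[_ y1] := ttI _ ty.
have /andP[tx0 tx1] := tx; have /andP[ty0 ty1] := ty.
have tau0 : 0 < tau by rewrite lt_max tx0.
have xyt : y - x <= tau.
  have : `|endvar b x - endvar b y| <= tau.
    by rewrite ler_norml /tau; case: (leP (endvar b x) (endvar b y)) => h; apply/andP; split; lra.
  by rewrite endvar_dist distrC gtr0_norm // subr_gt0.
have wB z : x < z < y -> w z <= 2 * tau `^ a.
  move=> /andP[xz zy]; have zI : -1 < z < 1 by rewrite (lt_trans x1 xz) (lt_trans zy y1).
  apply: (le_trans (jweight_le b zI)); rewrite ler_pM2l ?ltr0n // -/a.
  have := zI; rewrite (endvar_in b) => /andP[z0 _].
  apply: ge0_ler_powR; rewrite ?nnegrE; try exact: ltW.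
  rewrite le_max; have : endsign R b = 1 \/ endsign R b = -1 by rewrite /endsign; case: (b); [right|left].
  by rewrite /endvar => -[->|->]; apply/orP; [left|right]; lra.
have ih : leb.-integrable `]x, y[ (EFin \o (fun z => - (w z * real_pow al be n f z))).
  have := integrableN (integrable_itvI x1 y1 (integrable_prod hg L2w_1)).
  by apply: eq_integrable => // z _ /=; rewrite mulr1.
have PE := topflux_integral hn Kf x1 xy y1 ih.
rewrite /= in PE; rewrite PE.
(* This [th] balances the AM-GM bound: with B = 2 tau^a and y - x <= tau both terms are at most
   multiples of tau^((1 + a) / 2). *)
have th0 : 0 < tau `^ ((1 + a) / 2) by rewrite powR_gt0.
apply: (le_trans (weighted_integral_le hg x1 xy y1 th0 wB)); rewrite -/G.
have e1 : tau `^ a * tau = tau `^ ((1 + a) / 2) * tau `^ ((1 + a) / 2).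
  have tn : tau != 0 by rewrite gt_eqF.
  rewrite -{2}(powRr1 (ltW tau0)) -!powRD ?tn ?implybT //; congr powR; lra.
have le1 : 2 * tau `^ a / tau `^ ((1 + a) / 2) * (y - x) <= 2 * tau `^ ((1 + a) / 2).
  apply: (@le_trans _ _ (2 * tau `^ a / tau `^ ((1 + a) / 2) * tau)).
    by rewrite ler_wpM2l // divr_ge0 ?mulr_ge0 ?powR_ge0 //.
  rewrite mulrAC -(mulrA 2) e1 mulrA mulfK //; exact: lt0r_neq0.
have le2 : tau `^ ((1 + a) / 2) <= endpow b ((1 + a) / 2) x + endpow b ((1 + a) / 2) y.
  rewrite /tau /endpow; case: (leP (endvar b x) (endvar b y)) => _; [rewrite lerDr|rewrite lerDl]; exact: powR_ge0.
move: le1 le2 (ltW th0).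
move: (2 * tau `^ a / tau `^ ((1 + a) / 2) * (y - x)) (tau `^ ((1 + a) / 2)).
move: (endpow b ((1 + a) / 2) x) (endpow b ((1 + a) / 2) y) => u v p q le1 le2 q0.
have h : (G + 2) / 2 * q <= (G + 2) / 2 * (u + v).
  by apply: ler_wpM2l => //; apply: divr_ge0 => //; exact: addr_ge0.
by move: h le1; lra.
Qed.

(** * Membership in the weighted space *)

Lemma measurable_acder f : acder 1 f -> measurable_fun I f.
Proof.
move=> Kf; apply: open_continuous_measurable_fun; first exact: itv_open.
move=> x; rewrite inE => /IP xI.
by apply/differentiable_continuous/derivable1_diffP; exact: (acder_derivable (isT : (0 < 1)%N) Kf xI).
Qed.

(** Monotone convergence along intervals exhausting (-1, 1), on which the explicit primitive F
    bounds the integrals uniformly because s + 1 > 0. *)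
Lemma integrable_endpow b s : -1 < s -> leb.-integrable I (fun x => (endpow b s x)%:E).
Proof.
move=> s1; pose F x := - endsign R b / (s + 1) * endpow b (s + 1) x.
have s10 : 0 < s + 1 by rewrite -ltrBlDr sub0r.
have mp : measurable_fun I (endpow b s) by apply: measurable_acder; exact: acder_endpow.
have KF : acder 0 F by apply: acder_scale; exact: acder_endpow.
have dF x : -1 < x < 1 -> derive1 F x = endpow b s x.
  rewrite (endvar_in b) => /andP[t0 _].
  rewrite (derive1Ml _ (derivable_endpow t0)) (derive1_endpow _ t0) addrK mulrA.
  have -> : - endsign R b / (s + 1) * - (endsign R b * (s + 1)) = endsign R b * endsign R b.
    by field; exact: lt0r_neq0.
  by rewrite sgsg mul1r.
pose M := 2 * (2 `^ (s + 1) / (s + 1)).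
have FM x : -1 < x < 1 -> `|F x| <= 2 `^ (s + 1) / (s + 1).
  rewrite (endvar_in b) => /andP[t0 t2]; rewrite normrM normrM normrN norm_endsign mul1r.
  rewrite (gtr0_norm (_ : 0 < (s + 1)^-1)) ?invr_gt0 // mulrC ler_pM2r ?invr_gt0 //.
  rewrite ger0_norm ?endpow_ge0 //; apply: ge0_ler_powR; rewrite ?nnegrE //; exact: ltW.
have ip x y : -1 < x -> x < y -> y < 1 -> leb.-integrable `]x, y[ (fun z => (endpow b s z)%:E).
  move=> x1 xy y1.
  have [B hB] := ac_bounded (ltW xy) (acder_endpow 0 b s x y x1 (ltW xy) y1).
  apply: (le_integrable (mitv x y) _ _ (integrable_itvI x1 y1 (integrable_cstI B))).
    by apply/measurable_EFinP; apply: measurable_funS mp => //; exact: itv_subI.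
  move=> z; rewrite /= in_itv /= lee_fin => /andP[xz zy].
  by apply: le_trans (ler_norm _); apply: hB; rewrite !ltW.
have iM x y : -1 < x -> x < y -> y < 1 -> (\int[leb]_(z in `]x, y[) (endpow b s z)%:E <= M%:E)%E.
  move=> x1 xy y1; have ixy := ip _ _ x1 xy y1.
  rewrite -(fineK (integrable_fin_num _ ixy)) // lee_fin.
  have -> : fine (\int[leb]_(z in `]x, y[) (endpow b s z)%:E) = F y - F x.
    apply/esym/ac_integral => //; first exact: (KF x y x1 (ltW xy) y1).
    apply: filterS; first exact: (ae_filter_ringOfSetsType leb).
      2: exact: (@filterT _ _ (ae_filter_ringOfSetsType leb)).
    move=> z _ /andP[xz zy] _; apply: dF; by rewrite (lt_trans x1 xz) (lt_trans zy y1).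
  apply: (le_trans (ler_norm _)); apply: (le_trans (ler_normB _ _)).
  have xI : -1 < x < 1 by rewrite x1 (lt_trans xy).
  have yI : -1 < y < 1 by rewrite y1 (lt_trans x1).
  by move: (FM x xI) (FM y yI); rewrite /M; move: (_ / _) => B; lra.
(* Starting at 1/2 makes every interval of the exhaustion nonempty. *)
pose A i : set (measurableTypeR R) := `](-1 + i.+2%:R^-1), (1 - i.+2%:R^-1)[%classic.
have i2 i : 0 < (i.+2%:R^-1 : R) < 1.
  by rewrite invr_gt0 ltr0n /= invf_lt1 ?ltr0n // ltr1n.
have AI : \bigcup_i A i = I.
  apply/seteqP; split=> [z [i _]|z /IP /andP[z1 z2]].
    have /andP[h1 _] := i2 i.
    by apply: (@itv_subI (-1 + i.+2%:R^-1) (1 - i.+2%:R^-1)); rewrite ?ltrDl // ltrBlDr ltrDl.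
  have e0 : 0 < Num.min (1 + z) (1 - z) by rewrite lt_min; apply/andP; split; lra.
  have [i hi] : exists i, i.+2%:R^-1 < Num.min (1 + z) (1 - z).
    have [i _ H] := near_infty_natSinv_lt (PosNum e0); exists i.
    apply: le_lt_trans (H i (leqnn i)); rewrite lef_pV2 ?posrE ?ltr0n // ler_nat //.
  exists i => //; rewrite /A /= in_itv /=.
  by move: hi; rewrite lt_min; move: (i.+2%:R^-1) => e /andP[? ?]; apply/andP; split; lra.
have nA : nondecreasing_seq A.
  move=> i j ij; apply/subsetPset => z; rewrite /A /= !in_itv /=.
  have : (j.+2%:R^-1 : R) <= i.+2%:R^-1 by rewrite lef_pV2 ?posrE ?ltr0n // ler_nat !ltnS.
  by move: (i.+2%:R^-1) (j.+2%:R^-1) => e e' ? /andP[z1 z2]; apply/andP; split; lra.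
have AS i : A i `<=` I by rewrite -AI; exact: bigcup_sup.
have mA i : measurable (A i) by exact: measurable_itv.
apply/integrableP; split; first exact/measurable_EFinP.
rewrite (@le_lt_trans _ _ M%:E) ?ltry //.
have -> : (\int[leb]_(x in I) `|(endpow b s x)%:E| = \int[leb]_(x in \bigcup_i A i) (endpow b s x)%:E)%E.
  by rewrite AI; apply: eq_integral => x _; rewrite /= ger0_norm ?endpow_ge0.
have mf i : measurable_fun (A i) (fun x : measurableTypeR R => (endpow b s x)%:E).
  by apply/measurable_EFinP; apply: measurable_funS mp => //; exact: AS.
have H := @ge0_nondecreasing_set_cvg_integral _ (measurableTypeR R) R A
  (fun x => (endpow b s x)%:E) leb nA mA mf (fun i x _ => endpow_ge0 b s x).
have <- := cvg_lim (@ereal_hausdorff R) H.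
apply: lime_le; first by apply/cvg_ex; eexists; exact: H.
apply: nearW => i; have := i2 i; rewrite /A; move: (i.+2%:R^-1) => e /andP[e0 e1].
by apply: iM; lra.
Qed.

(** f^2 w has order -2a + a = -a at each end, integrable because a < 1, and is bounded in between;
    the sum of the three bounds dominates it everywhere. *)
Lemma L2w_endO f : acder 1 f -> (forall b, endO b 1 (- endexp al be b) 0 f) -> L2w f.
Proof.
move=> Kf Hf; split; first exact: measurable_acder.
have ends b : exists M d : R, [/\ 0 < d, d <= 1 & forall x, 0 < endvar b x < d ->
    f x ^+ 2 * w x <= M * endpow b (- endexp al be b) x].
  have [M [d d0 hM]] := endO_bound (Hf b); have d10 : 0 < Num.min d 1 by rewrite lt_min d0 ltr01.
  exists (2 * M ^+ 2), (Num.min d 1); split=> //; first by rewrite ge_min lexx orbT.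
  move=> x; rewrite lt_min => /andP[x0 /andP[xd x1]].
  have xI : -1 < x < 1 by rewrite (endvar_in b) x0 (lt_trans x1) // ltr1n.
  have h1 : `|f x| <= M * endpow b (- endexp al be b) x by apply: hM; rewrite x0.
  have h2 : f x ^+ 2 <= (M * endpow b (- endexp al be b) x) ^+ 2.
    by rewrite -(real_normK (num_real (f x))); apply: lerXn2r; rewrite ?nnegrE //; exact: le_trans h1.
  apply: (@le_trans _ _ ((M * endpow b (- endexp al be b) x) ^+ 2 * (2 * endpow b (endexp al be b) x))).
    by apply: ler_pM => //; [exact: sqr_ge0|exact: jweight_ge0|exact: jweight_le].
  have : endpow b (- endexp al be b) x * endpow b (endexp al be b) x = 1 by rewrite -pwD // addNr pw0.
  move: (endpow _ _ _) (endpow _ _ _) => p q pq; rewrite exprMn.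
  have -> : M ^+ 2 * q ^+ 2 * (2 * p) = 2 * M ^+ 2 * q * (q * p) by ring.
  by rewrite pq mulr1.
have [M0 [d0 [d00 d01 H0]]] := ends false; have [M1 [d1 [d10 d11 H1]]] := ends true.
have x1 : -1 < -1 + d1 / 2 by lra.
have y1 : 1 - d0 / 2 < 1 by lra.
have xy : -1 + d1 / 2 <= 1 - d0 / 2 by lra.
have [B hB] := ac_bounded xy ((acder_S Kf) _ _ x1 xy y1).
have i0 : leb.-integrable I (fun x => (`|M0| * endpow false (- endexp al be false) x)%:E).
  have := integrableZl mI `|M0| (@integrable_endpow false (- endexp al be false) _).
  have -> : -1 < - endexp al be false by rewrite ltrN2; case/andP: (a_in hal hbe false).
  by move=> /(_ isT); apply: eq_integrable.
have i1 : leb.-integrable I (fun x => (`|M1| * endpow true (- endexp al be true) x)%:E).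
  have := integrableZl mI `|M1| (@integrable_endpow true (- endexp al be true) _).
  have -> : -1 < - endexp al be true by rewrite ltrN2; case/andP: (a_in hal hbe true).
  by move=> /(_ isT); apply: eq_integrable.
have i2 := integrableD mI (integrableD mI i0 i1) (integrable_cstI (B ^+ 2 * 4)).
apply: (le_integrable mI _ _ i2) => //.
  apply/measurable_EFinP; apply: measurable_funM; last exact: measurable_jweight.
  by apply: measurable_funX; exact: measurable_acder.
move=> x /IP xI; rewrite /= lee_fin (ger0_norm (mulr_ge0 (sqr_ge0 _) (jweight_ge0 _))).
apply: le_trans (ler_norm _).
have p0 := endpow_ge0 false (- endexp al be false) x; have p1 := endpow_ge0 true (- endexp al be true) x.
have n0 := normr_ge0 M0; have n1 := normr_ge0 M1; have b0 := sqr_ge0 B.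
have /andP[t0 t0'] : 0 < endvar false x < 2 by rewrite -endvar_in.
have /andP[t1 t1'] : 0 < endvar true x < 2 by rewrite -endvar_in.
have q0 := mulr_ge0 n0 p0; have q1 := mulr_ge0 n1 p1.
have [xd0|dx0] := ltP (endvar false x) d0.
  have h := H0 x; rewrite t0 xd0 in h; apply: (le_trans (h isT)).
  have := ler_wpM2r p0 (ler_norm M0); move: q0 q1.
  by move: (_ * endpow _ _ _) (`|M0| * endpow _ _ _) (`|M1| * endpow _ _ _) => u v z; lra.
have [xd1|dx1] := ltP (endvar true x) d1.
  have h := H1 x; rewrite t1 xd1 in h; apply: (le_trans (h isT)).
  have := ler_wpM2r p1 (ler_norm M1); move: q0 q1.
  by move: (_ * endpow _ _ _) (`|M0| * endpow _ _ _) (`|M1| * endpow _ _ _) => u v z; lra.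
have fB : `|f x| <= B.
  by apply: hB; move: dx0 dx1; rewrite /endvar /endsign expr0 expr1; move=> ? ?; apply/andP; split; lra.
have h1 : f x ^+ 2 <= B ^+ 2.
  by rewrite -(real_normK (num_real (f x))); apply: lerXn2r; rewrite ?nnegrE //; exact: le_trans fB.
have h2 : f x ^+ 2 * w x <= B ^+ 2 * 4.
  by apply: ler_pM => //; [exact: sqr_ge0|exact: jweight_ge0|exact: jweight_le4].
apply: (le_trans h2); move: q0 q1.
by move: (`|M0| * endpow _ _ _) (`|M1| * endpow _ _ _) (_ * 4) => u v z; lra.
Qed.

(** * Green's formula for real functions *)

Section Green.
Variables (n : nat) (C : nat -> R).
Hypothesis hn : (0 < n)%N.
Hypothesis hCr : forall q : R -> R, (forall m, acder m q) -> forall x, -1 < x < 1 ->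
  real_pow al be n q x = (jweight al be x)^-1 *
    \sum_(1 <= k < n.+1) (-1) ^+ k * iderive k (fun y => real_coef al be C k y * iderive k q y) x.

(** The bracket minus a primitive of its derivative is constant on (-1, 1); comparison at the two
    ends gives the integral. *)
Lemma real_green f g (L1 L2 : R) : acder (2 * n).-1 f -> acder (2 * n).-1 g ->
  L2w f -> L2w g -> L2w (real_pow al be n f) -> L2w (real_pow al be n g) ->
  real_bracket al be n C f g @ endfilter false --> L1 -> real_bracket al be n C f g @ endfilter true --> L2 ->
  \int[leb]_(x in I) (w x * (real_pow al be n f x * g x)) -
  \int[leb]_(x in I) (w x * (f x * real_pow al be n g x)) = L1 - L2.
Proof.
move=> Kf Kg hf hg hlf hlg hL1 hL2.
pose H x := w x * (real_pow al be n f x * g x - f x * real_pow al be n g x).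
have i1 := integrable_prod hlf hg; have i2 := integrable_prod hf hlg.
have iH : leb.-integrable I (EFin \o H).
  have := integrableB mI i1 i2; apply: eq_integrable => // x _ /=.
  by rewrite -EFinB /H mulrBr.
rewrite -RintegralB //.
have -> : \int[leb]_(x in I) (w x * (real_pow al be n f x * g x) - w x * (f x * real_pow al be n g x)) =
    \int[leb]_(x in I) H x by apply: eq_Rintegral => x _; rewrite /H mulrBr.
(* Extension by 0 lets the primitive G live on the closed interval, where it is continuous up to
   both ends. *)
pose H0 := H \_ I.
have iH0 : leb.-integrable setT (EFin \o H0).
  by rewrite -restrict_EFin; apply/integrable_restrict => //; rewrite setTI.
pose G c := \int[leb]_(t in `[(-1), c]) H0 t.
have GE x y : -1 < x -> x < y -> y < 1 -> real_bracket al be n C f g y - real_bracket al be n C f g x = G y - G x.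
  move=> x1 xy y1; rewrite (rbr_integral hn hCr Kf Kg x1 xy y1); last exact: integrable_itvI iH.
  rewrite /G Rintegral_itvB ?bnd_simp; [|exact: integrable_itv|exact: ltW|exact: ltW].
  rewrite -Rintegral_itv_bndo_bndc; last exact: integrable_itv.
  apply: eq_Rintegral => z; rewrite inE /= in_itv /= => /andP[xz zy].
  by rewrite /H0 patchE mem_set // /jint /= in_itv /= (lt_trans x1 xz) (lt_trans zy y1).
have m11 : -1 < 1 :> R by lra.
have iH1 : leb.-integrable `[(-1), 1] (EFin \o H0) by exact: integrable_itv.
have G1 : G @ endfilter false --> G 1.
  by rewrite E_left; exact: (parameterized_integral_cvg_at_left m11 iH1).
have G0 : G @ endfilter true --> (0 : R).
  rewrite E_right; apply/cvgrPdist_lt => e e0.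
  have := parameterized_integral_near_left m11 e0 iH1; move=> [d /= d0 hd].
  exists d => //= c /= cd c1; rewrite sub0r normrN; apply: hd => //; exact: ltW.
have I0 : -1 < (0 : R) < 1 by apply/andP; split; lra.
pose D x := real_bracket al be n C f g x - G x.
have DE x : -1 < x < 1 -> D x = D 0.
  move=> /andP[x1 x2]; have /andP[l1 l2] := I0.
  have [x0|x0|->//] := ltgtP x 0.
    by have := GE _ _ x1 x0 l2; rewrite /D; move: (real_bracket _ _ _ _ _ _ _) (real_bracket _ _ _ _ _ _ _) (G _) (G _) => p q r s; lra.
  by have := GE _ _ l1 x0 x2; rewrite /D; move: (real_bracket _ _ _ _ _ _ _) (real_bracket _ _ _ _ _ _ _) (G _) (G _) => p q r s; lra.
have D1 : L1 - G 1 = D 0.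
  apply: (E_cvg_unique (cvgB hL1 G1)); apply: (E_cvg_eq (f := fun=> D 0)); last exact: E_cvg_cst.
  by apply: nearI => x /DE.
have D2 : L2 - 0 = D 0.
  apply: (E_cvg_unique (cvgB hL2 G0)); apply: (E_cvg_eq (f := fun=> D 0)); last exact: E_cvg_cst.
  by apply: nearI => x /DE.
have -> : \int[leb]_(x in I) H x = G 1.
  rewrite /G -Rintegral_itv_bndo_bndc; last exact: integrable_itv.
  rewrite -Rintegral_itv_obnd_cbnd; last exact: integrable_itv.
  by apply: eq_Rintegral => z zI; rewrite /H0 patchE zI.
by move: D1 D2; move: (G 1) (D 0) => p q; lra.
Qed.

End Green.

End WeightedL2.

(** * Real and imaginary parts *)

Section ComplexParts.
Variable R : realType.
Implicit Types (f g : R -> R[i]) (x y s : R).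

Definition re f : R -> R := fun x => complex.Re (f x).
Definition im f : R -> R := fun x => complex.Im (f x).

Lemma re_cderiven k f : re (cderiven k f) = iderive k (re f).
Proof. by elim: k => // k IH; rewrite -iderive_derive1 -IH. Qed.

Lemma im_cderiven k f : im (cderiven k f) = iderive k (im f).
Proof. by elim: k => // k IH; rewrite -iderive_derive1 -IH. Qed.

Lemma cderivenE k f x : cderiven k f x = iderive k (re f) x +i* iderive k (im f) x.
Proof. by rewrite -re_cderiven -im_cderiven /re /im; case: (cderiven k f x). Qed.

Lemma Re_cmul (c : R) (z : R[i]) : complex.Re (c%:C * z) = c * complex.Re z.
Proof. by case: z => p q /=; rewrite mul0r subr0. Qed.

Lemma Im_cmul (c : R) (z : R[i]) : complex.Im (c%:C * z) = c * complex.Im z.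
Proof. by case: z => p q /=; rewrite mul0r addr0. Qed.

Lemma CReM (z t : R[i]) :
  complex.Re (z * t) = complex.Re z * complex.Re t - complex.Im z * complex.Im t.
Proof. by case: z; case: t. Qed.

Lemma CImM (z t : R[i]) :
  complex.Im (z * t) = complex.Re z * complex.Im t + complex.Im z * complex.Re t.
Proof. by case: z; case: t. Qed.

Lemma CReD (z t : R[i]) : complex.Re (z + t) = complex.Re z + complex.Re t.
Proof. by case: z; case: t. Qed.

Lemma CImD (z t : R[i]) : complex.Im (z + t) = complex.Im z + complex.Im t.
Proof. by case: z; case: t. Qed.

Lemma CReN (z : R[i]) : complex.Re (- z) = - complex.Re z.
Proof. by case: z. Qed.

Lemma CImN (z : R[i]) : complex.Im (- z) = - complex.Im z.
Proof. by case: z. Qed.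

Lemma Re_sum (T : Type) (r : seq T) (F : T -> R[i]) :
  complex.Re (\sum_(i <- r) F i) = \sum_(i <- r) complex.Re (F i).
Proof. exact: (big_morph (@complex.Re R) CReD). Qed.

Lemma Im_sum (T : Type) (r : seq T) (F : T -> R[i]) :
  complex.Im (\sum_(i <- r) F i) = \sum_(i <- r) complex.Im (F i).
Proof. exact: (big_morph (@complex.Im R) CImD). Qed.

Lemma Re_sign m (z : R[i]) : complex.Re ((-1) ^+ m * z) = (-1) ^+ m * complex.Re z.
Proof. by rewrite -signr_odd -[in RHS]signr_odd; case: odd; rewrite ?expr0 ?expr1 ?mul1r ?mulN1r ?CReN. Qed.

Lemma Im_sign m (z : R[i]) : complex.Im ((-1) ^+ m * z) = (-1) ^+ m * complex.Im z.
Proof. by rewrite -signr_odd -[in RHS]signr_odd; case: odd; rewrite ?expr0 ?expr1 ?mul1r ?mulN1r ?CImN. Qed.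

Lemma complex_eq (z t : R[i]) :
  complex.Re z = complex.Re t -> complex.Im z = complex.Im t -> z = t.
Proof. by case: z; case: t => /= p q p' q' -> ->. Qed.

Definition cacder N f := acder N (re f) /\ acder N (im f).

Lemma cacder_congr N f g : (forall x, f x = g x) -> cacder N f -> cacder N g.
Proof. by move=> /funext ->. Qed.

Lemma cacder_add N f g : cacder N f -> cacder N g -> cacder N (fun x => f x + g x).
Proof.
move=> [f1 f2] [g1 g2]; split.
  by apply: acder_congr (acder_add f1 g1) => x _; rewrite /re CReD.
by apply: acder_congr (acder_add f2 g2) => x _; rewrite /im CImD.
Qed.

Lemma cacder_scale N (c : R[i]) f : cacder N f -> cacder N (fun x => c * f x).
Proof.
move=> [f1 f2]; split.
  apply: acder_congr (acder_sub (acder_scale (complex.Re c) f1) (acder_scale (complex.Im c) f2)) => x _.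
  by rewrite /re CReM.
apply: acder_congr (acder_add (acder_scale (complex.Re c) f2) (acder_scale (complex.Im c) f1)) => x _.
by rewrite /im CImM.
Qed.

Lemma cacder_cst N (c : R[i]) : cacder N (fun=> c).
Proof. by split; exact: acder_cst. Qed.

Lemma cacder_sum (r : seq nat) N (F : nat -> R -> R[i]) :
  (forall i, i \in r -> cacder N (F i)) -> cacder N (fun x => \sum_(i <- r) F i x).
Proof.
elim: r => [|i r IH] H.
  by apply: (cacder_congr (f := fun=> 0)); [move=> x; rewrite big_nil|exact: cacder_cst].
apply: (cacder_congr (f := fun x => F i x + \sum_(i <- r) F i x)).
  by move=> x; rewrite big_cons.
apply: cacder_add; first by apply: H; rewrite mem_head.
by apply: IH => j jr; apply: H; rewrite inE jr orbT.
Qed.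

Lemma acder_intro N (f : R -> R) :
  (forall k x, (k < N)%N -> -1 < x < 1 -> derivable (iderive k f) x 1) -> acI (iderive N f) -> acder N f.
Proof.
elim: N f => [|N IH] f H1 H2 //; split; first by move=> x xI; exact: (H1 0%N).
by apply: IH; rewrite -?DnS // => k x kN xI; have := H1 k.+1 x kN xI; rewrite DnS.
Qed.

(** [csmooth] provides derivatives but no bounds: here f' is continuous, hence bounded on compact
    intervals, and f is Lipschitz there. *)
Lemma acI_C2 (f : R -> R) : (forall x, -1 < x < 1 -> derivable f x 1) ->
  (forall x, -1 < x < 1 -> derivable (derive1 f) x 1) -> acI f.
Proof.
move=> d1 d2 a b a1 ab b1.
have sub x : a <= x <= b -> -1 < x < 1.
  by move=> /andP[ax xb]; rewrite (lt_le_trans a1 ax) (le_lt_trans xb b1).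
have cf : {within `[a, b], continuous (derive1 f)}.
  by apply: derivable_within_continuous => x; rewrite in_itv /= => /sub /d2.
have [M hM] : exists M : R, forall x, a <= x <= b -> `|derive1 f x| <= M.
  have [c _ hc] := EVT_max ab cf; have [c' _ hc'] := EVT_min ab cf.
  exists (`|derive1 f c| + `|derive1 f c'|) => x xab.
  have xi : x \in `[a, b]%R by rewrite in_itv.
  move: (hc x xi) (hc' x xi); rewrite ler_norml.
  move: (derive1 f x) (derive1 f c) (derive1 f c') => u v z uv zu.
  by have := ler_norm v; have := ler_norm (- z); rewrite normrN; have := normr_ge0 v;
    have := normr_ge0 z; move: `|v| `|z| => V Z; lra.
apply: (ac_lip (M := M)); apply: MVT_le => // x /sub; exact: d1.
Qed.

Lemma csmooth_cacder f : csmooth f -> forall N, cacder N f.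
Proof.
move=> sf N; have d k x : -1 < x < 1 -> derivable (iderive k (re f)) x 1 /\ derivable (iderive k (im f)) x 1.
  by move=> xI; have := sf k x xI; rewrite -re_cderiven -im_cderiven.
split; apply: acder_intro => [k x _ xI|]; try (by have [] := d k x xI); apply: acI_C2 => x xI;
  have [h1 h2] := d N x xI; have [h3 h4] := d N.+1 x xI; rewrite ?iderive_derive1.
- exact: h1.
- exact: h3.
- exact: h2.
- exact: h4.
Qed.

Lemma cacder_cderivable N k f x : (k < N)%N -> cacder N f -> -1 < x < 1 -> cderivable (cderiven k f) x.
Proof.
move=> kN [f1 f2] xI; split.
  rewrite -[fun y => _]/(re (cderiven k f)) re_cderiven.
  by apply: (acder_derivable (isT : (0 < 1)%N)) xI; apply: acder_iderive; apply: acder_leN f1; lia.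
rewrite -[fun y => _]/(im (cderiven k f)) im_cderiven.
by apply: (acder_derivable (isT : (0 < 1)%N)) xI; apply: acder_iderive; apply: acder_leN f2; lia.
Qed.

Lemma cmod_ge_re (z : R[i]) : `|complex.Re z| <= cmod z.
Proof.
case: z => p q; rewrite /cmod /= -sqrtr_sqr; apply: ler_wsqrtr.
by rewrite lerDl sqr_ge0.
Qed.

Lemma cmod_ge_im (z : R[i]) : `|complex.Im z| <= cmod z.
Proof.
case: z => p q; rewrite /cmod /= -sqrtr_sqr; apply: ler_wsqrtr.
by rewrite lerDr sqr_ge0.
Qed.

Lemma cmod_le (z : R[i]) : cmod z <= `|complex.Re z| + `|complex.Im z|.
Proof.
case: z => p q; rewrite /cmod /= -(ger0_norm (addr_ge0 (normr_ge0 p) (normr_ge0 q))).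
rewrite -sqrtr_sqr; apply: ler_wsqrtr; rewrite sqrrD !real_normK ?num_real //.
rewrite addrAC lerDl mulrn_wge0 // mulr_ge0 //.
Qed.

Lemma cmod_sqr (z : R[i]) : cmod z ^+ 2 = complex.Re z ^+ 2 + complex.Im z ^+ 2.
Proof. by case: z => p q; rewrite /cmod /= sqr_sqrtr // addr_ge0 ?sqr_ge0. Qed.

Lemma abs_cont_on_ac a b f : abs_cont_on a b f <-> ac a b (re f) /\ ac a b (im f).
Proof.
split=> [H|[H1 H2]].
  split=> e e0; have [d d0 hd] := H e e0; exists d => // s /andP[s1 s2] sd;
    apply: le_lt_trans (hd s s1 s2 sd); apply: ler_sum => p _.
    by have := cmod_ge_re (f p.2 - f p.1); rewrite CReD CReN.
  by have := cmod_ge_im (f p.2 - f p.1); rewrite CImD CImN.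
move=> e e0; have e20 : 0 < e / 2 by rewrite divr_gt0.
have [d1 d10 hd1] := H1 _ e20; have [d2 d20 hd2] := H2 _ e20.
exists (Num.min d1 d2); first by rewrite lt_min d10.
move=> s s1 s2; rewrite lt_min => /andP[sd1 sd2].
apply: (@le_lt_trans _ _ (\sum_(p <- s) `|re f p.2 - re f p.1| + \sum_(p <- s) `|im f p.2 - im f p.1|)).
  rewrite -big_split /=; apply: ler_sum => p _.
  by have := cmod_le (f p.2 - f p.1); rewrite CReD CReN CImD CImN.
have ss : subitvs a b s by apply/andP.
have := hd1 s ss sd1; have := hd2 s ss sd2.
by move: (\sum_(p <- s) _) (\sum_(p <- s) _) => A B; lra.
Qed.

Lemma AC_loc_acI f : AC_loc f <-> acI (re f) /\ acI (im f).
Proof.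
split=> [H|[H1 H2] a b a1 ab b1].
  by split=> a b a1 ab b1; have /abs_cont_on_ac[] := H a b a1 ab b1.
by apply/abs_cont_on_ac; split; [exact: H1|exact: H2].
Qed.

End ComplexParts.

Section ComplexLimits.
Variable R : realType.
Variable b : bool.
Implicit Types (f g : R -> R[i]) (z : R[i]).

(** Joins existence and value, since [clim] has a default value where there is no limit. *)
Definition ccvg_to f z := re f @ endfilter b --> complex.Re z /\ im f @ endfilter b --> complex.Im z.

Lemma ccvg_toP f z : ccvg_to f z -> ccvg (endfilter b) f /\ clim (endfilter b) f = z.
Proof.
move=> [h1 h2]; split; first by split; apply/cvg_ex; eexists; [exact: h1|exact: h2].
apply: complex_eq; apply: E_cvg_unique; [|exact: h1| |exact: h2].
  by apply/cvg_ex; eexists; exact: h1.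
by apply/cvg_ex; eexists; exact: h2.
Qed.

Lemma ccvg_to_near f g z : (\forall x \near endfilter b, f x = g x) -> ccvg_to f z -> ccvg_to g z.
Proof.
move=> fg [h1 h2]; split.
  by apply: E_cvg_eq h1; apply: filterS fg => x; rewrite /re => ->.
by apply: E_cvg_eq h2; apply: filterS fg => x; rewrite /im => ->.
Qed.

Lemma ccvg_to_lin (a : R[i]) f g z t : ccvg_to f z -> ccvg_to g t ->
  ccvg_to (fun x => a * f x + g x) (a * z + t).
Proof.
move=> [f1 f2] [g1 g2]; split.
  rewrite CReD CReM; apply: (E_cvg_eq (f := fun x =>
      (complex.Re a * re f x - complex.Im a * im f x) + re g x)).
    by apply: nearW => x; rewrite /re CReD CReM.
  by apply: cvgD => //; apply: cvgB; apply: cvgMr.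
rewrite CImD CImM; apply: (E_cvg_eq (f := fun x =>
    (complex.Re a * im f x + complex.Im a * re f x) + im g x)).
  by apply: nearW => x; rewrite /im CImD CImM.
by apply: cvgD => //; apply: cvgD; apply: cvgMr.
Qed.

End ComplexLimits.

(** * The complex operators in terms of the real ones *)

Section Bridge.
Variable R : realType.
Variables (al be : R) (n : nat) (C : nat -> R).
Hypothesis hal : 0 < al < 1.
Hypothesis hbe : 0 < be < 1.
Hypothesis hn : (0 < n)%N.
Hypothesis hC : jacobi_constants al be n C.
Implicit Types (f g : R -> R[i]) (x y s : R).

Local Notation w := (jweight al be).
Local Notation ra := (real_coef al be C).
Local Notation Sj := (real_quasi al be n C).
Local Notation rbr := (real_bracket al be n C).
Local Notation rellk := (real_pow al be).
Local Notation N := (2 * n).-1.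
Local Notation Q b i := (endpow b (i%:R - endexp al be b)).
Local Notation comb b := (endcomb al be b).
Local Notation quasi := (quasi al be C n).
Local Notation bracket := (bracket al be C n).

Lemma re_term k h : re (fun y => acoef al be C k y * cderiven k h y) = (fun y => ra k y * iderive k (re h) y).
Proof. by apply/funext => y; rewrite /re Re_cmul cderivenE. Qed.

Lemma im_term k h : im (fun y => acoef al be C k y * cderiven k h y) = (fun y => ra k y * iderive k (im h) y).
Proof. by apply/funext => y; rewrite /im Im_cmul cderivenE. Qed.

Lemma re_jacobi_pow k f : re (jacobi_pow al be k f) = rellk k (re f).
Proof.
elim: k f => // k IH f; rewrite /jacobi_pow iterS -/(jacobi_pow al be k f).
rewrite /real_pow iterS -/(rellk k (re f)) -IH; apply/funext => x.
set g := jacobi_pow al be k f; pose h y := (jweight (al + 1) (be + 1) y)%:C * cderive g y.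
have e : re h = real_flux al be (re g) by apply/funext => y; rewrite /re Re_cmul.
rewrite /real_expr -e {1}/re /jacobi_expr -(rmorphN (real_complex R)) Re_cmul.
by [].
Qed.

Lemma im_jacobi_pow k f : im (jacobi_pow al be k f) = rellk k (im f).
Proof.
elim: k f => // k IH f; rewrite /jacobi_pow iterS -/(jacobi_pow al be k f).
rewrite /real_pow iterS -/(rellk k (im f)) -IH; apply/funext => x.
set g := jacobi_pow al be k f; pose h y := (jweight (al + 1) (be + 1) y)%:C * cderive g y.
have e : im h = real_flux al be (im g) by apply/funext => y; rewrite /im Im_cmul.
rewrite /real_expr -e {1}/im /jacobi_expr -(rmorphN (real_complex R)) Im_cmul.
by [].
Qed.

(** The real part of the defining identity at a smooth function with zero imaginary part; this is
    the hypothesis [hCr] of the real sections. *)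
Lemma jacobi_constants_real (q : R -> R) : (forall m, acder m q) -> forall x, -1 < x < 1 ->
  rellk n q x = (w x)^-1 *
    \sum_(1 <= k < n.+1) (-1) ^+ k * iderive k (fun y => ra k y * iderive k q y) x.
Proof.
move=> Kq x xI; pose f y := (q y)%:C.
have sf : csmooth f.
  by move=> k y yI; apply: (cacder_cderivable (ltnSn k)) yI; split; [exact: Kq|exact: acder_cst].
have := congr1 (@complex.Re R) (hC sf xI).
rewrite -[complex.Re (jacobi_pow _ _ _ _ _)]/(re (jacobi_pow al be n f) x) re_jacobi_pow.
rewrite Re_cmul Re_sum => ->; congr (_ * _); apply: eq_bigr => k _.
by rewrite Re_sign cderivenE /= re_term.
Qed.

Lemma sum_triangle (T : zmodType) m (F : nat -> nat -> T) :
  \sum_(1 <= k < m.+1) \sum_(1 <= j < k.+1) F k j = \sum_(1 <= j < m.+1) \sum_(j <= k < m.+1) F k j.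
Proof.
elim: m => [|m IH]; first by rewrite !big_geq.
rewrite big_nat_recr //= IH [RHS]big_nat_recr //= big_nat1 [X in _ + X]big_nat_recr //= addrA; congr (_ + _).
rewrite -big_split /=; apply: eq_big_nat => j /andP[j1 jm].
by rewrite [RHS]big_nat_recr // ltnW.
Qed.

Lemma bracketE f g x : cacder N f -> cacder N g -> -1 < x < 1 ->
  bracket f g x = (rbr (re f) (re g) x + rbr (im f) (im g) x) +i*
                  (rbr (im f) (re g) x - rbr (re f) (im g) x).
Proof.
move=> [f1 f2] [g1 g2] xI.
pose T k j (h : R -> R) := iderive (k - j) (fun y => ra k y * iderive k h y) x.
have rc : re (fun z => (g z)^*%C) = re g by apply/funext => z; rewrite /re; case: (g z).
have ic : im (fun z => (g z)^*%C) = (fun y => -1 * im g y).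
  by apply/funext => z; rewrite /im mulN1r; case: (g z).
have TN k j : (j <= k)%N -> (0 < j)%N -> (k <= n)%N -> T k j (fun y => -1 * im g y) = - T k j (im g).
  move=> jk j0 kn; rewrite /T -[RHS]mulN1r -iderive_scale //; last first.
    by apply: acder_mul; [exact: acder_ra|apply: acder_iderive; apply: acder_leN g2; lia].
  apply: I_iderive => // y yI; rewrite iderive_scale //; last by apply: acder_leN g2; lia.
  by rewrite mulrCA.
have DN j : (0 < j)%N -> (j <= n)%N -> iderive j.-1 (fun y => -1 * im g y) x = - iderive j.-1 (im g) x.
  by move=> j0 jn; rewrite iderive_scale ?mulN1r //; apply: acder_leN g2; lia.
(* Exchanging the summations turns the grouping by j in [real_bracket] back into the double sum of
   the definition. *)
have rE (u v : R -> R) : rbr u v x = \sum_(1 <= k < n.+1) \sum_(1 <= j < k.+1)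
    (-1) ^+ (k + j) * (T k j v * iderive j.-1 u x - T k j u * iderive j.-1 v x).
  rewrite sum_triangle; apply: eq_bigr => j _; rewrite /real_quasi !mulr_suml -sumrB.
  by apply: eq_bigr => k _; rewrite mulrBr !mulrA.
have cT k j h : cderiven (k - j) (fun y => acoef al be C k y * cderiven k h y) x =
    T k j (re h) +i* T k j (im h).
  by rewrite cderivenE re_term im_term.
apply: complex_eq.
  rewrite /Defs.bracket Re_sum /= !rE -big_split /=; apply: eq_big_nat => k /andP[k1 kn].
  rewrite Re_sum -big_split /=; apply: eq_big_nat => j /andP[j1 jk].
  have jn : (j <= n)%N by lia.
  rewrite Re_sign !cT !cderivenE rc ic (TN k j jk j1 kn) (DN j j1 jn).
  rewrite CReD CReN !CReM /= -mulrDr; congr (_ * _).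
  move: (T _ _ _) (T _ _ _) (T _ _ _) (T _ _ _) => t1 t2 t3 t4.
  move: (iderive _ _ _) (iderive _ _ _) (iderive _ _ _) (iderive _ _ _) => u1 u2 u3 u4; ring.
rewrite /Defs.bracket Im_sum /= !rE -sumrB /=; apply: eq_big_nat => k /andP[k1 kn].
rewrite Im_sum -sumrB /=; apply: eq_big_nat => j /andP[j1 jk].
have jn : (j <= n)%N by lia.
rewrite Im_sign !cT !cderivenE rc ic (TN k j jk j1 kn) (DN j j1 jn).
rewrite CImD CImN !CImM /= -mulrBr; congr (_ * _).
move: (T _ _ _) (T _ _ _) (T _ _ _) (T _ _ _) => t1 t2 t3 t4.
move: (iderive _ _ _) (iderive _ _ _) (iderive _ _ _) (iderive _ _ _) => u1 u2 u3 u4; ring.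
Qed.

Lemma quasiE m f x : cacder N f -> -1 < x < 1 -> (n <= m <= N)%N ->
  quasi m f x = Sj (2 * n - m) (re f) x +i* Sj (2 * n - m) (im f) x.
Proof.
move=> [f1 f2] xI /andP[nm mN]; rewrite /Defs.quasi ltnNge nm /=.
(* The recursive clause of [quasi_up] is [derive1_SjS] solved for the next quasi-derivative. *)
have H k : (k < n)%N -> forall y, -1 < y < 1 ->
    re (quasi_up al be C n k f) y = Sj (n - k) (re f) y /\
    im (quasi_up al be C n k f) y = Sj (n - k) (im f) y.
  elim: k => [|k IH] kn y yI.
    rewrite subn0 !Sjn /= -[fun x => _]/(fun y => acoef al be C n y * cderiven n f y).
    by rewrite re_term im_term.
  have jn : (0 < n - k.+1 < n)%N by lia.
  have nk : (n - k)%N = (n - k.+1).+1 by lia.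
  have e1 := derive1_SjS al be C hn jn yI f1; have e2 := derive1_SjS al be C hn jn yI f2.
  have d1 := I_derive1 (fun z zI => (IH (ltnW kn) z zI).1) yI.
  have d2 := I_derive1 (fun z zI => (IH (ltnW kn) z zI).2) yI.
  rewrite nk in d1 d2; rewrite e1 in d1; rewrite e2 in d2.
  split.
    rewrite /re [quasi_up _ _ _ _ _ _]/= CReD CReN Re_cmul cderivenE /=.
    rewrite -[X in _ - X]/(derive1 (re (quasi_up al be C n k f)) y) d1.
    by rewrite opprB addrC subrK.
  rewrite /im [quasi_up _ _ _ _ _ _]/= CImD CImN Im_cmul cderivenE /=.
  rewrite -[X in _ - X]/(derive1 (im (quasi_up al be C n k f)) y) d2.
  by rewrite opprB addrC subrK.
have mn : (m - n < n)%N by lia.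
have [h1 h2] := H (m - n)%N mn x xI.
have -> : (2 * n - m)%N = (n - (m - n))%N by lia.
by apply: complex_eq; [exact: h1|exact: h2].
Qed.

Lemma le_sqr_mul (p c d : R) : 0 <= p -> `|c| <= d -> `|c ^+ 2 * p| <= `|d ^+ 2 * p|.
Proof.
move=> p0 cd; rewrite normrM [leRHS]normrM; apply: ler_wpM2r => //.
rewrite !normrX; apply: lerXn2r; rewrite ?nnegrE //.
by apply: (le_trans cd); exact: ler_norm.
Qed.

Lemma L2ab_L2w f : L2ab al be f <-> L2w al be (re f) /\ L2w al be (im f).
Proof.
have mI : measurable (@jint R : set (measurableTypeR R)) by exact: measurable_itv.
split=> [[m1 m2 i]|[[m1 i1] [m2 i2]]].
  have H (u : R -> R) : measurable_fun (@jint R) u -> (forall x, `|u x| <= cmod (f x)) -> L2w al be u.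
    move=> mu uf; split=> //; apply: (le_integrable mI _ _ i).
      apply/measurable_EFinP; apply: measurable_funM; last exact: measurable_jweight.
      exact: measurable_funX.
    by move=> x _; rewrite /= lee_fin; apply: le_sqr_mul => //; exact: jweight_ge0.
  by split; apply: H => // x; [exact: cmod_ge_re|exact: cmod_ge_im].
split=> //; have := integrableD mI i1 i2; apply: eq_integrable => // x _ /=.
by rewrite -EFinD -mulrDl cmod_sqr.
Qed.

Lemma Dmax_parts f : Dmax al be n f -> [/\ cacder N f, L2w al be (re f) /\ L2w al be (im f) &
  L2w al be (rellk n (re f)) /\ L2w al be (rellk n (im f))].
Proof.
move=> [/L2ab_L2w h1 d ac /L2ab_L2w]; rewrite re_jacobi_pow im_jacobi_pow => h2; split=> //.
have /AC_loc_acI[] := ac N (leqnn _); rewrite re_cderiven im_cderiven => a1 a2.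
split; apply: acder_intro => // k x kN xI; have [d1 d2] := d k x kN xI.
  by rewrite -re_cderiven; exact: d1.
by rewrite -im_cderiven; exact: d2.
Qed.

Lemma parts_Dmax f : (forall m, cacder m f) -> L2w al be (re f) /\ L2w al be (im f) ->
  L2w al be (rellk n (re f)) /\ L2w al be (rellk n (im f)) -> Dmax al be n f.
Proof.
move=> kf h1 h2; split; first exact/L2ab_L2w.
- by move=> k x _ xI; exact: (cacder_cderivable (ltnSn k)).
- move=> k _; apply/AC_loc_acI; rewrite re_cderiven im_cderiven; have [k1 k2] := kf (k + 0)%N.
  by split; [apply: (acder_iderive k1)|apply: (acder_iderive k2)].
- by apply/L2ab_L2w; rewrite re_jacobi_pow im_jacobi_pow.
Qed.

Lemma Dmax_exp b (f : R -> R) : acder N f -> L2w al be (rellk n f) ->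
  exists c d, expands al be n b f c d.
Proof.
move=> Kf hf; have [K HK] := topflux_increment hal hbe b hn Kf hf.
exact: (expansion_Dmax hal hbe hn Kf HK).
Qed.

End Bridge.

(** * The boundary triple *)

Section Families.
Variable R : realType.
Variables (al be : R) (n : nat) (C : nat -> R).
Hypothesis hal : 0 < al < 1.
Hypothesis hbe : 0 < be < 1.
Hypothesis hn : (0 < n)%N.
Hypothesis hC : jacobi_constants al be n C.
(** The two endpoints are bundled by the boolean; v_j is q_(n - j), its exponent being n - j - a. *)
Variables phi v : bool -> nat -> R -> R[i].
Local Notation Q b i := (endpow b (i%:R - endexp al be b)).
Hypothesis hfam : forall b j, (1 <= j <= n)%N ->
  [/\ csmooth (phi b j) /\ csmooth (v b j),
      \forall x \near endfilter b, phi b j x = (endpow b j.-1%:R x)%:C,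
      \forall x \near endfilter b, v b j x = (Q b (n - j)%N x)%:C,
      \forall x \near endfilter (~~ b), phi b j x = 0 &
      \forall x \near endfilter (~~ b), v b j x = 0].
Implicit Types (f g : R -> R[i]) (x y s : R) (b : bool) (d : nat -> R).

Local Notation w := (jweight al be).
Local Notation Sj := (real_quasi al be n C).
Local Notation rbr := (real_bracket al be n C).
Local Notation rellk := (real_pow al be).
Local Notation N := (2 * n).-1.
Local Notation comb b := (endcomb al be b).
Local Notation quasi := (quasi al be C n).
Local Notation bracket := (bracket al be C n).
Local Notation br b := (bracket_at al be C n (endfilter b)).
Local Notation qa b := (quasi_at al be C n (endfilter b)).
Local Notation u b := (ufun (br b) (phi b) (v b)).
Local Notation yk b := (scaled_quasi al be n C b).
Local Notation Mq b := (quasi_endpow_lim al be n C b).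
Local Notation kap b k := (falling b (k.-1%:R : R) k.-1).

Let hCr := jacobi_constants_real hC.

Lemma rbr0 (r : R -> R) x : -1 < x < 1 -> rbr (fun=> 0) r x = 0.
Proof.
move=> xI; have K0 : acder N (fun=> 0 : R) by exact: acder_cst.
have := rbr_lin C hal hbe hn true r (-1) K0 K0 xI.
rewrite (_ : (fun y => 0 + -1 * 0) = (fun=> 0) :> (R -> R)) => [->|]; first by rewrite mulN1r subrr.
by apply/funext => y; rewrite mulr0 addr0.
Qed.

Lemma bracket_near_real b f g (r : R -> R) : cacder N f -> cacder N g ->
  (\forall x \near endfilter b, g x = (r x)%:C) ->
  \forall x \near endfilter b, bracket f g x = rbr (re f) r x +i* rbr (im f) r x.
Proof.
move=> kf kg gr.
have g1 : \forall x \near endfilter b, re g x = r x by apply: filterS gr => x; rewrite /re => ->.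
have g2 : \forall x \near endfilter b, im g x = 0 by apply: filterS gr => x; rewrite /im => ->.
have tr (p : R -> R) : \forall x \near endfilter b, p x = p x by apply: nearW.
near=> x; have xI : -1 < x < 1 by near: x; exact: E_in.
rewrite (bracketE C hal hbe hn kf kg xI).
have -> : rbr (re f) (re g) x = rbr (re f) r x by near: x; apply: E_rbr.
have -> : rbr (im f) (re g) x = rbr (im f) r x by near: x; apply: E_rbr.
have -> : rbr (im f) (im g) x = rbr (im f) (fun=> 0) x by near: x; apply: E_rbr.
have -> : rbr (re f) (im g) x = rbr (re f) (fun=> 0) x by near: x; apply: E_rbr.
by rewrite (rbrC _ _ _ _ (fun=> 0) (im f)) (rbrC _ _ _ _ (fun=> 0) (re f)) !rbr0 // oppr0 addr0 subr0.
Unshelve. all: by end_near. Qed.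

(** Near the endpoint phi_j is t^(j - 1), so [rbr_pow_cvg] evaluates every bracket in the recursion
    for u_k. *)
Lemma bracket_phi b j g d : (1 <= j <= n)%N -> cacder N g ->
  (\forall x \near endfilter b, g x = (\sum_(0 <= i < n) d i * Q b i x)%:C) ->
  br b (phi b j) g = (yk b d j)%:C.
Proof.
move=> jn kg gd; have [[/csmooth_cacder sphi _] phiE _ _ _] := hfam b jn.
have p1 : \forall x \near endfilter b, re (phi b j) x = endpow b j.-1%:R x.
  by apply: filterS phiE => x; rewrite /re => ->.
have p2 : \forall x \near endfilter b, im (phi b j) x = 0 by apply: filterS phiE => x; rewrite /im => ->.
have gc : \forall x \near endfilter b, g x = (comb b (fun=> 0) d n x)%:C.
  by apply: filterS gd => x ->; rewrite comb_q.
have tr (p : R -> R) : \forall x \near endfilter b, p x = p x by apply: nearW.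
have h := bracket_near_real (sphi N) kg gc.
suff H : ccvg_to b (bracket (phi b j) g) (yk b d j)%:C by have [_] := ccvg_toP H.
split=> /=.
  apply: (E_cvg_eq (f := rbr (endpow b j.-1%:R) (comb b (fun=> 0) d n))).
    by apply: filterS2 h (E_rbr al be n C p1 (tr (comb b (fun=> 0) d n))) => x; rewrite /re => -> /= ->.
  have jn' : (j.-1 < n)%N by lia.
  have := @rbr_pow_cvg R al be n C hal hbe hn b j.-1 (comb b (fun=> 0) d n)
    (fun j => \sum_(0 <= i < n) d i * Mq b j i) jn' (endO_comb hal hbe b _ _ _ _).
  rewrite /scaled_quasi prednK; last by case/andP: jn.
  apply=> l /andP[l1 _]; exact: Sj_comb_cvg.
apply: (E_cvg_eq (f := fun=> 0)); last exact: E_cvg_cst.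
near=> x; rewrite /im.
have -> : bracket (phi b j) g x = rbr (re (phi b j)) (comb b (fun=> 0) d n) x +i*
   rbr (im (phi b j)) (comb b (fun=> 0) d n) x by near: x.
rewrite /=; have -> : rbr (im (phi b j)) (comb b (fun=> 0) d n) x =
  rbr (fun=> 0) (comb b (fun=> 0) d n) x by near: x; exact: E_rbr.
by rewrite rbr0 //; near: x; exact: E_in.
Unshelve. all: by end_near. Qed.

(** The coefficients on the left have the shape of the recursion for u_k. *)
Lemma yk_lin b (r : seq nat) (c : nat -> R) d (D : nat -> nat -> R) (s : R) l :
  yk b (fun i => (d i - \sum_(j <- r) c j * D j i) / s) l =
  (yk b d l - \sum_(j <- r) c j * yk b (D j) l) / s.
Proof.
rewrite /scaled_quasi; move: (falling b l.-1%:R l.-1) => K.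
have -> : \sum_(0 <= i < n) (d i - \sum_(j <- r) c j * D j i) / s * Mq b l i =
    (\sum_(0 <= i < n) d i * Mq b l i -
     \sum_(j <- r) c j * \sum_(0 <= i < n) D j i * Mq b l i) / s.
  under [X in (_ - X) / _]eq_bigr do rewrite mulr_sumr.
  rewrite exchange_big /= -sumrB mulr_suml; apply: eq_bigr => i _.
  rewrite mulrAC; congr (_ / s); rewrite mulrBl mulr_suml; congr (_ - _).
  by apply: eq_bigr => j _; rewrite mulrA.
rewrite mulrA mulrBr; congr ((_ - _) / s); rewrite mulr_sumr.
by apply: eq_bigr => j _; rewrite mulrCA.
Qed.

Let del k : nat -> R := fun i => (i == n - k)%N%:R.

Let yk_del b k l : (1 <= k <= n)%N -> yk b (del k) l = kap b l * Mq b l (n - k)%N.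
Proof.
move=> kn; rewrite /scaled_quasi; congr (_ * _).
rewrite (bigD1_seq (n - k)%N) /=; [|by rewrite mem_index_iota; lia|exact: iota_uniq].
rewrite /del eqxx mul1r big1 ?addr0 // => i /negbTE ->; by rewrite mul0r.
Qed.

(** The third clause decouples the two ends. The last one is duality: the scaled limits of the
    quasi-derivatives of u_k form a unit vector. *)
Definition u_spec b k (h : R -> R[i]) d := [/\ forall m, cacder m h,
  \forall x \near endfilter b, h x = (\sum_(0 <= i < n) d i * Q b i x)%:C,
  \forall x \near endfilter (~~ b), h x = 0 &
  forall l, (1 <= l <= n)%N -> yk b d l = (l == k)%:R].

Lemma E_all_seq b (r : seq nat) (P : nat -> R -> Prop) :
  (forall j, j \in r -> \forall x \near endfilter b, P j x) ->
  \forall x \near endfilter b, forall j, j \in r -> P j x.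
Proof.
elim: r => [|j r IH] H; first by apply: nearW => x j; rewrite in_nil.
have Hr : \forall x \near endfilter b, forall i, i \in r -> P i x.
  by apply: IH => i ir; apply: H; rewrite inE ir orbT.
apply: filterS2 (H j (mem_head _ _)) Hr => x h1 h2 i.
by rewrite inE => /predU1P[->|]; [exact: h1|exact: h2].
Qed.

(** The recursion is an elimination: for l < k the subtracted terms cancel the l-th functional, for
    l = k the denominator normalises it, and for l > k it vanishes on v_k by triangularity and on
    the earlier u_j by duality. *)
Lemma u_exists b k : (1 <= k <= n)%N -> exists d, u_spec b k (u b k) d.
Proof.
elim/ltn_ind: k => k IH kn; have k0 : (0 < k)%N by case/andP: kn.
have IH' j : exists d, (1 <= j < k)%N -> u_spec b j (u b j) d.
  have [jk|jk] := boolP (1 <= j < k)%N; last by exists (fun=> 0).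
  have j1 : (j < k)%N by lia.
  have j2 : (1 <= j <= n)%N by lia.
  by have [d hd] := IH j j1 j2; exists d.
have [D HD] := choice IH'.
have [[_ /csmooth_cacder sv] _ vE _ v0] := hfam b kn.
have vd : \forall x \near endfilter b, v b k x = (\sum_(0 <= i < n) del k i * Q b i x)%:C.
  apply: filterS vE => x ->; congr (_ %:C).
  rewrite (bigD1_seq (n - k)%N) /=; [|by rewrite mem_index_iota; lia|exact: iota_uniq].
  by rewrite /del eqxx mul1r big1 ?addr0 // => i /negbTE ->; rewrite mul0r.
have bv j : (1 <= j <= n)%N -> br b (phi b j) (v b k) = (yk b (del k) j)%:C.
  by move=> jn; apply: bracket_phi.
(* Duality for the smaller indices makes the inner denominators equal to 1. *)
have bu j : (1 <= j < k)%N -> br b (phi b j) (u b j) = 1.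
  move=> jk; have jn : (1 <= j <= n)%N by lia.
  have [sj jE _ yj] := HD j jk.
  by rewrite (bracket_phi jn (sj N) jE) yj // eqxx.
pose s := yk b (del k) k.
have s0 : s != 0.
  rewrite /s yk_del // mulf_neq0 ?falling_diag_neq0 //.
  by apply: (Mq_diag hal hbe hn hCr) => //; lia.
pose d i := (del k i - \sum_(1 <= j < k) yk b (del k) j * D j i) / s.
have uE x : u b k x = (v b k x - \sum_(1 <= j < k) (yk b (del k) j)%:C * u b j x) * (s^-1)%:C.
  rewrite (ufunE (br b) (phi b) (v b) k0) (bv k kn) fmorphV /=; congr (_ / _).
  congr (_ - _); apply: eq_big_nat => j jk.
  by rewrite bu // divr1 bv //; lia.
exists d; split.
- move=> m; apply: (cacder_congr (f := fun x => (s^-1)%:C * (v b k x +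
      \sum_(1 <= j < k) (- (yk b (del k) j)%:C) * u b j x))).
    move=> x; rewrite uE [RHS]mulrC; congr (_ * (_ + _)); rewrite -sumrN.
    by apply: eq_bigr => j _; rewrite mulNr.
  apply: cacder_scale; apply: cacder_add => //; apply: cacder_sum => j.
  by rewrite mem_index_iota => jk; apply: cacder_scale; have [+ _ _ _] := HD j jk.
- have h : \forall x \near endfilter b, forall j, j \in index_iota 1 k ->
      u b j x = (\sum_(0 <= i < n) D j i * Q b i x)%:C.
    by apply: E_all_seq => j; rewrite mem_index_iota => jk; have [] := HD j jk.
  apply: filterS2 vd h => x vx ux; rewrite uE vx.
  have -> : \sum_(1 <= j < k) (yk b (del k) j)%:C * u b j x =
      (\sum_(1 <= j < k) yk b (del k) j * \sum_(0 <= i < n) D j i * Q b i x)%:C.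
    rewrite rmorph_sum big_seq [RHS]big_seq; apply: eq_bigr => j jk.
    by rewrite (ux _ jk); apply/esym; exact: rmorphM.
  rewrite -rmorphB -rmorphM; congr (_ %:C).
  under [X in (_ - X) / _]eq_bigr do rewrite mulr_sumr.
  rewrite exchange_big /= -sumrB mulr_suml; apply: eq_bigr => i _.
  rewrite /d mulrAC; congr (_ / s); rewrite mulrBl mulr_suml; congr (_ - _).
  by apply: eq_bigr => j _; rewrite mulrA.
- have h : \forall x \near endfilter (~~ b), forall j, j \in index_iota 1 k -> u b j x = 0.
    by apply: E_all_seq => j; rewrite mem_index_iota => jk; have [] := HD j jk.
  apply: filterS2 v0 h => x vx ux; rewrite uE vx big_seq big1 ?subr0 ?mul0r //.
  by move=> j jk; rewrite ux // mulr0.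
- move=> l ln; rewrite /d yk_lin.
  have -> : \sum_(1 <= j < k) yk b (del k) j * yk b (D j) l =
      \sum_(1 <= j < k) yk b (del k) j * (l == j)%:R.
    by apply: eq_big_nat => j jk; have [_ _ _ ->] := HD j jk.
  have [lk|kl] := ltnP l k.
    rewrite (bigD1_seq l) /=; [|by rewrite mem_index_iota; lia|exact: iota_uniq].
    rewrite eqxx mulr1 big1 ?addr0; last first.
      by move=> j; rewrite eq_sym => /negbTE ->; rewrite mulr0.
    by rewrite subrr mul0r ltn_eqF.
  rewrite big_nat big1 ?subr0; last first.
    by move=> j /andP[_ jk]; rewrite gtn_eqF ?mulr0 // (leq_trans jk).
  have [->|lk] := eqVneq l k; first by rewrite -/s divff.
  rewrite yk_del // Mq_low //; [by rewrite mulr0 mul0r|lia|].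
  by move: lk kl; rewrite neq_ltn => /orP[|]; lia.
Qed.

Let duP : exists dU : bool -> nat -> nat -> R, forall b k, (1 <= k <= n)%N -> u_spec b k (u b k) (dU b k).
Proof.
have H (p : bool * nat) : exists d, (1 <= p.2 <= n)%N -> u_spec p.1 p.2 (u p.1 p.2) d.
  have [kn|kn] := boolP (1 <= p.2 <= n)%N; last by exists (fun=> 0).
  by have [d hd] := u_exists p.1 kn; exists d.
have [D HD] := choice H; exists (fun b k => D (b, k)) => b k kn; exact: (HD (b, k) kn).
Qed.

(** X k is the coefficient of t^(k - 1), which will be [f, u_k]; Y k is the limit of the
    quasi-derivative of order 2n - k. *)
Definition endpoint_values f b (X Y : nat -> R[i]) := exists c1 d1 c2 d2,
  [/\ expands al be n b (re f) c1 d1, expands al be n b (im f) c2 d2,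
      forall k, (1 <= k <= n)%N -> X k = c1 k.-1 +i* c2 k.-1 &
      forall k, (1 <= k <= n)%N -> Y k = (\sum_(0 <= i < n) d1 i * Mq b k i) +i* (\sum_(0 <= i < n) d2 i * Mq b k i)].

Lemma Dmax_endpoint_values f b : Dmax al be n f -> exists X Y, endpoint_values f b X Y.
Proof.
move=> /Dmax_parts[[k1 k2] _ [l1 l2]].
have [c1 [d1 h1]] := Dmax_exp hal hbe hn b k1 l1.
have [c2 [d2 h2]] := Dmax_exp hal hbe hn b k2 l2.
by exists (fun k => c1 k.-1 +i* c2 k.-1); eexists; exists c1, d1, c2, d2; split.
Qed.

Lemma quasi_cvg f b X Y m : cacder N f -> endpoint_values f b X Y -> (n <= m <= N)%N ->
  ccvg_to b (quasi m f) (Y (2 * n - m)%N).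
Proof.
move=> kf [c1 [d1 [c2 [d2 [h1 h2 _ yE]]]]] mn; have [k1 k2] := kf.
have jn : (1 <= 2 * n - m <= n)%N by lia.
apply: (ccvg_to_near (f := fun x => Sj (2 * n - m) (re f) x +i* Sj (2 * n - m) (im f) x)).
  by apply: nearI => z zI; rewrite (quasiE C hal hbe hn kf zI mn).
rewrite yE //; split; rewrite /re /im /=.
  exact: (Sj_exp_cvg hal hbe hn k1 h1 jn).
exact: (Sj_exp_cvg hal hbe hn k2 h2 jn).
Qed.

Lemma bracket_u_cvg f b X Y k : cacder N f -> endpoint_values f b X Y -> (1 <= k <= n)%N ->
  ccvg_to b (bracket f (u b k)) (X k).
Proof.
move=> kf [c1 [d1 [c2 [d2 [h1 h2 xE _]]]]] kn; have [k1 k2] := kf.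
have [dU HU] := duP; have [su uE _ _] := HU b k kn.
have hU j l : (1 <= j <= n)%N -> (1 <= l <= n)%N -> yk b (dU b l) j = (j == l)%:R.
  by move=> jn ln; have [_ _ _ ->] := HU b l ln.
have uc : \forall z \near endfilter b, u b k z = (comb b (fun=> 0) (dU b k) n z)%:C.
  by apply: filterS uE => z ->; rewrite comb_q.
have h := bracket_near_real kf (su N) uc.
apply: (ccvg_to_near (f := fun z => rbr (re f) (comb b (fun=> 0) (dU b k) n) z +i*
    rbr (im f) (comb b (fun=> 0) (dU b k) n) z)).
  by apply: filterS h => z ->.
rewrite xE //; split; rewrite /re /im /=.
  exact: (rbr_fU_cvg hal hbe hn hCr hU k1 h1 kn).
exact: (rbr_fU_cvg hal hbe hn hCr hU k2 h2 kn).
Qed.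

Let hUex b : exists dU : nat -> nat -> R, forall j k, (1 <= j <= n)%N -> (1 <= k <= n)%N ->
  kap b j * \sum_(0 <= i < n) dU k i * Mq b j i = (j == k)%:R.
Proof.
have [dU HU] := duP; exists (dU b) => j k jn kn.
by have [_ _ _ H] := HU b k kn; exact: H.
Qed.

(** The second part exports the limits of the four real brackets, from which Green's formula is
    assembled. *)
Lemma bracket_cvg f g b X Y X' Y' : cacder N f -> cacder N g -> endpoint_values f b X Y -> endpoint_values g b X' Y' ->
  ccvg_to b (bracket f g) (\sum_(1 <= k < n.+1) (kap b k)%:C *
    (X k * (Y' k)^*%C - Y k * (X' k)^*%C)) /\
  forall p r : R -> R, (p = re f \/ p = im f) -> (r = re g \/ r = im g) ->
    exists L : R, rbr p r @ endfilter b --> L.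
Proof.
move=> kf kg; have [k1 k2] := kf; have [k1' k2'] := kg.
move=> [c1 [d1 [c2 [d2 [h1 h2 xE yE]]]]] [c1' [d1' [c2' [d2' [h1' h2' xE' yE']]]]].
have [dU hU] := hUex b.
have e11 := @rbr_cvg _ _ _ _ _ hal hbe hn hCr b dU hU _ _ _ _ _ _ k1 k1' h1 h1'.
have e12 := @rbr_cvg _ _ _ _ _ hal hbe hn hCr b dU hU _ _ _ _ _ _ k1 k2' h1 h2'.
have e21 := @rbr_cvg _ _ _ _ _ hal hbe hn hCr b dU hU _ _ _ _ _ _ k2 k1' h2 h1'.
have e22 := @rbr_cvg _ _ _ _ _ hal hbe hn hCr b dU hU _ _ _ _ _ _ k2 k2' h2 h2'.
split; last first.
  by move=> p r [->|->] [->|->]; eexists; [exact: e11|exact: e12|exact: e21|exact: e22].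
apply: (ccvg_to_near (f := fun z => (rbr (re f) (re g) z + rbr (im f) (im g) z) +i*
                  (rbr (im f) (re g) z - rbr (re f) (im g) z))).
  by apply: nearI => z zI; rewrite (bracketE C hal hbe hn kf kg zI).
split; rewrite /re /im /=.
  have -> : complex.Re (\sum_(1 <= k < n.+1) (kap b k)%:C * (X k * (Y' k)^*%C - Y k * (X' k)^*%C)) =
      \sum_(1 <= k < n.+1) (c1 k.-1 * yk b d1' k - yk b d1 k * c1' k.-1) +
      \sum_(1 <= k < n.+1) (c2 k.-1 * yk b d2' k - yk b d2 k * c2' k.-1).
    rewrite Re_sum -big_split /=; apply: eq_big_nat => k kn.
    rewrite Re_cmul (xE k kn) (yE k kn) (xE' k kn) (yE' k kn) /scaled_quasi /=.
    move: (falling b k.-1%:R k.-1) (\sum_(0 <= i < n) _) (\sum_(0 <= i < n) _)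
      (\sum_(0 <= i < n) _) (\sum_(0 <= i < n) _) => K A B A' B'; ring.
  exact: (cvgD e11 e22).
have -> : complex.Im (\sum_(1 <= k < n.+1) (kap b k)%:C * (X k * (Y' k)^*%C - Y k * (X' k)^*%C)) =
    \sum_(1 <= k < n.+1) (c2 k.-1 * yk b d1' k - yk b d2 k * c1' k.-1) -
    \sum_(1 <= k < n.+1) (c1 k.-1 * yk b d2' k - yk b d1 k * c2' k.-1).
  rewrite Im_sum -sumrB /=; apply: eq_big_nat => k kn.
  rewrite Im_cmul (xE k kn) (yE k kn) (xE' k kn) (yE' k kn) /scaled_quasi /=.
  move: (falling b k.-1%:R k.-1) (\sum_(0 <= i < n) _) (\sum_(0 <= i < n) _)
    (\sum_(0 <= i < n) _) (\sum_(0 <= i < n) _) => K A B A' B'; ring.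
exact: (cvgB e21 e12).
Qed.


Lemma cx_lin (T : (R -> R) -> R) K f g (a : R[i]) :
  (forall (p r : R -> R) (c : R), acder K p -> acder K r -> T (fun y => p y + c * r y) = T p + c * T r) ->
  cacder K f -> cacder K g ->
  T (re (fun x => a * f x + g x)) +i* T (im (fun x => a * f x + g x)) =
  a * (T (re f) +i* T (im f)) + (T (re g) +i* T (im g)).
Proof.
move=> Tlin [f1 f2] [g1 g2].
have -> : re (fun x => a * f x + g x) =
    (fun x => (re g x + complex.Re a * re f x) + (- complex.Im a) * im f x).
  by apply/funext => x; rewrite /re /im CReD CReM mulNr addrC addrA.
have -> : im (fun x => a * f x + g x) =
    (fun x => (im g x + complex.Re a * im f x) + complex.Im a * re f x).
  by apply/funext => x; rewrite /re /im CImD CImM addrC addrA.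
rewrite !Tlin //; try by apply: acder_add => //; exact: acder_scale.
apply: complex_eq; rewrite ?CReD ?CImD ?CReM ?CImM /=.
  by move: (T _) (T _) (T _) => A B D; ring.
by move: (T _) (T _) (T _) => A B D; ring.
Qed.

Lemma quasi_at_lin (a : R[i]) f g b m : Dmax al be n f -> Dmax al be n g -> (n <= m <= N)%N ->
  qa b m (fun x => a * f x + g x) = a * qa b m f + qa b m g.
Proof.
move=> df dg mn; have [kf _ _] := Dmax_parts df; have [kg _ _] := Dmax_parts dg.
have [X [Y hf]] := Dmax_endpoint_values b df; have [X' [Y' hg]] := Dmax_endpoint_values b dg.
have cf := quasi_cvg kf hf mn; have cg := quasi_cvg kg hg mn.
have kl : cacder N (fun x => a * f x + g x) by apply: cacder_add => //; exact: cacder_scale.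
rewrite /quasi_at; have [_ ->] := ccvg_toP cf; have [_ ->] := ccvg_toP cg.
suff H : ccvg_to b (quasi m (fun x => a * f x + g x)) (a * Y (2 * n - m)%N + Y' (2 * n - m)%N).
  by have [_] := ccvg_toP H.
apply: ccvg_to_near (ccvg_to_lin a cf cg); apply: nearI => x xI.
rewrite !(quasiE C hal hbe hn _ xI mn) //; apply/esym.
have m1 : (1 <= 2 * n - m)%N by lia.
apply: (@cx_lin (fun p => Sj (2 * n - m) p x) N) => // p r c Kp Kr.
by apply: (Sj_lin al be C hn c _ _ xI); [apply: acder_leN Kp|apply: acder_leN Kr]; lia.
Qed.

Lemma bracket_at_lin (a : R[i]) f g b k : Dmax al be n f -> Dmax al be n g -> (1 <= k <= n)%N ->
  br b (fun x => a * f x + g x) (u b k) = a * br b f (u b k) + br b g (u b k).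
Proof.
move=> df dg kn; have [kf _ _] := Dmax_parts df; have [kg _ _] := Dmax_parts dg.
have [X [Y hf]] := Dmax_endpoint_values b df; have [X' [Y' hg]] := Dmax_endpoint_values b dg.
have cf := bracket_u_cvg kf hf kn; have cg := bracket_u_cvg kg hg kn.
have kl : cacder N (fun x => a * f x + g x) by apply: cacder_add => //; exact: cacder_scale.
rewrite /bracket_at.
have [_ ->] := ccvg_toP cf; have [_ ->] := ccvg_toP cg.
suff H : ccvg_to b (bracket (fun x => a * f x + g x) (u b k)) (a * X k + X' k).
  by have [_] := ccvg_toP H.
apply: ccvg_to_near (ccvg_to_lin a cf cg).
have [d [su uE _ _]] := u_exists b kn.
have h1 := bracket_near_real kf (su N) uE; have h2 := bracket_near_real kg (su N) uE.
have h3 := bracket_near_real kl (su N) uE.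
near=> x; have xI : -1 < x < 1 by near: x; exact: E_in.
have -> : bracket f (u b k) x = rbr (re f) (fun x => \sum_(0 <= i < n) d i * Q b i x) x +i*
    rbr (im f) (fun x => \sum_(0 <= i < n) d i * Q b i x) x by near: x.
have -> : bracket g (u b k) x = rbr (re g) (fun x => \sum_(0 <= i < n) d i * Q b i x) x +i*
    rbr (im g) (fun x => \sum_(0 <= i < n) d i * Q b i x) x by near: x.
have -> : bracket (fun x => a * f x + g x) (u b k) x =
    rbr (re (fun x => a * f x + g x)) (fun x => \sum_(0 <= i < n) d i * Q b i x) x +i*
    rbr (im (fun x => a * f x + g x)) (fun x => \sum_(0 <= i < n) d i * Q b i x) x by near: x.
apply/esym; apply: (@cx_lin (fun p => rbr p (fun x => \sum_(0 <= i < n) d i * Q b i x) x) N) => //.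
by move=> p r c Kp Kr; exact: (rbr_lin C hal hbe hn b _ _ Kp Kr xI).
Unshelve. all: by end_near. Qed.

Lemma E_rellk b k (p r : R -> R) : (\forall x \near endfilter b, p x = r x) ->
  \forall x \near endfilter b, rellk k p x = rellk k r x.
Proof.
elim: k => // k IH /IH h; rewrite /real_pow !iterS.
have h1 : \forall x \near endfilter b, real_flux al be (iter k (real_expr al be) p) x =
    real_flux al be (iter k (real_expr al be) r) x.
  by apply: filterS (E_derive1 h) => x; rewrite /real_flux => ->.
by apply: filterS (E_derive1 h1) => x; rewrite /real_expr => ->.
Qed.

(** ell^n maps combinations of the t^i and q_i to such combinations, so p and ell^n p are both
    O(t^(-a)) at each end. *)
Lemma L2w_near_comb (p : R -> R) : (forall m, acder m p) ->
  (forall b, exists c d, \forall x \near endfilter b, p x = comb b c d n x) ->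
  L2w al be p /\ L2w al be (rellk n p).
Proof.
move=> Kp H; split; apply: (L2w_endO hal hbe).
- exact: Kp.
- move=> b; have [c [d h]] := H b; apply: endO_congr (endO_comb hal hbe b c d n 0).
  by apply: filterS h => x ->.
- by apply: (acder_rellk al be hn); exact: Kp.
- move=> b; have [c [d h]] := H b; have [c' [d' h']] := rellk_comb_ex al be b n c d n.
  apply: endO_congr (endO_comb hal hbe b c' d' n 0).
  have hI : \forall x \near endfilter b, rellk n (comb b c d n) x = comb b c' d' n x by apply: nearI.
  by apply: filterS2 (E_rellk n h) hI => x -> ->.
Qed.

Lemma boundary_onto (X Y : bool -> nat -> R[i]) : exists f, Dmax al be n f /\
  forall b k, (1 <= k <= n)%N -> br b f (u b k) = X b k /\ qa b (2 * n - k) f = Y b k.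
Proof.
have [dU HU] := duP.
(* phi_k carries the regular coefficients and u_k the quasi-derivatives; [kap] undoes the scaling in
   the duality. Each [F b] vanishes near the opposite endpoint, so the data at the two ends do not
   interact. *)
pose F b x := \sum_(1 <= k < n.+1) X b k * phi b k x +
              \sum_(1 <= k < n.+1) (kap b k)%:C * Y b k * u b k x.
pose f x := F false x + F true x.
have kF b m : cacder m (F b).
  apply: cacder_add; apply: cacder_sum => k; rewrite mem_index_iota => kn; apply: cacder_scale.
    by have [[/csmooth_cacder H _] _ _ _ _] := hfam b kn; exact: H.
  by have [H _ _ _] := HU b k kn; exact: H.
have kf m : cacder m f by apply: cacder_add; exact: kF.
have F0 b : \forall x \near endfilter (~~ b), F b x = 0.
  have h1 : \forall x \near endfilter (~~ b), forall k, k \in index_iota 1 n.+1 -> phi b k x = 0.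
    by apply: E_all_seq => k; rewrite mem_index_iota => kn; have [] := hfam b kn.
  have h2 : \forall x \near endfilter (~~ b), forall k, k \in index_iota 1 n.+1 -> u b k x = 0.
    by apply: E_all_seq => k; rewrite mem_index_iota => kn; have [] := HU b k kn.
  apply: filterS2 h1 h2 => x h1 h2; rewrite /F.
  by rewrite big_seq big1 ?add0r => [|k kn]; [rewrite big_seq big1 // => k kn|]; rewrite ?h1 ?h2 ?mulr0.
pose cc (P : R[i] -> R) b i := P (X b i.+1).
pose dd (P : R[i] -> R) b i := \sum_(1 <= k < n.+1) kap b k * P (Y b k) * dU b k i.
have FE b : \forall x \near endfilter b, f x =
    comb b (cc (@complex.Re R) b) (dd (@complex.Re R) b) n x +i*
    comb b (cc (@complex.Im R) b) (dd (@complex.Im R) b) n x.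
  have h1 : \forall x \near endfilter b, forall k, k \in index_iota 1 n.+1 -> phi b k x = (endpow b k.-1%:R x)%:C.
    by apply: E_all_seq => k; rewrite mem_index_iota => kn; have [] := hfam b kn.
  have h2 : \forall x \near endfilter b, forall k, k \in index_iota 1 n.+1 ->
      u b k x = (\sum_(0 <= i < n) dU b k i * Q b i x)%:C.
    by apply: E_all_seq => k; rewrite mem_index_iota => kn; have [] := HU b k kn.
  have h3 : \forall x \near endfilter b, f x = F b x.
    have := F0 (~~ b); rewrite negbK; apply: filterS => x; rewrite /f.
    by case: (b) => /= ->; rewrite ?add0r ?addr0.
  have comm (P : R[i] -> R) x : comb b (cc P b) (dd P b) n x =
      \sum_(1 <= k < n.+1) P (X b k) * endpow b k.-1%:R x +
      \sum_(1 <= k < n.+1) kap b k * P (Y b k) * \sum_(0 <= i < n) dU b k i * Q b i x.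
    rewrite /endcomb; congr (_ + _); first by rewrite big_add1.
    under [RHS]eq_bigr do rewrite mulr_sumr.
    rewrite exchange_big /=; apply: eq_bigr => i _; rewrite /dd mulr_suml.
    by apply: eq_bigr => k _; rewrite -mulrA.
  near=> x.
  have e1 : forall k, k \in index_iota 1 n.+1 -> phi b k x = (endpow b k.-1%:R x)%:C by near: x.
  have e2 : forall k, k \in index_iota 1 n.+1 ->
      u b k x = (\sum_(0 <= i < n) dU b k i * Q b i x)%:C by near: x.
  have -> : f x = F b x by near: x.
  apply: complex_eq; rewrite /F !comm.
    rewrite CReD !Re_sum /=; congr (_ + _); rewrite big_seq [RHS]big_seq; apply: eq_bigr => k kn.
      by rewrite e1 // mulrC Re_cmul mulrC.
    by rewrite e2 // -mulrA Re_cmul mulrC [in LHS]mulrC mulrC [Y b k * _]mulrC Re_cmul mulrC -mulrA [_ * complex.Re _]mulrC mulrA.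
  rewrite CImD !Im_sum /=; congr (_ + _); rewrite big_seq [RHS]big_seq; apply: eq_bigr => k kn.
    by rewrite e1 // mulrC Im_cmul mulrC.
  by rewrite e2 // -mulrA Im_cmul mulrC [in LHS]mulrC mulrC [Y b k * _]mulrC Im_cmul mulrC -mulrA [_ * complex.Im _]mulrC mulrA.
have re_f b : \forall x \near endfilter b, re f x = comb b (cc (@complex.Re R) b) (dd (@complex.Re R) b) n x.
  by apply: filterS (FE b) => x; rewrite /re => ->.
have im_f b : \forall x \near endfilter b, im f x = comb b (cc (@complex.Im R) b) (dd (@complex.Im R) b) n x.
  by apply: filterS (FE b) => x; rewrite /im => ->.
have [r1 r2] : L2w al be (re f) /\ L2w al be (rellk n (re f)).
  apply: L2w_near_comb => [m|b]; first by have [] := kf m.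
  by eexists; eexists; exact: re_f.
have [i1 i2] : L2w al be (im f) /\ L2w al be (rellk n (im f)).
  apply: L2w_near_comb => [m|b]; first by have [] := kf m.
  by eexists; eexists; exact: im_f.
exists f; split; first exact: parts_Dmax.
move=> b k kn.
have yE' (P : R[i] -> R) k' : (1 <= k' <= n)%N -> \sum_(0 <= i < n) dd P b i * Mq b k' i = P (Y b k').
  move: k' => {}k {}kn.
  apply: (mulfI (falling_diag_neq0 R b k.-1)).
  have -> : \sum_(0 <= i < n) dd P b i * Mq b k i =
      \sum_(1 <= l < n.+1) kap b l * P (Y b l) * \sum_(0 <= i < n) dU b l i * Mq b k i.
    under [RHS]eq_bigr do rewrite mulr_sumr.
    rewrite exchange_big /=; apply: eq_bigr => i _; rewrite /dd mulr_suml.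
    by apply: eq_bigr => l _; rewrite -mulrA.
  rewrite mulr_sumr (bigD1_seq k) /=; [|by rewrite mem_index_iota|exact: iota_uniq].
  have yd l : (1 <= l <= n)%N -> kap b k * \sum_(0 <= i < n) dU b l i * Mq b k i = (k == l)%:R.
    by move=> ln; have [_ _ _ H] := HU b l ln; exact: H.
  rewrite mulrCA yd // eqxx mulr1 big_seq_cond big1 ?addr0 // => l.
  rewrite mem_index_iota ltnS => /andP[ln lk].
  by rewrite mulrCA yd // eq_sym (negbTE lk) mulr0.
have sf : endpoint_values f b (X b) (Y b).
  exists (cc (@complex.Re R) b), (dd (@complex.Re R) b), (cc (@complex.Im R) b), (dd (@complex.Im R) b).
  split.
  - apply: endO_congr (endO_zero b 1 _ _).
    by apply: filterS (re_f b) => x ->; rewrite subrr.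
  - apply: endO_congr (endO_zero b 1 _ _).
    by apply: filterS (im_f b) => x ->; rewrite subrr.
  - by move=> l /andP[l0 _]; rewrite /cc prednK //; case: (X b l).
  - by move=> l ln; rewrite !yE' //; case: (Y b l).
have [_ e1] := ccvg_toP (bracket_u_cvg (kf N) sf kn).
have kn' : (n <= 2 * n - k <= N)%N by lia.
have [_ e2] := ccvg_toP (quasi_cvg (kf N) sf kn').
split; first exact: e1.
by move: e2; rewrite /quasi_at => ->; congr (Y b _); lia.
Unshelve. all: by end_near. Qed.

Local Notation leb := (@lebesgue_measure R).
Local Notation J p r := (\int[leb]_(x in @jint R) (w x * (p x * r x))).

Lemma inner_abE f g : L2w al be (re f) /\ L2w al be (im f) -> L2w al be (re g) /\ L2w al be (im g) ->
  inner_ab al be f g = (J (re f) (re g) + J (im f) (im g)) +i* (J (im f) (re g) - J (re f) (im g)).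
Proof.
move=> [f1 f2] [g1 g2].
have mI : measurable (@jint R : set (measurableTypeR R)) by exact: measurable_itv.
have i11 := integrable_prod f1 g1; have i12 := integrable_prod f1 g2.
have i21 := integrable_prod f2 g1; have i22 := integrable_prod f2 g2.
apply: complex_eq; rewrite /inner_ab /cintegral /=.
  rewrite -RintegralD //; apply: eq_Rintegral => x _.
  rewrite mulrC Re_cmul CReM -mulrDr /re /im; congr (_ * _).
  by case: (f x); case: (g x) => p q p' q' /=; rewrite mulrN opprK.
rewrite -RintegralB //; apply: eq_Rintegral => x _.
rewrite mulrC Im_cmul CImM -mulrBr /re /im; congr (_ * _).
by case: (f x); case: (g x) => p q p' q' /=; rewrite mulrN addrC.
Qed.

Lemma bracket_at_real f g b (L11 L12 L21 L22 : R) : cacder N f -> cacder N g ->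
  rbr (re f) (re g) @ endfilter b --> L11 -> rbr (re f) (im g) @ endfilter b --> L12 ->
  rbr (im f) (re g) @ endfilter b --> L21 -> rbr (im f) (im g) @ endfilter b --> L22 ->
  br b f g = (L11 + L22) +i* (L21 - L12).
Proof.
move=> kf kg h11 h12 h21 h22.
suff H : ccvg_to b (bracket f g) ((L11 + L22) +i* (L21 - L12)) by have [_] := ccvg_toP H.
apply: (ccvg_to_near (f := fun z => (rbr (re f) (re g) z + rbr (im f) (im g) z) +i*
                  (rbr (im f) (re g) z - rbr (re f) (im g) z))).
  by apply: nearI => z zI; rewrite (bracketE C hal hbe hn kf kg zI).
by split; rewrite /re /im /=; [exact: (cvgD h11 h22)|exact: (cvgB h21 h12)].
Qed.

Lemma green f g : Dmax al be n f -> Dmax al be n g ->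
  inner_ab al be (jacobi_pow al be n f) g - inner_ab al be f (jacobi_pow al be n g) =
  br false f g - br true f g.
Proof.
move=> df dg; have [kf lf lff] := Dmax_parts df; have [kg lg lgg] := Dmax_parts dg.
have [k1 k2] := kf; have [k1' k2'] := kg.
have [f1 f2] := lf; have [f1' f2'] := lff; have [g1 g2] := lg; have [g1' g2'] := lgg.
have lims b : forall p r : R -> R, (p = re f \/ p = im f) -> (r = re g \/ r = im g) ->
    exists L : R, rbr p r @ endfilter b --> L.
  have [X [Y hf]] := Dmax_endpoint_values b df; have [X' [Y' hg]] := Dmax_endpoint_values b dg.
  by have [_] := bracket_cvg kf kg hf hg.
have [||A11 a11] := lims false (re f) (re g); [by left|by left|].
have [||A12 a12] := lims false (re f) (im g); [by left|by right|].
have [||A21 a21] := lims false (im f) (re g); [by right|by left|].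
have [||A22 a22] := lims false (im f) (im g); [by right|by right|].
have [||B11 b11] := lims true (re f) (re g); [by left|by left|].
have [||B12 b12] := lims true (re f) (im g); [by left|by right|].
have [||B21 b21] := lims true (im f) (re g); [by right|by left|].
have [||B22 b22] := lims true (im f) (im g); [by right|by right|].
rewrite (bracket_at_real kf kg a11 a12 a21 a22) (bracket_at_real kf kg b11 b12 b21 b22).
have e11 := real_green hn hCr k1 k1' f1 g1 f1' g1' a11 b11.
have e12 := real_green hn hCr k1 k2' f1 g2 f1' g2' a12 b12.
have e21 := real_green hn hCr k2 k1' f2 g1 f2' g1' a21 b21.
have e22 := real_green hn hCr k2 k2' f2 g2 f2' g2' a22 b22.
rewrite !inner_abE ?re_jacobi_pow ?im_jacobi_pow //.
apply: complex_eq; rewrite ?CReD ?CImD ?CReN ?CImN /=.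
  move: e11 e22; do 4 move: (Rintegral _ _ _); move=> *; lra.
move: e12 e21; do 4 move: (Rintegral _ _ _); move=> *; lra.
Qed.

Lemma bracket_at_pairing f g b : Dmax al be n f -> Dmax al be n g ->
  ccvg (endfilter b) (bracket f g) /\
  br b f g = \sum_(1 <= k < n.+1) (kap b k)%:C *
    (br b f (u b k) * (qa b (2 * n - k) g)^*%C - qa b (2 * n - k) f * (br b g (u b k))^*%C).
Proof.
move=> df dg; have [kf _ _] := Dmax_parts df; have [kg _ _] := Dmax_parts dg.
have [X [Y hf]] := Dmax_endpoint_values b df; have [X' [Y' hg]] := Dmax_endpoint_values b dg.
have [h _] := bracket_cvg kf kg hf hg; have [c1 e] := ccvg_toP h.
split=> //; rewrite [LHS]e; apply: eq_big_nat => k kn.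
have mn : (n <= 2 * n - k <= N)%N by lia.
have kE : (2 * n - (2 * n - k))%N = k by lia.
have [_ e1] := ccvg_toP (bracket_u_cvg kf hf kn); have [_ e2] := ccvg_toP (bracket_u_cvg kg hg kn).
have [_ e3] := ccvg_toP (quasi_cvg kf hf mn); have [_ e4] := ccvg_toP (quasi_cvg kg hg mn).
by rewrite /bracket_at /quasi_at e1 e2 e3 e4 kE.
Qed.

Lemma quasi_ccvg f b m : Dmax al be n f -> (n <= m <= N)%N -> ccvg (endfilter b) (quasi m f).
Proof.
move=> df mn; have [kf _ _] := Dmax_parts df; have [X [Y hf]] := Dmax_endpoint_values b df.
by have [] := ccvg_toP (quasi_cvg kf hf mn).
Qed.

Lemma bracket_u_ccvg f b k : Dmax al be n f -> (1 <= k <= n)%N -> ccvg (endfilter b) (bracket f (u b k)).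
Proof.
move=> df kn; have [kf _ _] := Dmax_parts df; have [X [Y hf]] := Dmax_endpoint_values b df.
by have [] := ccvg_toP (bracket_u_cvg kf hf kn).
Qed.

End Families.

Lemma sum_ord_rev (T : zmodType) n (F : nat -> T) :
  \sum_(1 <= k < n.+1) F k = \sum_(i < n) F (n - i)%N.
Proof.
rewrite big_nat_rev big_add1 big_mkord /=; apply: eq_bigr => i _.
by congr F; have := ltn_ord i; lia.
Qed.

Theorem theorem4p13 (R : realType) (al be : R) (n : nat)
    (hal : 0 < al < 1) (hbe : 0 < be < 1) (hn : (0 < n)%N)
    (C : nat -> R) (hC : jacobi_constants al be n C)
    (phip vp phim vm : nat -> R -> R[i])
    (hp : endpoint_family_p al n phip vp)
    (hm : endpoint_family_m be n phim vm) :
  let D := Dmax al be n in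
  let ell := jacobi_pow al be n in
  let brp := bracket_at al be C n (1 : R)^'- in
  let brm := bracket_at al be C n (-1 : R)^'+ in
  let up := ufun brp phip vp in
  let um := ufun brm phim vm in
  let G0 := Gamma0 al be C n in
  let G1 := Gamma1 al be C n up um in
  [/\ (* the limits defining G0, G1 and the brackets exist *)
      (forall f : R -> R[i], D f ->
         (forall m : nat, (n <= m <= (2 * n).-1)%N ->
            ccvg (1 : R)^'- (quasi al be C n m f) /\
            ccvg (-1 : R)^'+ (quasi al be C n m f)) /\
         (forall j : nat, (1 <= j <= n)%N ->
            ccvg (1 : R)^'- (bracket al be C n f (up j)) /\
            ccvg (-1 : R)^'+ (bracket al be C n f (um j)))) /\
      (forall f g : R -> R[i], D f -> D g ->
         ccvg (1 : R)^'- (bracket al be C n f g) /\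
         ccvg (-1 : R)^'+ (bracket al be C n f g)),
      (* G0 and G1 are linear *)
      (forall (a : R[i]) (f g : R -> R[i]), D f -> D g ->
         G0 (fun x => a * f x + g x) = a *: G0 f + G0 g /\
         G1 (fun x => a * f x + g x) = a *: G1 f + G1 g),
      (* surjectivity *)
      (forall z0 z1 : 'cV[R[i]]_(n + n),
         exists f : R -> R[i], [/\ D f, G0 f = z0 & G1 f = z1]) &
      (* abstract Green identity *)
      (forall f g : R -> R[i], D f -> D g ->
         inner_ab al be (ell f) g - inner_ab al be f (ell g)
           = brp f g - brm f g /\
         brp f g - brm f g = cdot (G1 f) (G0 g) - cdot (G0 f) (G1 g))].
Proof.
move=> D ell brp brm up um G0 G1.
pose phi b := if b then phim else phip; pose v b := if b then vm else vp.
have hfam b j : (1 <= j <= n)%N ->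
    [/\ csmooth (phi b j) /\ csmooth (v b j),
      \forall x \near endfilter b, phi b j x = (endpow b j.-1%:R x)%:C,
      \forall x \near endfilter b, v b j x = (endpow b ((n - j)%:R - endexp al be b) x)%:C,
      \forall x \near endfilter (~~ b), phi b j x = 0 &
      \forall x \near endfilter (~~ b), v b j x = 0].
  move=> jn; have njE : (n - j)%:R = n%:R - j%:R :> R by rewrite natrB //; case/andP: jn.
  case: b => /=; [have [h1 h2 h3 h4 h5] := hm j jn|have [h1 h2 h3 h4 h5] := hp j jn];
    rewrite E_left E_right; split=> //; rewrite -?E_left -?E_right in h2 h3 *.
  - apply: filterS2 (E_t R true) h2 => x t0 ->; congr (_ %:C).
    by rewrite /endpow powR_mulrn ?ltW // /endvar /endsign expr1 mulN1r opprK.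
  - apply: filterS h3 => x ->; congr (_ %:C).
    by rewrite /endpow /endvar /endsign expr1 mulN1r opprK njE /endexp; congr (_ `^ _); ring.
  - apply: filterS2 (E_t R false) h2 => x t0 ->; congr (_ %:C).
    by rewrite /endpow powR_mulrn ?ltW // /endvar /endsign expr0 mul1r.
  - apply: filterS h3 => x ->; congr (_ %:C).
    by rewrite /endpow /endvar /endsign expr0 mul1r njE /endexp; congr (_ `^ _); ring.
pose br b := bracket_at al be C n (endfilter b); pose u b := ufun (br b) (phi b) (v b).
pose qa b := quasi_at al be C n (endfilter b).
pose kap b k : R[i] := (falling b (k.-1%:R : R) k.-1)%:C.
have upE : up = u false by rewrite /up /u /brp /br E_left.
have umE : um = u true by rewrite /um /u /brm /br E_right.
have brpE : brp = br false by rewrite /brp /br E_left.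
have brmE : brm = br true by rewrite /brm /br E_right.
(* Entry i of each half belongs to k = n - i: the quasi-derivative has order n + i = 2n - k, and the
   matching value f^{k - 1} is [kap] times [f, u_k]. *)
have cpE f (i : 'I_n) : curly_p al be C n up (n - i.+1) f = kap false (n - i)%N * br false f (u false (n - i)%N).
  rewrite /curly_p -/(brp f _) upE brpE (subnSK (ltn_ord i)) /kap falling_diag /endsign expr0 subnS.
  congr (_ * _); rewrite rmorphM rmorphXn rmorphN rmorph1 rmorph_nat //.
have cmE f (i : 'I_n) : curly_m al be C n um (n - i.+1) f = kap true (n - i)%N * br true f (u true (n - i)%N).
  rewrite /curly_m -/(brm f _) umE brmE (subnSK (ltn_ord i)) /kap falling_diag /endsign expr1 opprK expr1n mul1r subnS.
  by congr (_ * _); rewrite rmorph_nat.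
have qE b f (i : 'I_n) : qa b (n + i)%N f = qa b (2 * n - (n - i))%N f.
  by congr (qa b _ f); have := ltn_ord i; lia.
have G0E f : G0 f = col_mx (\col_(i < n) - qa true (2 * n - (n - i))%N f)
                           (\col_(i < n) qa false (2 * n - (n - i))%N f).
  rewrite /G0 /Gamma0 -(E_left R) -(E_right R); congr col_mx; apply/colP => i; rewrite !mxE.
    by rewrite -qE.
  by rewrite -qE.
have G1E f : G1 f = col_mx (\col_(i < n) (kap true (n - i)%N * br true f (u true (n - i)%N)))
                           (\col_(i < n) (kap false (n - i)%N * br false f (u false (n - i)%N))).
  by rewrite /G1 /Gamma1; congr col_mx; apply/colP => i; rewrite !mxE ?cmE ?cpE.
have iN (i : 'I_n) : (1 <= n - i <= n)%N by have := ltn_ord i; lia.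
have iM (i : 'I_n) : (n <= 2 * n - (n - i) <= (2 * n).-1)%N by have := ltn_ord i; lia.
have kap0 b k : kap b k != 0.
  by rewrite /kap fmorph_eq0 falling_diag_neq0.
split.
- rewrite upE umE -(E_left R) -(E_right R); split=> [f df|f g df dg].
    split=> [m mn|j jn].
      by split; exact: (quasi_ccvg C hal hbe hn).
    by split; exact: (bracket_u_ccvg hal hbe hn hC hfam).
  have [h1 _] := bracket_at_pairing hal hbe hn hC hfam false df dg.
  by have [h2 _] := bracket_at_pairing hal hbe hn hC hfam true df dg.
- move=> a f g df dg; rewrite !G0E !G1E !scale_col_mx !add_col_mx.
  split; congr col_mx; apply/colP => i; rewrite !mxE.
  + by rewrite /qa (quasi_at_lin _ hal hbe hn) // opprD mulrN.
  + by rewrite /qa (quasi_at_lin _ hal hbe hn).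
  + by rewrite /br (bracket_at_lin hal hbe hn hC hfam) // mulrDr mulrCA.
  + by rewrite /br (bracket_at_lin hal hbe hn hC hfam) // mulrDr mulrCA.
- move=> z0 z1.
  (* Re-indexing by k = n - i; the default value 0 is not reached for 1 <= k <= n. *)
  pose zz (z : 'cV[R[i]]_(n + n)) (b : bool) k : R[i] :=
    if insub (n - k)%N is Some i then z (if b then lshift n i else rshift n i) 0 else 0.
  have zzE z b (i : 'I_n) : zz z b (n - i)%N = z (if b then lshift n i else rshift n i) 0.
    rewrite /zz; have -> : (n - (n - i))%N = i by have := ltn_ord i; lia.
    by rewrite valK.
  (* Gamma0 carries a minus sign at -1 only. *)
  pose Y b k := if b then - zz z0 b k else zz z0 b k.
  have [f [df hf0]] := boundary_onto hal hbe hn hC hfam (fun b k => zz z1 b k / kap b k) Y.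
  have hf b k : (1 <= k <= n)%N ->
    br b f (u b k) = zz z1 b k / kap b k /\ qa b (2 * n - k)%N f = Y b k := hf0 b k.
  exists f; split=> //.
    rewrite G0E -[RHS]vsubmxK; congr col_mx; apply/colP => i; rewrite !mxE.
      by have [_ ->] := hf true _ (iN i); rewrite /Y zzE opprK.
    by have [_ ->] := hf false _ (iN i); rewrite /Y zzE.
  rewrite G1E -[RHS]vsubmxK; congr col_mx; apply/colP => i; rewrite !mxE.
    by have [-> _] := hf true _ (iN i); rewrite zzE mulrC divfK.
  by have [-> _] := hf false _ (iN i); rewrite zzE mulrC divfK.
- move=> f g df dg; rewrite brpE brmE; split; first exact: (green hal hbe hn hC hfam).
  have termE (K : R) (p q r s : R[i]) : K%:C * (p * q^*%C - r * s^*%C) =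
      K%:C * p * q^*%C - r * (K%:C * s)^*%C.
    by case: p; case: q; case: r; case: s => *; apply: complex_eq; rewrite /=; ring.
  (* At -1 the bracket is subtracted; the minus sign in the upper half of Gamma0 absorbs this. *)
  have termN (K : R) (p q r s : R[i]) : - (K%:C * (p * q^*%C - r * s^*%C)) =
      K%:C * p * (- q)^*%C - (- r) * (K%:C * s)^*%C.
    by case: p; case: q; case: r; case: s => *; apply: complex_eq; rewrite /=; ring.
  have [_ e1] := bracket_at_pairing hal hbe hn hC hfam false df dg.
  have [_ e2] := bracket_at_pairing hal hbe hn hC hfam true df dg.
  rewrite /cdot !big_split_ord /= !G0E !G1E opprD addrACA -!sumrB addrC.
  rewrite /br e1 e2 !sum_ord_rev -sumrN; congr (_ + _); apply: eq_bigr => i _.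
    by rewrite !col_mxEd !mxE termE.
  by rewrite !col_mxEu !mxE termN.
Qed.
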